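(* Let $(\theta_n,\mu_n)_{n\ge 0}$ be the joint dual averaging iterates with importance sampling defined in the context. Assume: (a) $f:\Theta\to\mathbb R$ is convex, continuously differentiable, and twice continuously differentiable in a neighborhood of $\theta^\star$; the problem $\min_{\theta\in\Theta} f(\theta)$ has a unique minimizer $\theta^\star$, and $\nabla^2 f(\theta^\star)$ is symmetric positive definite; $\Theta$ is bounded. (b) For every $x\in\mathbb R^r$ the function $\mu\mapsto \ell(x,\mu)$ is logarithmically convex and differentiable. (c) The problem $\min_{\mu\in\mathcal M} v(\theta^\star,\mu)$ has a unique minimizer $\mu^\star$, and $\nabla^2_\mu v(\theta^\star,\mu^\star)$ is symmetric positive definite; $\mathcal M$ is bounded; there are constants $G_M,H_M<\infty$ such that for all $\theta\in\Theta$, $\mu\in\mathcal M$: $\mathbb E_{X\sim\mathbb P}[\|G(\theta,X)\|^2\ell(X,\mu)]\le G_M^2$ and $\mathbb E_{X\sim\mathbb P}[\|P_{A_a^\theta}G(\theta,X)\|^4\|\nabla_\mu\ell(X,\mu)\|^2]\le H_M^2$. (d) There is $c_1>0$ such that for all $\theta\in\Theta$, $\mu\in\mathcal M$: $f(\theta)-f(\theta^\star)\ge c_1\|\theta-\theta^\star\|^2$ and $v(\theta^\star,\mu)-v(\theta^\star,\mu^\star)\ge c_1\|\mu-\mu^\star\|^2$. There are $c_2,c_3<\infty$ such that for all $\theta\in\Theta$, $\mu\in\mathcal M$: $\|\nabla f(\theta)-\nabla f(\theta^\star)\|\le c_2\|\theta-\theta^\star\|$ and $\|\nabla_\mu v(\theta^\star,\mu)-\nabla_\mu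 v(\theta^\star,\mu^\star)\|\le c_2\|\mu-\mu^\star\|$; and $\|\nabla_\mu v(\theta,\mu)-\nabla_\mu v(\theta^\star,\mu)\|\le c_3\|\theta-\theta^\star\|^2$ for all $\mu\in\mathcal M$ and all $\theta\in\Theta$ with $A_a^\star\theta=b_a^\star$, $A_i^\star\theta<b_i^\star$. (e) $-\nabla f(\theta^\star)=A_a^{\star\top}\lambda_1$ for some $\lambda_1\in\mathbb R^{p_1}_{++}$ and $-\nabla_\mu v(\theta^\star,\mu^\star)=C_a^{\star\top}\lambda_2$ for some $\lambda_2\in\mathbb R^{p_2}_{++}$. Then there exists an almost surely finite random $N$ such that for all $n\ge N$: $A_a^\star\theta_n=b_a^\star$, $A_i^\star\theta_n<b_i^\star$, $C_a^\star\mu_n=d_a^\star$ and $C_i^\star\mu_n<d_i^\star$.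
   Context: Notation: $\|\cdot\|$ is the Euclidean norm; $\mathbb R_{++}=\{x\in\mathbb R:x>0\}$; $B^\dagger$ is the Moore–Penrose pseudoinverse of $B$; vector inequalities are componentwise. Setup. $\Theta=\{\theta\in\mathbb R^s: A\theta\le b\}$ with $A\in\mathbb R^{p\times s}$, $b\in\mathbb R^p$, and $\mathcal M=\{\mu\in\mathbb R^m: C\mu\le d\}$ for a matrix $C$ and vector $d$. $\mathbb P$ is a probability distribution on $\mathcal X\subseteq\mathbb R^r$, $F:\mathbb R^s\times\mathbb R^r\to\mathbb R$, $f(\theta)=\mathbb E_{X\sim\mathbb P}[F(\theta,X)]$, $G(\theta,x)=\nabla_\theta F(\theta,x)$, and $\nabla f(\theta)=\mathbb E_{X\sim\mathbb P}[G(\theta,X)]$. $(\mathbb P_\mu)_{\mu\in\mathcal M}$ is a family of probability distributions with $\mathbb P\ll\mathbb P_\mu$ (the importance sampling family), with likelihood ratio $\ell(x,\mu)=\frac{d\mathbb P}{d\mathbb P_\mu}(x)$; put $G_\mu(\theta,x)=\ell(x,\mu)G(\theta,x)$. Active constraints. For $\theta\in\Theta$, $A_a^\theta,b_a^\theta$ (resp. $A_i^\theta,b_i^\theta$) collect the rows of $A$, entries of $b$ of the constraints that are active, $A_a^\theta\theta=b_a^\theta$ (resp. inactive, $A_i^\theta\theta<b_i^\theta$). For $\theta=\theta^\star$ write $A_a^\star,b_a^\star,A_i^\star,b_i^\star$; $p_1$ is the dimension of $b_a^\star$. Similarly $C_a^\star,d_a^\star$ (resp. $C_i^\star,d_i^\star$)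 are the active (resp. inactive) parts of $C,d$ at $\mu^\star$: $C_a^\star\mu^\star=d_a^\star$, $C_i^\star\mu^\star<d_i^\star$; $p_2$ is the dimension of $d_a^\star$. For a matrix $B$, $P_B=I-B^\top(BB^\top)^\dagger B$ is the orthogonal projector onto $\mathrm{Ker}(B)$ (and $P_B=I$ if $B$ has no rows). Importance sampling objective. $v(\theta,\mu)=\mathbb E_{X\sim\mathbb P}[\|P_{A_a^\theta}G(\theta,X)\|^2\ell(X,\mu)]$ and $H(\theta,\mu,x)=\|P_{A_a^\theta}G(\theta,x)\|^2\nabla_\mu\ell(x,\mu)$. Algorithm. Let $\alpha_n=\alpha/n^\gamma$ ($n\ge1$) with $\alpha>0$, $\gamma\in(1/2,1)$, and let $(\theta_0,\mu_0)\in\Theta\times\mathcal M$ be deterministic. For $n\ge0$, $$(\theta_{n+1},\mu_{n+1})=\arg\min_{(\theta,\mu)\in\Theta\times\mathcal M}\Big\{\sum_{k=0}^n\alpha_{k+1}\big(\langle G_k,\theta\rangle+\langle H_k,\mu\rangle\big)+\tfrac12\|\theta-\theta_0\|^2+\tfrac12\|\mu-\mu_0\|^2\Big\},$$ where $G_k=G_{\mu_k}(\theta_k,X_{k+1}^{(\mu_k)})$, $H_k=H(\theta_k,\mu_k,X_{k+1})$, $\mathcal F_n=\sigma(X_k^{(\mu_{k-1})},X_k: k\le n)$, and, conditionally on $\mathcal F_k$, $X_{k+1}^{(\mu_k)}\sim\mathbb P_{\mu_k}$ and $X_{k+1}\sim\mathbb P$ are independent. *)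

(* Defs.v *)
From HB Require Import structures.
From mathcomp Require Import all_boot all_order all_algebra.
From mathcomp Require Import all_classical all_reals all_analysis.
From mathcomp Require Import measurable_realfun.

Set Implicit Arguments.
Unset Strict Implicit.
Unset Printing Implicit Defensive.

Import Order.TTheory GRing.Theory Num.Theory.
Import numFieldNormedType.Exports.

Local Open Scope classical_set_scope.
Local Open Scope ring_scope.

(* The norm that the library puts on matrices is the sup norm (it induces the
   same topology, bounded sets and derivatives); [enorm] is the Euclidean one. *)
Definition dotp (R : realType) (n : nat) (u v : 'cV[R]_n) : R :=
  \sum_(i < n) u i 0 * v i 0.

Definition enorm (R : realType) (n : nat) (u : 'cV[R]_n) : R :=
  Num.sqrt (dotp u u).

Definition vlt (R : realType) (n : nat) (u v : 'cV[R]_n) : Prop :=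
  forall i, u i 0 < v i 0.

Definition vle (R : realType) (n : nat) (u v : 'cV[R]_n) : Prop :=
  forall i, u i 0 <= v i 0.

Definition sym_posdef (R : realType) (n : nat) (S : 'M[R]_n) : Prop :=
  S^T = S /\ forall u : 'cV[R]_n, u != 0 -> 0 < (u^T *m S *m u) 0 0.

Definition penrose (R : realType) (m n : nat)
    (B : 'M[R]_(m, n)) (X : 'M[R]_(n, m)) : Prop :=
  [/\ B *m X *m B = B, X *m B *m X = X,
      (B *m X)^T = B *m X & (X *m B)^T = X *m B].

Definition mp_pinv (R : realType) (m n : nat) (B : 'M[R]_(m, n)) :
  'M[R]_(n, m) := xget 0 [set X | penrose B X].

Definition ker_proj (R : realType) (m n : nat) (B : 'M[R]_(m, n)) : 'M[R]_n :=
  1%:M - B^T *m mp_pinv (B *m B^T) *m B.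

Lemma mulmx_tr_eq0 (R : realType) (n : nat) (u : 'rV[R]_n) :
  u *m u^T = 0 -> u = 0.
Proof.
move=> /matrixP /(_ 0 0); rewrite !mxE => /eqP.
rewrite psumr_eq0 => [/allP u0|i _]; last by rewrite mxE -expr2 sqr_ge0.
apply/rowP => i; rewrite mxE.
have := u0 i (mem_index_enum i); rewrite /= mxE mulf_eq0 orbb.
by move/eqP.
Qed.

Lemma row_free_gram_unit (R : realType) (k n : nat) (X : 'M[R]_(k, n)) :
  row_free X -> X *m X^T \in unitmx.
Proof.
move=> Xfree; rewrite -row_free_unit -kermx_eq0; apply/eqP/row_matrixP => i.
rewrite row0; set u := row i _.
have uXX : u *m (X *m X^T) = 0.
  by rewrite /u -row_mul mulmx_ker row0.
have uX : u *m X = 0.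
  by apply: mulmx_tr_eq0; rewrite trmx_mul -mulmxA (mulmxA X) mulmxA uXX mul0mx.
by apply: (row_free_inj Xfree); rewrite uX mul0mx.
Qed.

Lemma penrose_ex (R : realType) (m n : nat) (B : 'M[R]_(m, n)) :
  exists X, penrose B X.
Proof.
have [k [L [U [-> uU uL]]]] : exists k (L : 'M[R]_(m, k)) (U : 'M[R]_(k, n)),
    [/\ B = L *m U, U *m U^T \in unitmx & L^T *m L \in unitmx].
  exists (\rank B), (col_base B), (row_base B); split.
  - by rewrite mulmx_base.
  - exact/row_free_gram_unit/row_base_free.
  - rewrite -{2}(trmxK (col_base B)); apply: row_free_gram_unit.
    by rewrite /row_free mxrank_tr; exact: col_base_full.
pose U' := U^T *m invmx (U *m U^T); pose L' := invmx (L^T *m L) *m L^T.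
have UU' : U *m U' = 1%:M by rewrite /U' mulmxA mulmxV.
have L'L : L' *m L = 1%:M by rewrite /L' -mulmxA mulVmx.
have BX : L *m U *m (U' *m L') = L *m L'.
  by rewrite mulmxA -(mulmxA L U) UU' mulmx1.
have XB : U' *m L' *m (L *m U) = U' *m U.
  by rewrite mulmxA -(mulmxA U' L') L'L mulmx1.
exists (U' *m L'); split.
- by rewrite BX mulmxA -(mulmxA L L') L'L mulmx1.
- by rewrite XB mulmxA -(mulmxA U' U) UU' mulmx1.
- by rewrite BX /L' !trmx_mul trmx_inv !trmx_mul !trmxK mulmxA.
- by rewrite XB /U' !trmx_mul trmx_inv !trmx_mul !trmxK mulmxA.
Qed.

Lemma penrose_uniq (R : realType) (m n : nat) (B : 'M[R]_(m, n)) X Y :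
  penrose B X -> penrose B Y -> X = Y.
Proof.
case=> X1 X2 X3 X4 [Y1 Y2 Y3 Y4].
have eBX : B *m X = B *m Y.
  have e : B *m Y *m (B *m X) = B *m X by rewrite mulmxA Y1.
  by rewrite -e -Y3 -X3 -trmx_mul mulmxA X1.
have eXB : X *m B = Y *m B.
  have e : X *m B *m (Y *m B) = X *m B by rewrite -!mulmxA (mulmxA B) Y1.
  by rewrite -e -X4 -Y4 -trmx_mul -!mulmxA (mulmxA B) X1.
by rewrite -X2 eXB -mulmxA eBX mulmxA Y2.
Qed.

Lemma mp_pinvP (R : realType) (m n : nat) (B : 'M[R]_(m, n)) :
  penrose B (mp_pinv B).
Proof. by apply: xgetPex; exact: penrose_ex. Qed.

Definition polyhedron (R : realType) (p n : nat)
    (A : 'M[R]_(p, n)) (b : 'cV[R]_p) : set 'cV[R]_n :=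
  [set t | vle (A *m t) b].

Definition active (R : realType) (p n : nat)
    (A : 'M[R]_(p, n)) (b : 'cV[R]_p) (t : 'cV[R]_n) : {set 'I_p} :=
  [set i | (A *m t) i 0 == b i 0].

(* the rows of [B] whose index lies in [I], in increasing order *)
Definition subrows (R : realType) (p n : nat)
    (I : {set 'I_p}) (B : 'M[R]_(p, n)) : 'M[R]_(#|I|, n) :=
  rowsub (fun k : 'I_#|I| => enum_val k) B.

Definition act_mx (R : realType) (p n : nat)
    (A : 'M[R]_(p, n)) (b : 'cV[R]_p) (t : 'cV[R]_n) :=
  subrows (active A b t) A.

Definition act_rhs (R : realType) (p n : nat)
    (A : 'M[R]_(p, n)) (b : 'cV[R]_p) (t : 'cV[R]_n) :=
  subrows (active A b t) b.

Definition inact_mx (R : realType) (p n : nat)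
    (A : 'M[R]_(p, n)) (b : 'cV[R]_p) (t : 'cV[R]_n) :=
  subrows (~: active A b t) A.

Definition inact_rhs (R : realType) (p n : nat)
    (A : 'M[R]_(p, n)) (b : 'cV[R]_p) (t : 'cV[R]_n) :=
  subrows (~: active A b t) b.

(* the constraints active (resp. inactive) at [t0] are active (resp. inactive)
   at [t] *)
Definition same_active (R : realType) (p n : nat)
    (A : 'M[R]_(p, n)) (b : 'cV[R]_p) (t0 t : 'cV[R]_n) : Prop :=
  act_mx A b t0 *m t = act_rhs A b t0 /\
  vlt (inact_mx A b t0 *m t) (inact_rhs A b t0).

Definition argmin (R : realType) (T : Type) (S : set T) (g : T -> R) : set T :=
  [set x | S x /\ forall y, S y -> g x <= g y].

(* Gradients and Hessians are those of the ambient space, also at boundary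
   points of a feasible set: the functions below are total, and the values
   taken off the feasible set only matter through these derivatives. [grad] and
   [hess] are meaningful under [gdifferentiable], [twice_differentiable]. *)
Definition grad (R : realType) (n : nat) (g : 'cV[R]_n -> R) (t : 'cV[R]_n) :
  'cV[R]_n := \col_(i < n) 'D_(delta_mx i 0) (g : _ -> R^o) t.

Definition hess (R : realType) (n : nat) (g : 'cV[R]_n -> R) (t : 'cV[R]_n) :
  'M[R]_n :=
  \matrix_(i < n, j < n) 'D_(delta_mx j 0) (fun u => grad g u i 0 : R^o) t.

Definition gdifferentiable (R : realType) (n : nat)
    (g : 'cV[R]_n -> R) (t : 'cV[R]_n) : Prop :=
  differentiable (g : _ -> R^o) t.

Definition twice_differentiable (R : realType) (n : nat)
    (g : 'cV[R]_n -> R) (t : 'cV[R]_n) : Prop :=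
  (\forall u \near t, gdifferentiable g u) /\ differentiable (grad g) t.

Definition C1_on (R : realType) (n : nat) (S : set 'cV[R]_n)
    (g : 'cV[R]_n -> R) : Prop :=
  (forall t, S t -> gdifferentiable g t) /\ {within S, continuous (grad g)}.

Definition C2_near (R : realType) (n : nat)
    (g : 'cV[R]_n -> R) (t : 'cV[R]_n) : Prop :=
  \forall u \near t, twice_differentiable g u /\ {for u, continuous (hess g)}.

(* [g] is nonnegative and ln \o g is convex on [S], with ln 0 = -oo *)
Definition log_convex_on (R : realType) (n : nat) (S : set 'cV[R]_n)
    (g : 'cV[R]_n -> R) : Prop :=
  (forall u, S u -> 0 <= g u) /\
  forall (t : R) u w, 0 < t < 1 -> S u -> S w ->
    (lne (g (t *: u + (1 - t) *: w))%:E <=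
     t%:E * lne (g u)%:E + (1 - t)%:E * lne (g w)%:E)%E.

(* R^n with its Borel sigma-algebra *)
Notation borel_cV R n := (g_sigma_algebraType (@open 'cV[R]_n)).

(* [g] is a version of the conditional probability of [E] given the
   sigma-algebra [S] *)
Definition cond_prob_version (d : measure_display) (T : measurableType d)
    (R : realType) (Q : probability T R) (S : set (set T)) (E : set T)
    (g : T -> \bar R) : Prop :=
  measurable_fun setT (g : g_sigma_algebraType S -> \bar R) /\
  (forall A, S A -> Q (A `&` E) = \int[Q]_(w in A) g w)%E.

(* sigma(Y_k, X_k : 1 <= k <= n) *)
Definition history (d : measure_display) (T : measurableType d)
    (d' : measure_display) (E : measurableType d')
    (Y X : nat -> T -> E) (n : nat) : set (set T) :=
  <<s [set A | exists k (B : set E), [/\ (1 <= k <= n)%N, measurable B &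
        A = Y k @^-1` B \/ A = X k @^-1` B]] >>.

Definition f_obj (R : realType) (s r : nat) (P : probability (borel_cV R r) R)
    (F : 'cV[R]_s -> 'cV[R]_r -> R) (t : 'cV[R]_s) : R :=
  \int[P]_x F t x.

Definition G_fun (R : realType) (s r : nat) (F : 'cV[R]_s -> 'cV[R]_r -> R)
    (t : 'cV[R]_s) (x : 'cV[R]_r) : 'cV[R]_s :=
  grad (fun u => F u x) t.

Definition Gmu_fun (R : realType) (s r m : nat)
    (F : 'cV[R]_s -> 'cV[R]_r -> R) (ell : 'cV[R]_r -> 'cV[R]_m -> R)
    (mu : 'cV[R]_m) (t : 'cV[R]_s) (x : 'cV[R]_r) : 'cV[R]_s :=
  ell x mu *: G_fun F t x.

Definition PG_fun (R : realType) (p s r : nat)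
    (A : 'M[R]_(p, s)) (b : 'cV[R]_p) (F : 'cV[R]_s -> 'cV[R]_r -> R)
    (t : 'cV[R]_s) (x : 'cV[R]_r) : 'cV[R]_s :=
  ker_proj (act_mx A b t) *m G_fun F t x.

Definition v_obj (R : realType) (p s r m : nat)
    (A : 'M[R]_(p, s)) (b : 'cV[R]_p) (P : probability (borel_cV R r) R)
    (F : 'cV[R]_s -> 'cV[R]_r -> R) (ell : 'cV[R]_r -> 'cV[R]_m -> R)
    (t : 'cV[R]_s) (mu : 'cV[R]_m) : R :=
  \int[P]_x (enorm (PG_fun A b F t x) ^+ 2 * ell x mu).

Definition H_fun (R : realType) (p s r m : nat)
    (A : 'M[R]_(p, s)) (b : 'cV[R]_p)
    (F : 'cV[R]_s -> 'cV[R]_r -> R) (ell : 'cV[R]_r -> 'cV[R]_m -> R)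
    (t : 'cV[R]_s) (mu : 'cV[R]_m) (x : 'cV[R]_r) : 'cV[R]_m :=
  enorm (PG_fun A b F t x) ^+ 2 *: grad (ell x) mu.

Definition step (R : realType) (alpha gamma : R) (n : nat) : R :=
  alpha / n%:R `^ gamma.

Definition da_objective (R : realType) (s m : nat) (a : nat -> R)
    (t0 : 'cV[R]_s) (mu0 : 'cV[R]_m)
    (g : nat -> 'cV[R]_s) (h : nat -> 'cV[R]_m) (n : nat)
    (z : 'cV[R]_s * 'cV[R]_m) : R :=
  \sum_(0 <= k < n.+1) a k.+1 * (dotp (g k) z.1 + dotp (h k) z.2)
  + 2^-1 * enorm (z.1 - t0) ^+ 2 + 2^-1 * enorm (z.2 - mu0) ^+ 2.

(* Main.v *)
(** Write [z_n] for the dual iterate, so that the primal iterate is the Euclidean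
    projection [x_n] of [z_n] on a polyhedron [K] with solution [x*].  The energy
    [|z_n - x*|^2 - |z_n - x_n|^2] dominates [|x_n - x*|^2] and decreases along
    the iterations up to noise terms that are summable almost surely: martingale
    increments with square-summable variances (stopped partial sums and
    Chebyshev's inequality) and squared steps.  When [x_n] is close to [x*], its
    active constraints are active at [x*], so [z_n - x_n] is orthogonal to
    [x_n - x*] and the energy is exactly [|x_n - x*|^2]; hence [x_n] tends to [x*].

    Dividing [z_n] by the sum [S_n] of the steps averages the gradients, so
    [(z_n - x_n) / S_n] tends to [B^T lambda] with [lambda > 0], where [B] is the
    matrix of the constraints active at [x*].  Since [z_n - x_n] is orthogonal to
    [x_n - x*] and to [ker B], pairing with [x_n - x*] shows that a combination
    of the slacks with coefficients tending to [lambda] vanishes, so all the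
    slacks vanish eventually.

    This applies first to [theta].  Once [theta_n] has the right active set, the
    bias of the gradient of [v(theta_n, .)] is [O(|theta_n - theta*|^2)], which is
    summable against the steps, and the argument applies to [mu].  The mean of
    [H] agrees with the gradient of [v] only along [M - M] (log-convexity and
    dominated convergence along feasible segments), which is all that a
    projection on [M] can see. *)

Require Import Defs.
From HB Require Import structures.
From mathcomp Require Import all_boot all_order all_algebra.
From mathcomp Require Import all_classical all_reals all_analysis.
From mathcomp Require Import measurable_realfun.
From mathcomp Require Import giry ring lra.

Set Implicit Arguments.
Unset Strict Implicit.
Unset Printing Implicit Defensive.

Import Order.TTheory GRing.Theory Num.Theory.
Import numFieldNormedType.Exports.

Local Open Scope classical_set_scope.
Local Open Scope ring_scope.

(** * Integration against conditional laws *)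

(** The index from which [theta] has the right active set depends on the whole path and need not be
    a stopping time. So nothing probabilistic happens after it: the almost sure statements about the
    noise concern whole series, from index 0, and the rest is done on one fixed path, where the
    descent inequality is only required from some [n0] on.

    Conditioning is expressed by kernels. The conditional law of the draws is given on events; it is
    extended to functions of the past and of the new draw by viewing the past as the identity map
    onto the same space with a coarser sigma-algebra. Boundedness of the feasible sets lets the
    coordinates of [x_n - x*], which are known given the past, multiply the noise while its second
    moment stays bounded.

    Of the two bounds on [gamma], [2^-1 < gamma] makes the squared steps summable and [gamma < 1]
    makes the sum of the steps diverge. *)

Section disintegration.
Local Open Scope ereal_scope.
Context d d1 d' (T : measurableType d) (T1 : measurableType d1)
  (E : measurableType d') (R : realType).
Variables (Q : probability T R) (proj : T -> T1) (Z : T -> E).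
Variable kappa : T1 -> probability E R.
Hypothesis mproj : measurable_fun setT proj.
Hypothesis mZ : measurable_fun setT Z.
Hypothesis mkappa : forall B, measurable B ->
  measurable_fun setT (fun w => kappa w B).
Hypothesis kappaE : forall A B, measurable A -> measurable B ->
  Q (proj @^-1` A `&` Z @^-1` B) = \int[Q]_(w in proj @^-1` A) kappa (proj w) B.

Let kap (w : T1) : giry E R := kappa w.

Let mkap : measurable_fun setT kap.
Proof. exact: measurable_giry_codensity. Qed.

Let cond_law (w : T) : giry (T1 * E)%type R :=
  giry_prod (giry_ret (proj w), kap (proj w)).

Let mcond_law : measurable_fun setT cond_law.
Proof.
apply: (measurableT_comp (measurable_giry_prod (R := R))).
apply/measurable_fun_pairP; split; last exact: (measurableT_comp mkap).
by apply: (measurableT_comp (@measurable_giry_ret _ T1 R)); exact: mproj.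
Qed.

Let Qg : giry T R := Q.

Let mprojZ : measurable_fun setT (fun w => (proj w, Z w)).
Proof. exact/measurable_fun_pairP. Qed.

Let cond_int (h : T1 * E -> \bar R) (w : T) :
  measurable_fun setT h -> (forall z, 0 <= h z) ->
  giry_int (cond_law w) h = \int[kappa (proj w)]_y h (proj w, y).
Proof.
move=> mh h0; rewrite giry_int_prod1// giry_int_ret//.
by apply: measurable_fun_fubini_tonelli_F.
Qed.

Lemma measurable_fun_kernel_int (h : T1 * E -> \bar R) :
  measurable_fun setT h -> (forall z, 0 <= h z) ->
  measurable_fun setT (fun w => \int[kappa w]_y h (w, y)).
Proof.
move=> mh h0.
have m2 : measurable_fun setT (fun w : T1 =>
    giry_prod (giry_ret w, kap w) : giry (T1 * E)%type R).
  apply: (measurableT_comp (measurable_giry_prod (R := R))).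
  by apply/measurable_fun_pairP; split => //; exact: (@measurable_giry_ret _ T1 R).
have := measurableT_comp (measurable_giry_int mh h0) m2.
congr measurable_fun; apply/funext => w /=.
rewrite giry_int_prod1// giry_int_ret//.
by apply: measurable_fun_fubini_tonelli_F.
Qed.

(** Both sides integrate [h], one against the law of [(proj, Z)], the other against the mixture
    under [Q] of the products of a Dirac mass at [proj w] with [kappa (proj w)]. By [kappaE] these
    two measures agree on measurable rectangles, which are stable under intersection and generate
    the product sigma-algebra. *)
Lemma ge0_integral_disintegration (h : T1 * E -> \bar R) :
  measurable_fun setT h -> (forall z, 0 <= h z) ->
  \int[Q]_w h (proj w, Z w) = \int[Q]_w \int[kappa (proj w)]_y h (proj w, y).
Proof.
move=> mh h0.
transitivity (giry_int (giry_map mprojZ Qg) h); first by rewrite giry_int_map.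
transitivity (giry_int (giry_bind Qg mcond_law) h); last first.
  by rewrite giry_int_bind//; apply: eq_integral => w _; rewrite cond_int.
apply: eq_measure_integral => X mX _.
pose C : set (set (T1 * E)) :=
  [set A `*` B | A in measurable & B in measurable].
have CI : setI_closed C.
  move=> _ _ [X1 mX1 [X2 mX2 <-]] [Y1 mY1 [Y2 mY2 <-]].
  exists (X1 `&` Y1); first exact: measurableI.
  by exists (X2 `&` Y2); [exact: measurableI|rewrite setXI].
apply: (measure_unique C (fun=> setT)) => //.
- exact: measurable_prod_measurableType.
- by move=> _; exists setT => //; exists setT => //; rewrite setXTT.
- by rewrite bigcup_const.
- move=> _ [A mA [B mB <-]].
  have mAB : measurable (A `*` B) by exact: measurableX.
  transitivity (\int[Q]_w cond_law w (A `*` B)); last first.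
    transitivity (giry_int (giry_bind Qg mcond_law)
        (fun z => (\1_(A `*` B) z)%:E)); last first.
      by rewrite /giry_int integral_indic// setIT.
    rewrite giry_int_bind//; last exact/measurable_EFinP.
    by apply: eq_integral => w _; rewrite /giry_int integral_indic// setIT.
  transitivity (\int[Q]_w ((\1_A (proj w))%:E * kappa (proj w) B)).
    rewrite -[LHS]/(Q (proj @^-1` A `&` Z @^-1` B)) kappaE//.
    rewrite integral_mkcond; apply: eq_integral => w _.
    have memE : (w \in proj @^-1` A) = (proj w \in A).
      by apply/idP/idP => /[!inE].
    rewrite patchE indicE /= memE.
    by case: ifPn => _; rewrite ?mul1e ?mul0e.
  apply: eq_integral => w _.
  rewrite -[RHS]/((\d_(proj w) \x kappa (proj w)) (A `*` B)).
  by rewrite product_measure1E.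
- move=> _ /=.
  by rewrite -[X in X < _]/(Q setT) probability_setT ltry.
Qed.

End disintegration.

(** * Square-integrable martingales *)

Section square_integrable.
Local Open Scope ereal_scope.
Context d (T : measurableType d) (R : realType) (Q : {measure set T -> \bar R}).
Implicit Types f g : T -> R.

Lemma ge0_integrable f : measurable_fun setT f -> (forall w, 0 <= f w)%R ->
  \int[Q]_w (f w)%:E < +oo -> Q.-integrable setT (fun w => (f w)%:E).
Proof.
move=> mf f0 foo; apply/integrableP; split; first exact/measurable_EFinP.
by under eq_integral do rewrite gee0_abs ?lee_fin ?f0//.
Qed.

Lemma sqr_integrable f : measurable_fun setT f ->
  \int[Q]_w (f w ^+ 2)%:E < +oo -> Q.-integrable setT (fun w => (f w ^+ 2)%:E).
Proof.
move=> mf foo; apply: ge0_integrable => //.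
  exact: measurable_funX.
by move=> w; exact: sqr_ge0.
Qed.

Lemma mul_integrable f g : measurable_fun setT f -> measurable_fun setT g ->
  Q.-integrable setT (fun w => (f w ^+ 2)%:E) ->
  Q.-integrable setT (fun w => (g w ^+ 2)%:E) ->
  Q.-integrable setT (fun w => (f w * g w)%:E).
Proof.
move=> mf mg f2 g2; apply: (le_integrable measurableT _ _ (integrableD measurableT f2 g2)).
  by apply/measurable_EFinP; exact: measurable_funM.
move=> w _ /=; rewrite lee_fin [leRHS]ger0_norm ?addr_ge0 ?sqr_ge0// normrM.
by rewrite -(real_normK (num_real (f w))) -(real_normK (num_real (g w))); nra.
Qed.

Lemma chebyshev_sqr f (a : R) : measurable_fun setT f -> (0 < a)%R ->
  (a ^+ 2)%:E * Q [set w | a <= `|f w|]%R <= \int[Q]_w (f w ^+ 2)%:E.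
Proof.
move=> mf a0.
have mA : measurable [set w | a <= `|f w|]%R.
  have := measurable_fun_ler (measurable_cst a)
    (measurableT_comp (@normr_measurable R setT) mf).
  by move=> /(_ measurableT [set true] I); rewrite setTI.
rewrite -integral_cst// integral_mkcond; apply: ge0_le_integral => //.
- by move=> w _; rewrite patchE; case: ifP => // _; rewrite lee_fin sqr_ge0.
- by have [h _] := measurable_restrictT (cst (a ^+ 2)%:E) mA; exact: h.
- by apply/measurable_EFinP; exact: measurable_funX.
move=> w _; rewrite patchE; case: ifPn => [|_]; last by rewrite lee_fin sqr_ge0.
rewrite inE /= => afw; rewrite lee_fin -(real_normK (num_real (f w))).
by rewrite ler_sqr ?nnegrE ?(ltW a0).
Qed.

End square_integrable.

Section l2_martingale.
Context d (T : measurableType d) (R : realType) (Q : probability T R).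
Variables (H : nat -> set (set T)) (D : nat -> T -> R) (e : nat -> R).
Hypothesis HT : forall n, H n `<=` measurable.
Hypothesis HS : forall n, H n `<=` H n.+1.
Hypothesis mD : forall k,
  measurable_fun setT (D k : g_sigma_algebraType (H k.+1) -> R).
Hypothesis De : forall k, (\int[Q]_w (D k w ^+ 2)%:E <= (e k)%:E)%E.
Hypothesis ecvg : cvgn (series e).
Hypothesis ortho : forall k (eta : T -> R),
  measurable_fun setT (eta : g_sigma_algebraType (H k) -> R) ->
  (\int[Q]_w (eta w ^+ 2)%:E < +oo -> \int[Q]_w (eta w * D k w)%:E = 0)%E.

Lemma measurable_fun_history_le d' (E : measurableType d') k n (f : T -> E) :
  (k <= n)%N ->
  measurable_fun setT (f : g_sigma_algebraType (H k) -> E) ->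
  measurable_fun setT (f : g_sigma_algebraType (H n) -> E).
Proof.
move=> kn mf _ B mB; have Hkn : H k `<=` H n.
  elim: n kn => [|n IH]; first by rewrite leqn0 => /eqP ->.
  by rewrite leq_eqVlt => /predU1P[->//|/IH Hn] X /Hn; exact: HS.
by have := mf measurableT _ mB; exact: sub_smallest2r.
Qed.

Lemma measurable_fun_history d' (E : measurableType d') k (f : T -> E) :
  measurable_fun setT (f : g_sigma_algebraType (H k) -> E) ->
  measurable_fun setT f.
Proof.
move=> mf _ B mB; have := mf measurableT _ mB.
by apply: smallest_sub => //; exact: sigma_algebra_measurable.
Qed.


Let sigF k := g_sigma_algebraType (H k).

Let e_ge0 k : 0 <= e k.
Proof.
rewrite -lee_fin; apply: le_trans (De k).
by apply: integral_ge0 => w _; rewrite lee_fin sqr_ge0.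
Qed.

Let mDT k : measurable_fun setT (D k).
Proof. exact: (measurable_fun_history (@mD k)). Qed.

Let D2 k : Q.-integrable setT (fun w => (D k w ^+ 2)%:E).
Proof.
apply: sqr_integrable => //; apply: le_lt_trans (De k) _.
by rewrite ltry.
Qed.

(* the partial sums from [m] on, frozen once they have reached modulus [a] *)
Fixpoint stopped (m : nat) (a : R) (n : nat) (w : T) : R :=
  if n is n'.+1 then
    stopped m a n' w + (if `|stopped m a n' w| < a then D (m + n') w else 0)
  else 0.

Let mstopped m a n : measurable_fun setT (stopped m a n : sigF (m + n) -> R).
Proof.
elim: n => [|n IH]; first exact: measurable_cst.
rewrite addnS; apply: measurable_funD.
  exact: (measurable_fun_history_le (leqnSn _)).
apply: measurable_fun_ifT; [|exact: mD|exact: measurable_cst].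
apply: (measurable_fun_history_le (leqnSn _)).
apply: measurable_fun_ltr; last exact: measurable_cst.
exact: measurableT_comp.
Qed.

(** Expanding the square of the next frozen sum leaves a cross term that pairs [D (m + n)] with
    [eta]. As [eta] only depends on the past, [ortho] kills it and the second moments add up.
    Freezing can only remove increments. *)
Let stopped_sqr m a n :
  (\int[Q]_w (stopped m a n w ^+ 2)%:E <= (\sum_(m <= k < m + n) e k)%:E)%E.
Proof.
elim: n => [|n IH].
  rewrite addn0 big_geq// integral0_eq// => w _.
  by rewrite expr0n.
have mSk := measurable_fun_history (@mstopped m a n).
have S2 : Q.-integrable setT (fun w => (stopped m a n w ^+ 2)%:E).
  by apply: sqr_integrable => //; apply: le_lt_trans IH _; rewrite ltry.
pose eta w := if `|stopped m a n w| < a then stopped m a n w else 0.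
pose D' w := if `|stopped m a n w| < a then D (m + n) w else 0.
have mb : measurable_fun setT
    ((fun w => `|stopped m a n w| < a) : sigF (m + n) -> bool).
  apply: measurable_fun_ltr; last exact: measurable_cst.
  exact: measurableT_comp.
have meta : measurable_fun setT (eta : sigF (m + n) -> R).
  apply: measurable_fun_ifT; [exact: mb|exact: mstopped|exact: measurable_cst].
have mD' : measurable_fun setT D'.
  apply: measurable_fun_ifT; [|exact: mDT|exact: measurable_cst].
  exact: (measurable_fun_history mb).
have eta2 : Q.-integrable setT (fun w => (eta w ^+ 2)%:E).
  apply: (le_integrable measurableT _ _ S2).
    by apply/measurable_EFinP; apply: measurable_funX; exact: (measurable_fun_history meta).
  move=> w _; rewrite lee_fin /eta; case: ifP => // _.
  by rewrite expr0n normr0.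
have D'2 : Q.-integrable setT (fun w => (D' w ^+ 2)%:E).
  apply: (le_integrable measurableT _ _ (D2 (m + n))).
    by apply/measurable_EFinP; exact: measurable_funX.
  by move=> w _; rewrite lee_fin /D'; case: ifP => // _; rewrite expr0n normr0.
have etaD : Q.-integrable setT (fun w => (eta w * D (m + n) w)%:E).
  by apply: mul_integrable => //; exact: (measurable_fun_history meta).
have -> : (\int[Q]_w (stopped m a n.+1 w ^+ 2)%:E =
   \int[Q]_w ((stopped m a n w ^+ 2)%:E +
      ((D' w ^+ 2)%:E + 2%:E * (eta w * D (m + n) w)%:E)))%E.
  apply: eq_integral => w _; rewrite -EFinM -!EFinD; congr (_%:E).
  by rewrite /= /D' /eta; case: ifP => _; ring.
rewrite integralD//; last first.
  by apply: integrableD => //; exact: integrableZl.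
rewrite integralD//; last exact: integrableZl.
rewrite integralZl// ortho//; last exact: integrable_lty eta2.
rewrite mule0 adde0 addnS big_nat_recr ?leq_addr//= EFinD.
apply: leeD => //; apply: le_trans (De _).
apply: ge0_le_integral => //.
- by move=> w _; rewrite lee_fin sqr_ge0.
- by apply/measurable_EFinP; exact: measurable_funX.
- by apply/measurable_EFinP; exact: measurable_funX.
- by move=> w _; rewrite lee_fin /D'; case: ifP; rewrite // expr0n sqr_ge0.
Qed.

Let stopped_stays m a n k w :
  a <= `|stopped m a n w| -> stopped m a (n + k) w = stopped m a n w.
Proof.
move=> h; elim: k => [|k IH]; first by rewrite addn0.
by rewrite addnS /= IH ltNge h addr0.
Qed.

Let stopped_partial m a n w :
  a <= `|\sum_(m <= k < m + n) D k w| -> exists2 k, (k <= n)%N & a <= `|stopped m a k w|.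
Proof.
move=> h; have [ex|nex] := pselect (exists2 k, (k <= n)%N & a <= `|stopped m a k w|) => //.
suff stE k : (k <= n)%N -> stopped m a k w = \sum_(m <= j < m + k) D j w.
  by exists n => //; rewrite stE.
elim: k => [|k IH] kn; first by rewrite addn0 big_geq.
rewrite addnS big_nat_recr ?leq_addr//= IH 1?ltnW//.
case: ifPn => //; rewrite -leNgt -IH 1?ltnW// => h'.
by exfalso; apply: nex; exists k => //; exact: ltnW.
Qed.

Let osc m a : set T := [set w | exists n, a <= `|\sum_(m <= k < m + n) D k w|].

Let tail m := limn (series e) - series e m.

Let tail_ge m n : \sum_(m <= k < m + n) e k <= tail m.
Proof.
rewrite /tail lerBrDr.
have -> : \sum_(m <= k < m + n) e k + series e m = series e (m + n).
  by rewrite /series /= addrC -big_cat_nat ?leq_addr.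
apply: nondecreasing_cvgn_le => // i j ij.
by rewrite /series /= [leRHS](big_cat_nat _ _ (n := i))//= lerDl sumr_ge0.
Qed.

(** Kolmogorov's maximal inequality. Freezing makes the events where [stopped m a n] has modulus at
    least [a] increase with [n], so the measure of their union is a limit of Chebyshev bounds and no
    supremum of partial sums has to be integrated. *)
Let osc_cover m (a : R) : 0 < a -> exists B, [/\ osc m a `<=` B,
  measurable B & (Q B <= (tail m / a ^+ 2)%:E)%E].
Proof.
move=> a0; pose B n := [set w | a <= `|stopped m a n w|].
have mB n : measurable (B n).
  have := measurable_fun_ler (measurable_cst a) (measurableT_comp
    (@normr_measurable R setT) (measurable_fun_history (@mstopped m a n))).
  by move=> /(_ measurableT [set true] I); rewrite setTI.
exists (\bigcup_n B n); split.
- by move=> w [n /stopped_partial[k _ ak]]; exists k.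
- exact: bigcupT_measurable.
have ndB : nondecreasing_seq B.
  move=> i j ij; apply/subsetPset => w; rewrite /B /= => h.
  by rewrite -(subnKC ij) stopped_stays.
have cB := nondecreasing_cvg_mu (mu := Q) mB (bigcupT_measurable _ mB) ndB.
rewrite -(cvg_lim _ cB)//; apply: lime_le.
  by apply/cvg_ex; exists (Q (\bigcup_n B n)).
near=> n; rewrite /= EFinM lee_pdivlMr ?exprn_gt0// muleC.
apply: le_trans (chebyshev_sqr _ (measurable_fun_history (@mstopped m a n)) a0) _.
by apply: le_trans (stopped_sqr m a n) _; rewrite lee_fin tail_ge.
Unshelve. all: by end_near. Qed.

Let tail0 : tail m @[m --> \oo] --> 0.
Proof.
rewrite -(subrr (limn (series e))); apply: cvgB; first exact: cvg_cst.
exact: ecvg.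
Qed.

Let osc_negligible (a : R) : 0 < a -> Q.-negligible (\bigcap_m osc m a).
Proof.
move=> a0; pose B m := sval (cid (osc_cover m a0)).
have BP m : [/\ osc m a `<=` B m, measurable (B m) &
  (Q (B m) <= (tail m / a ^+ 2)%:E)%E] by rewrite /B; case: cid.
have mB : measurable (\bigcap_m B m).
  by apply: bigcapT_measurable => m; have [] := BP m.
exists (\bigcap_m B m); split => //; last first.
  by move=> w h m _; have [+ _ _] := BP m; apply; exact: h.
apply/eqP; rewrite eq_le measure_ge0 andbT.
have c0 : (tail m / a ^+ 2)%:E @[m --> \oo] --> 0%E.
  apply: cvg_EFin; first exact: nearW.
  rewrite -(mul0r (a ^+ 2)^-1); apply: cvgMl; exact: tail0.
rewrite -(cvg_lim _ c0)//; apply: lime_ge; first by apply/cvg_ex; exists 0%E.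
near=> m; have [_ mBm BB] := BP m; apply: le_trans BB.
by apply: le_measure; rewrite ?inE//; exact: bigcap_inf.
Unshelve. all: by end_near. Qed.

(** Outside countably many null sets, one for each threshold [j.+1%:R^-1], the partial sums of some
    tail stay below the threshold, which is the Cauchy property. *)
Lemma l2_martingale_series_cvg :
  {ae Q, forall w, cvgn (series (D ^~ w) : nat -> R^o)}.
Proof.
have /(negligible_bigcup (mu := Q)) := fun j : nat =>
  osc_negligible (a := j.+1%:R^-1) (ltac:(by rewrite invr_gt0)).
move=> N; apply: negligibleS N => w /= nc.
apply: contrapT => nb; apply: nc.
suff : cauchy_ex (series (D ^~ w) @ \oo : set_system R^o).
  by move=> /cauchy_exP; exact: cauchy_cvg.
move=> _/posnumP[eps].
have [j jeps] : exists j, (j.+1%:R^-1 < eps%:num :> R).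
  have [j _ /(_ j (leqnn _))] := near_infty_natSinv_lt eps.
  by exists j.
have [m mj] : exists m, ~ osc m j.+1%:R^-1 w.
  apply: contrapT => h; apply: nb; exists j => // m _.
  by apply: contrapT => h'; apply: h; exists m.
exists (series (D ^~ w) m).
change (\forall n \near \oo,
  ball (series (D ^~ w) m : R^o) eps%:num (series (D ^~ w) n)).
near=> n.
rewrite /ball /= distrC.
have mn : (m <= n)%N by near: n; exact: nbhs_infty_ge.
have -> : series (D ^~ w) n - series (D ^~ w) m = \sum_(m <= k < m + (n - m)) D k w.
  by rewrite subnKC// /series /= (big_cat_nat _ _ (n := m))//= addrAC subrr add0r.
apply: le_lt_trans jeps; rewrite leNgt; apply/negP => h; apply: mj.
by exists (n - m)%N; exact: ltW.
Unshelve. all: by end_near. Qed.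

End l2_martingale.

Section centered.
Local Open Scope ereal_scope.
Context d (T : measurableType d) (R : realType) (P : probability T R).
Variables (f : T -> R) (C : R).
Hypothesis mf : measurable_fun setT f.
Hypothesis f2 : \int[P]_y (f y ^+ 2)%:E <= C%:E.

Lemma sqr_bound_integrable : P.-integrable setT (fun y => (f y)%:E).
Proof.
have f2i : P.-integrable setT (fun y => (f y ^+ 2)%:E).
  by apply: sqr_integrable => //; apply: le_lt_trans f2 _; rewrite ltry.
have -> : (fun y => (f y)%:E) = (fun y => (cst 1%R y * f y)%:E).
  by apply/funext => y; rewrite /= mul1r.
apply: mul_integrable => //.
have -> : (fun y : T => (cst 1%R y ^+ 2)%:E) = EFin \o cst (1 : R)%R.
  by apply/funext => y /=; rewrite expr1n.
exact: finite_measure_integrable_cst.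
Qed.

Let m := fine (\int[P]_y (f y)%:E).

Let mE : \int[P]_y (f y)%:E = m%:E.
Proof. by rewrite /m fineK//; exact: integrable_fin_num sqr_bound_integrable. Qed.

Lemma integral_centered : \int[P]_y (f y - m)%:E = 0.
Proof.
under eq_integral do rewrite EFinB.
rewrite integralB//; last 2 first.
- exact: sqr_bound_integrable.
- exact: finite_measure_integrable_cst.
by rewrite mE integral_cst//= probability_setT mule1 subee.
Qed.

Lemma integral_centered_sqr : \int[P]_y ((f y - m) ^+ 2)%:E <= C%:E.
Proof.
have f2i : P.-integrable setT (fun y => (f y ^+ 2)%:E).
  by apply: sqr_integrable => //; apply: le_lt_trans f2 _; rewrite ltry.
have fi := sqr_bound_integrable.
have -> : \int[P]_y ((f y - m) ^+ 2)%:E =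
    \int[P]_y ((f y ^+ 2)%:E + ((m ^+ 2)%:E + (- 2 * m)%:E * (f y)%:E)).
  by apply: eq_integral => y _; rewrite -EFinM -!EFinD; congr (_%:E); ring.
have ci : P.-integrable setT (fun y : T => (m ^+ 2)%:E).
  exact: finite_measure_integrable_cst.
rewrite integralD//; last by apply: integrableD => //; exact: integrableZl.
rewrite integralD//; last exact: integrableZl.
rewrite integralZl// mE integral_cst//= probability_setT mule1.
apply: le_trans f2; rewrite -[leRHS]adde0; apply: leeD => //.
by rewrite -EFinM -EFinD lee_fin; nra.
Qed.

End centered.

(** Disintegration is proved for nonnegative integrands. A signed integrand of mean zero is
    therefore handled through the equality of the integrals of its two parts. *)
Lemma integral0_funepos_funeneg d (T : measurableType d) (R : realType)
    (P : {measure set T -> \bar R}) (f : T -> \bar R) :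
  P.-integrable setT f -> (\int[P]_y f y = 0 ->
  \int[P]_y f^\+ y = \int[P]_y f^\- y)%E.
Proof.
move=> fi; rewrite integralE => f0.
have nfin := integrable_neg_fin_num measurableT fi.
by rewrite -[LHS](subeK _ nfin) f0 add0e.
Qed.

Lemma cvgn_nneseries (R : realType) (u : nat -> R) : (forall k, 0 <= u k) ->
  (\sum_(k <oo) (u k)%:E < +oo)%E -> cvgn (series u : nat -> R^o).
Proof.
move=> u0 uoo; apply: nondecreasing_is_cvgn.
  move=> i j ij.
  by rewrite /series /= [leRHS](big_cat_nat _ _ (n := i))//= lerDl sumr_ge0.
have s0 : (0 <= \sum_(k <oo) (u k)%:E)%E.
  by apply: nneseries_ge0 => k _ _; rewrite lee_fin.
exists (fine (\sum_(k <oo) (u k)%:E)%E) => _ [n _ <-].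
rewrite -lee_fin fineK ?ge0_fin_numE// /series /= -sumEFin big_mkord.
rewrite -(big_mkord predT (fun k => (u k)%:E)).
by apply: nneseries_lim_ge => k _ _; rewrite lee_fin.
Qed.

Section martingale_noise.
Context d d' (T : measurableType d) (E : measurableType d') (R : realType).
Variables (Q : probability T R) (H : nat -> set (set T)).
Hypothesis HT : forall n, H n `<=` measurable.
Hypothesis HS : forall n, H n `<=` H n.+1.
Variables (Z : nat -> T -> E) (kappa : nat -> T -> probability E R).
Hypothesis mZ : forall k,
  measurable_fun setT (Z k : g_sigma_algebraType (H k.+1) -> E).
Hypothesis mkappa : forall k B, measurable B ->
  measurable_fun setT ((kappa k ^~ B) : g_sigma_algebraType (H k) -> \bar R).
Hypothesis kappaE : forall k A B, <<s H k>> A -> measurable B ->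
  (Q (A `&` Z k @^-1` B) = \int[Q]_(w in A) kappa k w B)%E.
Variables (phi : nat -> T -> E -> R) (C : R) (a : nat -> R).
Hypothesis mphi : forall k, measurable_fun setT
  ((fun z => phi k z.1 z.2) : g_sigma_algebraType (H k) * E -> R).
Hypothesis phi2 : forall k w, (\int[kappa k w]_y (phi k w y ^+ 2)%:E <= C%:E)%E.
Hypothesis acvg : cvgn (series (fun k => a k ^+ 2)).

Let sigF k := g_sigma_algebraType (H k).

(** Taken as [proj] in the disintegration, this identity onto a coarser sigma-algebra turns it into
    conditioning on [H k]. *)
Let id_ k : T -> sigF k := id.

Let mid k : measurable_fun setT (id_ k).
Proof.
move=> _ B mB; rewrite setTI.
by apply: smallest_sub mB => //; exact: sigma_algebra_measurable.
Qed.

Let mZT k : measurable_fun setT (Z k).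
Proof. exact: (measurable_fun_history HT (@mZ k)). Qed.

Let disint k (h : sigF k * E -> \bar R) :
  measurable_fun setT h -> (forall z, 0 <= h z)%E ->
  (\int[Q]_w h (w, Z k w) = \int[Q]_w \int[kappa k w]_y h (w, y))%E.
Proof.
apply: (@ge0_integral_disintegration _ _ _ _ _ _ _ Q (id_ k)) => //.
- exact: mkappa.
- exact: kappaE.
Qed.

Let mphi1 k w : measurable_fun setT (phi k w).
Proof.
have := @measurableT_comp _ _ _ E (sigF k * E)%type R
  (fun z => phi k z.1 z.2) setT (pair w) (@mphi k).
by apply; exact: (@pair1_measurable _ _ (sigF k)).
Qed.

Definition noise_mean k w : R := fine (\int[kappa k w]_y (phi k w y)%:E)%E.

Let mmean k : measurable_fun setT (noise_mean k : sigF k -> R).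
Proof.
apply: measurableT_comp => //=.
under eq_fun do rewrite integralE.
apply: emeasurable_funB.
- have := @measurable_fun_kernel_int _ _ (sigF k) E R (kappa k) (@mkappa k)
    ((fun z => (phi k z.1 z.2)%:E)^\+)%E
    (measurable_funepos (iffRL (measurable_EFinP _ _) (@mphi k))) (funepos_ge0 _).
  congr measurable_fun; apply/funext => w; apply: eq_integral => y _.
  by rewrite !funeposE.
- have := @measurable_fun_kernel_int _ _ (sigF k) E R (kappa k) (@mkappa k)
    ((fun z => (phi k z.1 z.2)%:E)^\-)%E
    (measurable_funeneg (iffRL (measurable_EFinP _ _) (@mphi k))) (funeneg_ge0 _).
  congr measurable_fun; apply/funext => w; apply: eq_integral => y _.
  by rewrite !funenegE.
Qed.

Let noise k w := phi k w (Z k w) - noise_mean k w.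

Let mfst k : measurable_fun setT (fst : sigF k * E -> sigF k).
Proof. exact: measurable_fst. Qed.

Let mphiZ k : measurable_fun setT ((fun w => phi k w (Z k w)) : sigF k.+1 -> R).
Proof.
have mp : measurable_fun setT ((fun w => (w, Z k w)) : sigF k.+1 -> sigF k * E).
  apply/measurable_fun_pairP; split; last exact: mZ.
  by move=> _ B mB; rewrite setTI; apply: sub_sigma_algebra2 mB; exact: HS.
exact: (measurableT_comp (@mphi k) mp).
Qed.

Let mnoise k : measurable_fun setT (noise k : sigF k.+1 -> R).
Proof.
apply: measurable_funB; first exact: mphiZ.
exact: (measurable_fun_history_le HS (leqnSn k) (@mmean k)).
Qed.

Let mdiff k : measurable_fun setT
  ((fun z => phi k z.1 z.2 - noise_mean k z.1) : sigF k * E -> R).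
Proof.
apply: measurable_funB; first exact: mphi.
exact: (measurableT_comp (@mmean k) (@mfst k)).
Qed.

(** [C] bounds a second moment at every point, and a point exists because a probability space is not
    empty. *)
Let C_ge0 : 0 <= C.
Proof.
have /existsNP[w _] : ~ (forall w : T, False).
  move=> nw; have := probability_setT Q.
  rewrite (_ : setT = set0) ?measure0; last by apply/seteqP; split => // w _; exact: nw w.
  by move=> /eqP; rewrite eqe => /eqP; have := @oner_neq0 R; rewrite eq_sym => /eqP.
rewrite -lee_fin; apply: le_trans (phi2 0 w).
by apply: integral_ge0 => y _; rewrite lee_fin sqr_ge0.
Qed.

Let disint_le k (h : sigF k * E -> R) (c : R) :
  measurable_fun setT h -> (forall z, 0 <= h z) ->
  (forall w, \int[kappa k w]_y (h (w, y))%:E <= c%:E)%E ->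
  (\int[Q]_w (h (w, Z k w))%:E <= c%:E)%E.
Proof.
move=> mh h0 hc; rewrite (disint (h := EFin \o h)); last 2 first.
- exact/measurable_EFinP.
- by move=> z; rewrite lee_fin.
apply: (@le_trans _ _ (\int[Q]_w c%:E)%E); last first.
  by rewrite integral_cst//= probability_setT mule1.
apply: ge0_le_integral => //.
- by move=> w _; apply: integral_ge0 => y _; rewrite lee_fin.
- apply: (measurable_fun_history HT (k := k)).
  apply: (@measurable_fun_kernel_int _ _ (sigF k) E R (kappa k) (@mkappa k)
    (EFin \o h)).
  + exact/measurable_EFinP.
  + by move=> z; rewrite lee_fin.
Qed.

Let noise_sqr k :
  (\int[Q]_w ((a k * noise k w) ^+ 2)%:E <= (C * a k ^+ 2)%:E)%E.
Proof.
under eq_integral do rewrite exprMn.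
apply: (@disint_le k (fun z =>
  a k ^+ 2 * (phi k z.1 z.2 - noise_mean k z.1) ^+ 2)).
- apply: measurable_funM => //.
  by apply: measurable_funX; exact: mdiff.
- by move=> z; rewrite mulr_ge0 ?sqr_ge0.
move=> w /=; under eq_integral do rewrite EFinM.
rewrite ge0_integralZl//; last 3 first.
- apply/measurable_EFinP; apply: measurable_funX; apply: measurable_funB => //.
- by move=> y _; rewrite lee_fin sqr_ge0.
- by rewrite lee_fin sqr_ge0.
rewrite (mulrC C) (EFinM _ C); apply: lee_wpmul2l; rewrite ?lee_fin ?sqr_ge0//.
exact: (integral_centered_sqr (@mphi1 k w) (phi2 k w)).
Qed.

Let term_sqr k :
  (\int[Q]_w ((a k * phi k w (Z k w)) ^+ 2)%:E <= (C * a k ^+ 2)%:E)%E.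
Proof.
under eq_integral do rewrite exprMn.
apply: (@disint_le k (fun z => a k ^+ 2 * phi k z.1 z.2 ^+ 2)).
- by apply: measurable_funM => //; apply: measurable_funX; exact: mphi.
- by move=> z; rewrite mulr_ge0 ?sqr_ge0.
move=> w /=; under eq_integral do rewrite EFinM.
rewrite ge0_integralZl//; last 3 first.
- by apply/measurable_EFinP; apply: measurable_funX; exact: (@mphi1 k w).
- by move=> y _; rewrite lee_fin sqr_ge0.
- by rewrite lee_fin sqr_ge0.
rewrite (mulrC C) (EFinM _ C); apply: lee_wpmul2l; rewrite ?lee_fin ?sqr_ge0//.
exact: phi2.
Qed.

(** At fixed [w] the integrand has mean zero under [kappa k w], hence positive and negative parts of
    equal integral. Disintegrating the parts separately carries this equality over to [Q], where the
    product is integrable because both factors are square integrable. *)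
Let ortho k (eta : T -> R) :
  measurable_fun setT (eta : sigF k -> R) ->
  (\int[Q]_w (eta w ^+ 2)%:E < +oo ->
   \int[Q]_w (eta w * (a k * noise k w))%:E = 0)%E.
Proof.
move=> meta eta2.
pose g (z : sigF k * E) : R := eta z.1 * (a k * (phi k z.1 z.2 - noise_mean k z.1)).
have mg : measurable_fun setT g.
  apply: measurable_funM; first exact: (measurableT_comp meta (@mfst k)).
  by apply: measurable_funM => //; exact: mdiff.
have mgE : measurable_fun setT (EFin \o g) by exact/measurable_EFinP.
have inner w : (\int[kappa k w]_y ((EFin \o g)^\+ (w, y)) =
                \int[kappa k w]_y ((EFin \o g)^\- (w, y)))%E.
  have ci : (kappa k w).-integrable setT
      (fun y => (phi k w y - noise_mean k w)%:E).
    under eq_fun do rewrite EFinB.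
    apply: integrableB => //; last exact: finite_measure_integrable_cst.
    exact: (sqr_bound_integrable (@mphi1 k w) (phi2 k w)).
  have gE : (fun y => (g (w, y))%:E) =
      (fun y => (eta w * a k)%:E * (phi k w y - noise_mean k w)%:E)%E.
    by apply/funext => y; rewrite -EFinM /g /= mulrA.
  have gi : (kappa k w).-integrable setT (fun y => (g (w, y))%:E).
    by rewrite gE; exact: integrableZl.
  have g0 : (\int[kappa k w]_y (g (w, y))%:E = 0)%E.
    rewrite gE integralZl//.
    by rewrite (integral_centered (@mphi1 k w) (phi2 k w)) mule0.
  have := integral0_funepos_funeneg gi g0.
  by congr (_ = _); apply: eq_integral => y _; rewrite ?funeposE ?funenegE.
have mpos : measurable_fun setT (EFin \o g)^\+%E by exact: measurable_funepos.
have mneg : measurable_fun setT (EFin \o g)^\-%E by exact: measurable_funeneg.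
have mnT : measurable_fun setT (fun w => a k * noise k w).
  by apply: measurable_funM => //; exact: (measurable_fun_history HT (@mnoise k)).
have metaT := measurable_fun_history HT meta.
have gZi : Q.-integrable setT (fun w => (g (w, Z k w))%:E).
  apply: mul_integrable => //; first exact: sqr_integrable.
  by apply: sqr_integrable => //; apply: le_lt_trans (noise_sqr k) _; rewrite ltry.
have nfin := integrable_neg_fin_num measurableT gZi.
rewrite [LHS]integralE.
have -> : (\int[Q]_w (fun w => (g (w, Z k w))%:E)^\+ w =
           \int[Q]_w (fun w => (g (w, Z k w))%:E)^\- w)%E.
  transitivity (\int[Q]_w ((EFin \o g)^\+ (w, Z k w)))%E.
    by apply: eq_integral => w _; rewrite !funeposE.
  rewrite disint//; under eq_integral do rewrite inner.
  rewrite -(disint (h := (EFin \o g)^\-%E))//.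
  by apply: eq_integral => w _; rewrite !funenegE.
by rewrite subee.
Qed.

Lemma noise_series_cvg : {ae Q, forall w,
  cvgn (series (fun k => a k * (phi k w (Z k w) - noise_mean k w)) : nat -> R^o)}.
Proof.
apply: (@l2_martingale_series_cvg _ T R Q H (fun k w => a k * noise k w)
  (fun k => C * a k ^+ 2) HT HS _ noise_sqr) => //.
- by move=> k; apply: measurable_funM => //; exact: mnoise.
- have -> : series (fun k => C * a k ^+ 2) = C \*: series (fun k => a k ^+ 2).
    by apply/funext => n; rewrite /series /= /GRing.scale /= mulr_sumr.
  exact: is_cvgZr.
Qed.


(** The terms are nonnegative with integrals at most [C * a k ^+ 2], so their sum has a finite
    integral and is finite almost everywhere. *)
Lemma noise_series_sqr_cvg : {ae Q, forall w,
  cvgn (series (fun k => (a k * phi k w (Z k w)) ^+ 2) : nat -> R^o)}.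
Proof.
have mt k : measurable_fun setT (fun w => ((a k * phi k w (Z k w)) ^+ 2)%:E).
  apply/measurable_EFinP; apply: measurable_funX; apply: measurable_funM => //.
  exact: (measurable_fun_history HT (@mphiZ k)).
have t0 k w : (0 <= ((a k * phi k w (Z k w)) ^+ 2)%:E)%E.
  by rewrite lee_fin sqr_ge0.
have sint : Q.-integrable setT
    (fun w => \sum_(k <oo) ((a k * phi k w (Z k w)) ^+ 2)%:E)%E.
  apply/integrableP; split.
    exact: ge0_emeasurable_sum.
  under eq_integral do rewrite gee0_abs ?nneseries_ge0//.
  rewrite integral_nneseries//; apply: (@le_lt_trans _ _
    (C * limn (series (fun k => a k ^+ 2)))%:E); last by rewrite ltry.
  apply: lime_le; first by apply: is_cvg_nneseries => k _ _; exact: integral_ge0.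
  near=> n; apply: (@le_trans _ _ (\sum_(0 <= k < n) (C * a k ^+ 2)%:E)%E).
    by apply: lee_sum => k _; exact: term_sqr.
  rewrite sumEFin lee_fin -mulr_sumr ler_wpM2l//.
  apply: nondecreasing_cvgn_le => // i j ij.
  rewrite /series /= [leRHS](big_cat_nat _ _ (n := i))//= lerDl sumr_ge0// => ? _.
  exact: sqr_ge0.
have := integrable_ae measurableT sint.
apply: filterS => w /(_ I) wfin.
apply: cvgn_nneseries; first by move=> k; exact: sqr_ge0.
by rewrite ltey_eq wfin.
Unshelve. all: by end_near. Qed.

End martingale_noise.

(** * Dual averaging on a polyhedron *)

Section dotp_theory.
Variables (R : realType) (n : nat).
Implicit Types u v w : 'cV[R]_n.

Lemma dotpC u v : dotp u v = dotp v u.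
Proof. by apply: eq_bigr => i _; rewrite mulrC. Qed.

Lemma dotpDl u v w : dotp (u + v) w = dotp u w + dotp v w.
Proof. by rewrite /dotp -big_split; apply: eq_bigr => i _; rewrite mxE mulrDl. Qed.

Lemma dotpNl u w : dotp (- u) w = - dotp u w.
Proof. by rewrite /dotp -sumrN; apply: eq_bigr => i _; rewrite mxE mulNr. Qed.

Lemma dotpZl a u w : dotp (a *: u) w = a * dotp u w.
Proof. by rewrite /dotp mulr_sumr; apply: eq_bigr => i _; rewrite mxE mulrA. Qed.

Lemma dotpDr u v w : dotp w (u + v) = dotp w u + dotp w v.
Proof. by rewrite !(dotpC w) dotpDl. Qed.

Lemma dotpNr u w : dotp w (- u) = - dotp w u.
Proof. by rewrite !(dotpC w) dotpNl. Qed.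

Lemma dotpZr a u w : dotp w (a *: u) = a * dotp w u.
Proof. by rewrite !(dotpC w) dotpZl. Qed.

Lemma dotp0l u : dotp 0 u = 0.
Proof. by rewrite /dotp big1// => i _; rewrite mxE mul0r. Qed.

Definition dotpE := (dotpDl, dotpDr, dotpNl, dotpNr, dotpZl, dotpZr).

Lemma dotp_ge0 u : 0 <= dotp u u.
Proof. by apply: sumr_ge0 => i _; rewrite -expr2 sqr_ge0. Qed.

Lemma coord_sqr_le_dotp u i : u i 0 ^+ 2 <= dotp u u.
Proof.
rewrite /dotp (bigD1 i)//= expr2 lerDl.
by apply: sumr_ge0 => j _; rewrite -expr2 sqr_ge0.
Qed.

Lemma dotp_eq0 u : dotp u u = 0 -> u = 0.
Proof.
move=> u0; apply/colP => i; rewrite mxE; apply/eqP.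
by rewrite -sqrf_eq0 eq_le sqr_ge0 andbT -u0 coord_sqr_le_dotp.
Qed.

Lemma dotp_CauchySchwarz u v : dotp u v ^+ 2 <= dotp u u * dotp v v.
Proof.
have [v0|v0] := eqVneq (dotp v v) 0.
  by rewrite (dotp_eq0 v0) dotpC !dotp0l expr0n mulr0.
have v1 : 0 < dotp v v by rewrite lt_def v0 dotp_ge0.
have := dotp_ge0 (dotp v v *: u - dotp u v *: v).
rewrite !dotpE (dotpC v u) => h.
have {}h : 0 <= dotp v v * (dotp u u * dotp v v - dotp u v ^+ 2) by lra.
by rewrite -subr_ge0 -(pmulr_rge0 _ v1).
Qed.

Lemma enorm_sqr u : enorm u ^+ 2 = dotp u u.
Proof. by rewrite sqr_sqrtr// dotp_ge0. Qed.

Lemma enorm_ge0 u : 0 <= enorm u.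
Proof. exact: sqrtr_ge0. Qed.

Lemma dotp_le_enorm u v : `|dotp u v| <= enorm u * enorm v.
Proof.
rewrite -ler_sqr ?nnegrE ?mulr_ge0 ?enorm_ge0// exprMn !enorm_sqr.
by rewrite real_normK ?num_real// dotp_CauchySchwarz.
Qed.

End dotp_theory.

Lemma dotp_trmx_mul (R : realType) (m n : nat) (B : 'M[R]_(m, n)) u v :
  dotp (B^T *m u) v = dotp u (B *m v).
Proof.
rewrite /dotp; under eq_bigr do rewrite mxE big_distrl/=.
rewrite exchange_big; apply: eq_bigr => i _ /=.
by rewrite mxE big_distrr /=; apply: eq_bigr => j _; rewrite mxE; ring.
Qed.

Lemma subrows_mul (R : realType) (p n k : nat) (I : {set 'I_p})
    (B : 'M[R]_(p, n)) (u : 'M[R]_(n, k)) i j :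
  (subrows I B *m u) i j = (B *m u) (enum_val i) j.
Proof. by rewrite !mxE; apply: eq_bigr => l _; rewrite mxE. Qed.

(** One scale for finitely many constraints, used both for a step length and for a radius: the
    inverse of [K] works since [K] exceeds every ratio of [c i] in modulus to [s i]. *)
Lemma small_scale (R : realType) (I : finType) (c s : I -> R) :
  (forall i, 0 <= s i) -> (forall i, s i = 0 -> c i = 0) ->
  exists2 eps, 0 < eps & forall i, eps * `|c i| <= s i.
Proof.
(* Division by zero yields 0, so the tight indices do not contribute to [K]. *)
move=> s0 sc; pose K := 1 + \sum_i `|c i| / s i.
have t0 i : 0 <= `|c i| / s i by rewrite divr_ge0.
have K0 : 0 < K by rewrite ltr_pwDl// sumr_ge0.
exists K^-1; first by rewrite invr_gt0.
move=> i; have [/sc ->|si] := eqVneq (s i) 0; first by rewrite normr0 mulr0.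
have si0 : 0 < s i by rewrite lt_def si s0.
rewrite mulrC ler_pdivrMr// mulrC -ler_pdivrMr// /K (bigD1 i)//=.
by rewrite addrCA lerDl addr_ge0// sumr_ge0.
Qed.

Section projection.
Variables (R : realType) (p n : nat) (A : 'M[R]_(p, n)) (b : 'cV[R]_p).
Implicit Types x z u : 'cV[R]_n.

Let K := polyhedron A b.

(* the variational characterization of the Euclidean projection of [z] on [K] *)
Definition projects z x := K x /\ forall y, K y -> dotp (z - x) (y - x) <= 0.

(** A direction tangent to every constraint active at [x] can be followed both ways for a short
    time, so the variational inequality holds for [u] and for [- u]. *)
Lemma projects_face z x u : projects z x ->
  (forall i, (A *m x) i 0 = b i 0 -> (A *m u) i 0 = 0) -> dotp (z - x) u = 0.
Proof.
move=> [Kx vi] Au.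
have [eps eps0 epsP] : exists2 eps, 0 < eps &
    forall i, eps * `|(A *m u) i 0| <= b i 0 - (A *m x) i 0.
  apply: small_scale => i; first by rewrite subr_ge0; exact: Kx.
  by move=> /eqP; rewrite subr_eq0 => /eqP /esym; exact: Au.
have Kpm (s : R) : `|s| <= eps -> K (x + s *: u).
  move=> sle i.
  have -> : (A *m (x + s *: u)) i 0 = (A *m x) i 0 + s * (A *m u) i 0.
    by rewrite mulmxDr -scalemxAr mxE [X in _ + X]mxE.
  rewrite -lerBrDl; apply: le_trans (epsP i); apply: le_trans (ler_norm _) _.
  by rewrite normrM ler_wpM2r.
have := vi _ (Kpm eps _); have := vi _ (Kpm (- eps) _).
rewrite normrN gtr0_norm// => /(_ (lexx _)) + /(_ (lexx _)).
rewrite ![x + _]addrC !addrK !dotpZr => h1 h2; apply/eqP.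
by rewrite eq_le -(pmulr_rle0 _ eps0) h2/= -(pmulr_rge0 _ eps0) -oppr_le0 -mulNr.
Qed.

Variable xs : 'cV[R]_n.
Hypothesis Kxs : K xs.

Lemma inactive_near : exists2 rho, 0 < rho & forall x,
  dotp (x - xs) (x - xs) < rho ->
  forall i, (A *m xs) i 0 < b i 0 -> (A *m x) i 0 < b i 0.
Proof.
pose N i := dotp (row i A)^T (row i A)^T.
(* The squared slack is compared with the squared row norm in view of Cauchy-Schwarz; the summand 1
   keeps the final inequality strict when the row vanishes. *)
have [rho rho0 rhoP] : exists2 rho, 0 < rho & forall i,
    rho * `|if (A *m xs) i 0 < b i 0 then 1 + N i else 0| <=
    (b i 0 - (A *m xs) i 0) ^+ 2.
  apply: small_scale => i; first exact: sqr_ge0.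
  by move=> /eqP; rewrite sqrf_eq0 subr_eq0 => /eqP ->; rewrite ltxx.
exists rho => // x xrho i ib.
have := rhoP i; rewrite ib ger0_norm ?addr_ge0 ?dotp_ge0// => h.
have Ax : (A *m x) i 0 = (A *m xs) i 0 + dotp (row i A)^T (x - xs).
  rewrite -{1}(subrK xs x) mulmxDr mxE addrC; congr (_ + _).
  by rewrite mxE /dotp; apply: eq_bigr => j _; rewrite !mxE.
rewrite Ax -ltrBrDl; apply: le_lt_trans (ler_norm _) _.
have Ni : 0 <= N i by exact: dotp_ge0.
rewrite -ltr_sqr ?nnegrE ?normr_ge0// ?subr_ge0 ?(ltW ib)//.
rewrite real_normK ?num_real//; apply: lt_le_trans h.
apply: le_lt_trans (dotp_CauchySchwarz _ _) _; rewrite -/(N i).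
have := dotp_ge0 (x - xs); move: xrho Ni; set D := dotp _ _; nra.
Qed.

(** The Fenchel coupling of [xs] and [z] for half the squared norm restricted to [K], written with
    the projection [x] of [z]. *)
Let energy z x := 2^-1 * dotp (z - xs) (z - xs) - 2^-1 * dotp (z - x) (z - x).

Let energy_ge z x : projects z x ->
  2^-1 * dotp (x - xs) (x - xs) <= energy z x.
Proof.
move=> [_ /(_ _ Kxs)]; rewrite /energy !dotpE.
rewrite (dotpC xs z) (dotpC x z) (dotpC x xs); lra.
Qed.

(** Besides the two displayed terms, the exact change consists of [dotp (z - x) (x' - x)],
    nonpositive because [x'] lies in [K], and of minus half the squared norm of
    [(z' - z) - (x' - x)]. *)
Let energy_step z x z' x' : projects z x -> projects z' x' ->
  energy z' x' <= energy z x + dotp (z' - z) (x - xs)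
                  + 2^-1 * dotp (z' - z) (z' - z).
Proof.
move=> [_ vi] [/vi + _].
have := dotp_ge0 ((z' - z) - (x' - x)); rewrite /energy !dotpE.
have := (dotpC z' z, dotpC x' z', dotpC x z', dotpC xs z', dotpC x' z,
  dotpC x z, dotpC xs z, dotpC x' x, dotpC xs x).
by move=> [[[[[[[[e1 e2] e3] e4] e5] e6] e7] e8] e9]; lra.
Qed.

Let energy_eq z x : projects z x ->
  (forall i, (A *m x) i 0 = b i 0 -> (A *m xs) i 0 = b i 0) ->
  energy z x = 2^-1 * dotp (x - xs) (x - xs).
Proof.
move=> pzx act.
have /(projects_face pzx) : forall i, (A *m x) i 0 = b i 0 ->
    (A *m (x - xs)) i 0 = 0.
  move=> i xb; rewrite mulmxBr mxE [X in _ + X]mxE xb act// subrr//.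
rewrite /energy !dotpE.
by have := (dotpC xs z, dotpC x z, dotpC x xs) => -[[e1 e2] e3]; lra.
Qed.

Section dual_averaging_cvg.
Variables (x z g : nat -> 'cV[R]_n) (a e : nat -> R) (c : R) (n0 : nat).
Hypothesis xproj : forall k, projects (z k) (x k).
Hypothesis zS : forall k, z k.+1 = z k - a k *: g k.
Hypothesis a0 : forall k, 0 < a k.
Hypothesis ainfty : series a k @[k --> \oo] --> +oo.
Hypothesis ecvg : cvgn (series e : nat -> R^o).
Hypothesis gcvg :
  cvgn (series (fun k => a k ^+ 2 * dotp (g k) (g k)) : nat -> R^o).
Hypothesis c0 : 0 < c.
Hypothesis descent : forall k, (n0 <= k)%N ->
  c * (a k * dotp (x k - xs) (x k - xs)) + e k <= a k * dotp (g k) (x k - xs).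

Let dist2 k := dotp (x k - xs) (x k - xs).

Let V k := energy (z k) (x k).

Let V_ge k : 2^-1 * dist2 k <= V k. Proof. exact: energy_ge. Qed.

Let Eser := series e.
Let Gser := series (fun k => a k ^+ 2 * dotp (g k) (g k)).
Let Dser := series (fun k => a k * dist2 k).

(** The energy compensated for the noise and the squared steps, plus the accumulated drift. It is
    nonincreasing from [n0] on: a pathwise version of the Robbins-Siegmund argument. *)
Let W k := V k + Eser k - 2^-1 * Gser k + c * Dser k.

Let W_step k : (n0 <= k)%N -> W k.+1 <= W k.
Proof.
move=> nk; have := energy_step (xproj k) (xproj k.+1).
have -> : z k.+1 - z k = - (a k *: g k) by rewrite zS addrAC subrr add0r.
rewrite -/(V k) -/(V k.+1) !(dotpNl, dotpNr, dotpZl, dotpZr) => Vk.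
have {Vk}: V k.+1 <= V k - a k * dotp (g k) (x k - xs)
  + 2^-1 * (a k ^+ 2 * dotp (g k) (g k)) by lra.
have := descent nk; rewrite -/(dist2 k) => h1 h2.
rewrite /W /Eser /Gser /Dser /series /= !big_nat_recr//=; lra.
Qed.

Let W_noninc k : (n0 <= k)%N -> W k <= W n0.
Proof.
move=> /subnKC <-; elim: (k - n0)%N => [|j IH]; first by rewrite addn0.
by rewrite addnS; apply: le_trans IH; apply: W_step; exact: leq_addr.
Qed.

Let V_ge0 k : 0 <= V k.
Proof. by apply: le_trans (V_ge k); rewrite mulr_ge0 ?dotp_ge0. Qed.

Let Dser_ge0 k : 0 <= Dser k.
Proof. by apply: sumr_ge0 => j _; rewrite mulr_ge0 ?dotp_ge0// ltW. Qed.

Let Eser_lb : exists M, forall k, - M <= Eser k.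
Proof.
have [M MP] := cvg_has_ub ecvg; exists M => k.
by apply: lerNnormlW; apply: MP; exists k.
Qed.

Let Gser_ub : exists M, forall k, Gser k <= M.
Proof.
have [M MP] := cvg_has_ub gcvg; exists M => k.
by apply: le_trans (MP _ _); [exact: ler_norm|exists k].
Qed.

(** [W] is bounded above from [n0] on and its other terms are bounded below, so [Dser] is bounded.
    Applied to [theta], this also provides the summability of the bias in the recursion of [mu]. *)
Lemma dist_series_cvg : cvgn (Dser : nat -> R^o).
Proof.
have [ME MEP] := Eser_lb; have [MG MGP] := Gser_ub.
have ndD : nondecreasing_seq Dser.
  move=> i j ij.
  rewrite /Dser /series /= [leRHS](big_cat_nat _ _ (n := i))//= lerDl.
  by apply: sumr_ge0 => k _; rewrite mulr_ge0 ?dotp_ge0// ltW.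
apply: nondecreasing_is_cvgn => //.
exists ((W n0 + ME + 2^-1 * MG) / c) => _ [k _ <-].
apply: le_trans (ndD k (k + n0)%N (leq_addr _ _)) _.
rewrite ler_pdivlMr// mulrC.
have := W_noninc (leq_addl k n0); have := MEP (k + n0)%N; have := MGP (k + n0)%N.
have := V_ge0 (k + n0)%N; rewrite {1}/W; lra.
Qed.

Let V_cvg : cvgn (V : nat -> R^o).
Proof.
have [ME MEP] := Eser_lb; have [MG MGP] := Gser_ub.
have cW : cvgn (W : nat -> R^o).
  suff /cvg_ex[l] : cvgn ([sequence W (k + n0)%N]_k : nat -> R^o).
    by rewrite cvg_shiftn => Wl; apply/cvg_ex; exists l.
  apply: nonincreasing_is_cvgn.
    by apply/nonincreasing_seqP => k; rewrite /= addSn; apply: W_step; exact: leq_addl.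
  exists (- ME - 2^-1 * MG) => _ [k _ <-] /=; rewrite /W.
  have := MEP (k + n0)%N; have := MGP (k + n0)%N; have := V_ge0 (k + n0)%N.
  have := mulr_ge0 (ltW c0) (Dser_ge0 (k + n0)%N); lra.
have -> : V = (W - Eser + 2^-1 *: (Gser : nat -> R^o) - c *: (Dser : nat -> R^o)).
  by apply/funext => k; rewrite /W !fctE /GRing.scale /=; ring.
apply: is_cvgB; last by apply: is_cvgZr; exact: dist_series_cvg.
by apply: is_cvgD; [exact: is_cvgB|exact: is_cvgZr].
Qed.

Let dist_freq eps N : 0 < eps -> exists2 k, (N <= k)%N & dist2 k < eps.
Proof.
move=> eps0; have [M MP] := cvg_has_ub dist_series_cvg.
have [//|nex] := pselect (exists2 k, (N <= k)%N & dist2 k < eps).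
have {}nex k : (N <= k)%N -> eps <= dist2 k.
  by move=> Nk; rewrite leNgt; apply/negP => h; apply: nex; exists k.
(* The steps between [N] and [k] add up to at least [(M + 1) / eps], so distances that stay above
   [eps] would push [Dser] beyond its bound [M]. *)
have [k [Sk Nk]] : exists k, series a N + (M + 1) / eps <= series a k /\ (N <= k)%N.
  near \oo => k; exists k; split; near: k; last exact: nbhs_infty_ge.
  by move/cvgryPge : ainfty; exact.
have : M < Dser k.
  have {}Sk : (M + 1) / eps <= \sum_(N <= j < k) a j.
    rewrite -(lerD2l (series a N)); apply: le_trans Sk _.
    by rewrite /series /= [leLHS](big_cat_nat _ _ (n := N)).
  rewrite /Dser /series /= (big_cat_nat _ _ (n := N))//=.
  have := Dser_ge0 N; rewrite /Dser /series /=.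
  have : \sum_(N <= j < k) eps * a j <= \sum_(N <= j < k) a j * dist2 j.
    rewrite big_nat [leRHS]big_nat; apply: ler_sum => j /andP[Nj _].
    by rewrite mulrC ler_wpM2l ?nex// ltW.
  rewrite -mulr_sumr; move: Sk; rewrite ler_pdivrMr//; lra.
rewrite ltNge; apply: contraNP => _.
by apply: le_trans (MP _ _); [exact: ler_norm|exists k].
Unshelve. all: by end_near. Qed.

Lemma dist_cvg0 : dist2 k @[k --> \oo] --> (0 : R).
Proof.
have V0 : V k @[k --> \oo] --> (0 : R).
  suff <- : limn (V : nat -> R^o) = 0 by [].
  apply/eqP; rewrite eq_le; apply/andP; split; last first.
    by apply: limr_ge => //; exact: nearW.
  apply/ler_addgt0Pr => eps eps0; rewrite add0r.
  have [rho rho0 rhoP] := inactive_near.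
  rewrite leNgt; apply/negP => Vlim.
  have [N _ NP] : \forall k \near \oo, eps < V k.
    by apply: cvgr_gt Vlim; exact: V_cvg.
  (* The energy has a limit, so a single late index is enough to contradict [eps < V k]: closeness
     [rho] makes the energy equal to half the squared distance, closeness [eps] makes that small. *)
  have [|k Nk] := @dist_freq (Num.min eps rho) N.
    by rewrite lt_min eps0 rho0.
  rewrite lt_min => /andP[dk1 dk2].
  have := NP k Nk; rewrite /= /V energy_eq//.
    have := dotp_ge0 (x k - xs); move: dk1; rewrite /dist2; lra.
  move=> i xib; apply/eqP; move/eqP: xib; apply: contraLR => xsib.
  rewrite lt_eqF//; apply: rhoP => //; rewrite lt_neqAle xsib/=; exact: Kxs.
apply: (squeeze_cvgr (f := fun=> 0) (h := fun k => 2 * V k)).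
- by apply: nearW => k; rewrite dotp_ge0/= -ler_pdivrMl// V_ge.
- exact: cvg_cst.
- by rewrite -(mulr0 2); apply: cvgMr.
Qed.

End dual_averaging_cvg.

End projection.

(** * Weighted averages and identification of the active constraints *)

Lemma cvg_sumr (R : realType) (T : Type) (F : set_system T) (FF : Filter F)
    (I : finType) (f : I -> T -> R) (l : I -> R) :
  (forall i, f i x @[x --> F] --> l i) ->
  \sum_i f i x @[x --> F] --> \sum_i l i.
Proof.
move=> fl; elim: (index_enum I) => [|i r IH].
  under eq_fun do rewrite big_nil.
  by rewrite big_nil; exact: cvg_cst.
under eq_fun do rewrite big_cons.
by rewrite big_cons; exact: cvgD.
Qed.

Section weighted_average.
Variables (R : realType) (a : nat -> R).
Hypothesis a0 : forall k, 0 < a k.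
Hypothesis ainfty : series a k @[k --> \oo] --> +oo.

Lemma invr_series_cvg0 : (series a k)^-1 @[k --> \oo] --> (0 : R).
Proof.
apply/cvgrPdist_lt => eps eps0; near=> k.
have Sk : eps^-1 < series a k.
  by near: k; move/cvgryPgt : ainfty; exact.
have S0 : 0 < series a k by apply: lt_trans Sk; rewrite invr_gt0.
by rewrite sub0r normrN gtr0_norm ?invr_gt0// -ltf_pV2 ?posrE ?invr_gt0// invrK.
Unshelve. all: by end_near. Qed.

(** Toeplitz's lemma: the terms before [N] are negligible against the diverging sum of the
    weights. *)
Lemma weighted_average_cvg0 (delta : nat -> R) :
  delta k @[k --> \oo] --> (0 : R) ->
  series (fun k => a k * delta k) k / series a k @[k --> \oo] --> (0 : R).
Proof.
move=> delta0; apply/cvgrPdist_le => eps eps0.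
have [N _ NP] : \forall k \near \oo, `|delta k| <= eps / 2.
  move/cvgrPdist_le : delta0 => /(_ (eps / 2)) [|N _ NP]; first by rewrite divr_gt0.
  by exists N => // k /NP; rewrite /= sub0r normrN.
pose c := `|series (fun k => a k * delta k) N| + `|series a N|.
near=> k.
have Nk : (N <= k)%N by near: k; exact: nbhs_infty_ge.
(* Ensures [c + eps / 2 * (S + c) <= eps * S] for [S = series a k], where [c] bounds both sums up to
   [N]; the 1 makes [S] positive. *)
have Sc : 2 * c / eps + c + 1 < series a k.
  by near: k; move/cvgryPgt : ainfty; exact.
have c0 : 0 <= c by rewrite addr_ge0.
have S0 : 0 < series a k.
  by apply: lt_trans Sc; rewrite ltr_wpDl// addr_ge0// divr_ge0 ?mulr_ge0// ltW.
rewrite sub0r normrN normrM normfV (gtr0_norm S0) ler_pdivrMr//.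
have -> : series (fun k => a k * delta k) k =
    series (fun k => a k * delta k) N + \sum_(N <= j < k) a j * delta j.
  by rewrite /series /= (big_cat_nat _ _ (n := N)).
apply: le_trans (ler_normD _ _) _.
have h1 : `|\sum_(N <= j < k) a j * delta j| <= eps / 2 * \sum_(N <= j < k) a j.
  apply: le_trans (ler_norm_sum _ _ _) _; rewrite mulr_sumr.
  rewrite big_nat [leRHS]big_nat; apply: ler_sum => j /andP[Nj _].
  by rewrite normrM (gtr0_norm (a0 j)) mulrC ler_wpM2r ?NP// ltW.
have h2 : \sum_(N <= j < k) a j = series a k - series a N.
  by rewrite /series /= [in RHS](big_cat_nat _ _ (n := N))//= addrAC subrr add0r.
have h3 : 2 * c + eps * c <= eps * series a k.
  move: (ltW Sc); rewrite -(ler_pM2l eps0) => /(le_trans _); apply.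
  have e : eps * (2 * c / eps) = 2 * c by rewrite mulrC divfK// gt_eqF.
  have -> : eps * (2 * c / eps + c + 1) = eps * (2 * c / eps) + eps * c + eps by ring.
  by rewrite e; lra.
have h4 : - c <= series a N <= c.
  by rewrite -ler_norml /c lerDr.
have h5 : `|series (fun k => a k * delta k) N| <= c by rewrite /c lerDl.
move: h1; rewrite h2; nra.
Unshelve. all: by end_near. Qed.

(** Unrolled, [z k] is [z 0] minus [gam * series a k], minus a weighted sum of terms tending to 0,
    minus a convergent noise series. After division by [series a k] only [- gam] survives. *)
Lemma dual_average_cvg (z g xi : nat -> R) (gam : R) :
  (forall k, z k.+1 = z k - a k * g k) ->
  (g k - xi k) @[k --> \oo] --> gam ->
  cvgn (series (fun k => a k * xi k) : nat -> R^o) ->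
  z k / series a k @[k --> \oo] --> - gam.
Proof.
move=> zS ggam xicvg.
pose delta k := g k - xi k - gam.
have d0 : delta k @[k --> \oo] --> (0 : R).
  by rewrite -(subrr gam); apply: cvgB => //; exact: cvg_cst.
have zE k : z k = z 0 - gam * series a k - series (fun k => a k * delta k) k
    - series (fun k => a k * xi k) k.
  elim: k => [|k IH]; first by rewrite /series /= !big_geq// mulr0 !subr0.
  by rewrite zS IH /series /= !big_nat_recr//= /delta; ring.
have near_neq0 : \forall k \near \oo, series a k != 0.
  near=> k; rewrite gt_eqF//; near: k.
  by move/cvgryPgt : ainfty; exact.
have inv0 := invr_series_cvg0.
have H : (z 0 * (series a k)^-1 - gam
  - series (fun k => a k * delta k) k / series a k
  - series (fun k => a k * xi k) k * (series a k)^-1) @[k --> \oo]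
  --> z 0 * 0 - gam - 0 - limn (series (fun k => a k * xi k) : nat -> R^o) * 0.
  apply: cvgB; last by apply: cvgM; [exact: xicvg|].
  apply: cvgB; last exact: weighted_average_cvg0.
  apply: cvgB; last exact: cvg_cst.
  by apply: cvgM => //; exact: cvg_cst.
move: H; rewrite !mulr0 sub0r !subr0; apply: cvg_trans.
apply: near_eq_cvg; near=> k.
rewrite (zE k) !mulrBl mulfK//; near: k; exact: near_neq0.
Unshelve. all: by end_near. Qed.

End weighted_average.

Section identification.
Variables (R : realType) (p n : nat) (A : 'M[R]_(p, n)) (b : 'cV[R]_p).
Variables (xs : 'cV[R]_n) (x z : nat -> 'cV[R]_n) (S : nat -> R).
Variable lambda : 'cV[R]_(#|active A b xs|).
Hypothesis Kxs : polyhedron A b xs.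
Hypothesis xproj : forall k, projects A b (z k) (x k).
Hypothesis xcvg : dotp (x k - xs) (x k - xs) @[k --> \oo] --> (0 : R).
Hypothesis Sinfty : (S k)^-1 @[k --> \oo] --> (0 : R).
Hypothesis lambda0 : vlt 0 lambda.
Hypothesis zcvg : forall i,
  z k i 0 / S k @[k --> \oo] --> ((act_mx A b xs)^T *m lambda) i 0.

Let B := act_mx A b xs.
Let B' := mp_pinv B.

Let BE (u : 'cV[R]_n) i : (B *m u) i 0 = (A *m u) (enum_val i) 0.
Proof. exact: subrows_mul. Qed.

Lemma coord_cvg i : x k i 0 @[k --> \oo] --> xs i 0.
Proof.
apply/cvgrPdist_lt => eps eps0; near=> k.
have : dotp (x k - xs) (x k - xs) < eps ^+ 2.
  near: k; apply: (cvgr_lt (0 : R)) => //; exact: exprn_gt0.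
move=> /(le_lt_trans (coord_sqr_le_dotp _ i)).
rewrite !mxE distrC -real_normK ?num_real// ltr_sqr ?nnegrE//; exact: ltW.
Unshelve. all: by end_near. Qed.

(** The rows of [B] may be linearly dependent, so multipliers cannot be read off uniquely. The
    transposed pseudoinverse turns the deviation of the normalized [z k - x k] from [B^T *m lambda]
    into a correction of [lambda] that tends to 0 with it. *)
Let q k : 'cV[R]_(#|active A b xs|) :=
  B'^T *m ((S k)^-1 *: (z k - x k) - B^T *m lambda).

Let q0 i : q k i 0 @[k --> \oo] --> (0 : R).
Proof.
have h j : ((S k)^-1 *: (z k - x k) - B^T *m lambda) j 0 @[k --> \oo] --> (0 : R).
  have -> : (fun k => ((S k)^-1 *: (z k - x k) - B^T *m lambda) j 0) =
      (fun k => z k j 0 / S k - x k j 0 * (S k)^-1 - (B^T *m lambda) j 0).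
    by apply/funext => k; rewrite mxE [X in _ + X]mxE mxE 2!mxE; ring.
  have -> : 0 = (B^T *m lambda) j 0 - xs j 0 * 0 - (B^T *m lambda) j 0 by ring.
  apply: cvgB; last exact: cvg_cst.
  by apply: cvgB; [exact: zcvg|apply: cvgM => //; exact: coord_cvg].
have -> : (fun k => q k i 0) = (fun k => \sum_j B'^T i j *
   ((S k)^-1 *: (z k - x k) - B^T *m lambda) j 0).
  by apply/funext => k; rewrite /q mxE.
have e0 : \sum_j B'^T i j * 0 = 0 :> R.
  by apply: big1 => j _; rewrite mulr0.
rewrite -[X in _ --> X]e0.
exact: cvg_sumr (fun j => cvgM (cvg_cst (B'^T i j)) (h j)).
Qed.

Lemma eventually_same_active : \forall k \near \oo, same_active A b xs (x k).
Proof.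
have [rho rho0 rhoP] := inactive_near A b xs.
near=> k.
have inact i : (A *m xs) i 0 < b i 0 -> (A *m x k) i 0 < b i 0.
  apply: rhoP; near: k; exact: (cvgr_lt (0 : R)).
have act i : (A *m x k) i 0 = b i 0 -> (A *m xs) i 0 = b i 0.
  move=> xib; apply/eqP; move/eqP: xib; apply: contraLR => xsib.
  by rewrite lt_eqF//; apply: inact; rewrite lt_neqAle xsib/=; exact: Kxs.
have Kx : polyhedron A b (x k) by have [] := xproj k.
split; last first.
  move=> i; rewrite [ltLHS]subrows_mul [ltRHS]mxE; apply: inact.
  have := enum_valP i; rewrite inE lt_neqAle (Kxs _) andbT.
  by rewrite inE.
pose u := x k - xs.
have Au i : (A *m u) i 0 = (A *m x k) i 0 - (A *m xs) i 0.
  by rewrite mulmxBr mxE [X in _ + X]mxE.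
have h1 : dotp (z k - x k) u = 0.
  by apply: projects_face => // i xib; rewrite Au xib act// subrr.
(* As [B *m B' *m B = B], the vectors [u] and [B' *m (B *m u)] have the same image under [B]. Their
   difference is thus tangent to the constraints active at [x k], which are all among the rows of
   [B]. *)
have h2 : dotp (z k - x k) (u - B' *m (B *m u)) = 0.
  apply: projects_face => // i xib.
  have iact : i \in active A b xs by rewrite inE act.
  have -> : i = enum_val (enum_rank_in iact i) by rewrite enum_rankK_in.
  rewrite -BE mulmxBr !mulmxA.
  by have [-> _ _ _] := mp_pinvP B; rewrite subrr mxE.
pose sigma := - (B *m u).
have sigma_ge0 i : 0 <= sigma i 0.
  rewrite mxE BE oppr_ge0 Au subr_le0.
  have := enum_valP i; rewrite inE => /eqP ->; exact: Kx.
(* By [h1] and [h2] the residual [z k - x k] is orthogonal to [B' *m (B *m u)]; transposing [B']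
   moves this relation to the slacks [sigma], where the coefficients are eventually positive. *)
have sum0 : \sum_i (lambda i 0 + q k i 0) * sigma i 0 = 0.
  transitivity (dotp (lambda + q k) sigma).
    by apply: eq_bigr => i _; rewrite [X in _ = X * _]mxE.
  have BB : dotp (B^T *m lambda) (B' *m (B *m u)) = dotp lambda (B *m u).
    rewrite dotp_trmx_mul !mulmxA.
    by have [-> _ _ _] := mp_pinvP B.
  move: h2; rewrite dotpDr h1 add0r dotpNr => /eqP; rewrite oppr_eq0 => /eqP h2.
  rewrite dotpDl !dotpNr /q dotp_trmx_mul dotpDl dotpNl dotpZl h2 BB; ring.
have pos i : 0 < lambda i 0 + q k i 0.
  rewrite addrC -ltrBlDr sub0r; move: i; near: k.
  apply: filter_forall => i; apply: (cvgr_gt (0 : R)) => //.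
  by rewrite oppr_lt0; have := lambda0 i; rewrite mxE.
have sigma0 i : sigma i 0 = 0.
  move/eqP: sum0; rewrite psumr_eq0; last first.
    by move=> j _; rewrite mulr_ge0// ltW.
  move=> /allP /(_ i (mem_index_enum i)) /=.
  by rewrite mulf_eq0 gt_eqF//= => /eqP.
apply/colP => i; have := sigma0 i.
rewrite mxE BE Au => /eqP; rewrite oppr_eq0 subr_eq0 => /eqP e.
rewrite [LHS]subrows_mul e [RHS]mxE.
by have := enum_valP i; rewrite inE => /eqP.
Unshelve. all: by end_near. Qed.

End identification.

(** * Gradients of integrals of convex functions *)

Section gradient.
Variables (R : realType) (n : nat).
Implicit Types (g : 'cV[R]_n -> R) (t w a : 'cV[R]_n).

Lemma derive_dotp_grad g t w : gdifferentiable g t ->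
  'D_w (g : _ -> R^o) t = dotp (grad g t) w.
Proof.
move=> dg; rewrite deriveE//.
have {1}-> : w = \sum_i w i 0 *: delta_mx i 0.
  rewrite {1}[w]matrix_sum_delta; apply: eq_bigr => i _.
  by rewrite big_ord1.
rewrite linear_sum /dotp; apply: eq_bigr => i _.
by rewrite linearZ /= mxE deriveE// mulrC.
Qed.

(** Quotients along a sequence of steps are the form that suits dominated convergence and the
    measurability of pointwise limits. *)
Lemma diff_quotient_cvg g t w : gdifferentiable g t ->
  k.+1%:R * (g (t + k.+1%:R^-1 *: w) - g t) @[k --> \oo] --> dotp (grad g t) w.
Proof.
move=> dg; rewrite -derive_dotp_grad//.
have h0 : (k.+1%:R^-1 : R) @[k --> \oo] --> (0 : R)^'.
  move=> S S0.
  have hk : \forall k \near \oo, (k.+1%:R^-1 : R) != 0 -> S k.+1%:R^-1.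
    exact: (@cvg_harmonic R _ S0).
  change (\forall k \near \oo, S (k.+1%:R^-1 : R)).
  by apply: filterS hk => k; apply; rewrite invr_neq0// pnatr_eq0.
have := cvg_comp _ _ h0 (@diff_derivable _ _ _ _ t w dg).
apply: cvg_trans; apply: near_eq_cvg; apply: nearW => k /=.
by rewrite /GRing.scale /= invrK (addrC _ t).
Qed.

Lemma convex_segment_grad g t a : gdifferentiable g t ->
  (forall tau, 0 < tau <= 1 ->
     g (t + tau *: (a - t)) <= g t + tau * (g a - g t)) ->
  dotp (grad g t) (a - t) <= g a - g t.
Proof.
move=> /(@diff_quotient_cvg g t (a - t)) h conv.
rewrite -(cvg_lim _ h)//; apply: limr_le; first exact: cvgP h.
near=> k; rewrite mulrC -ler_pdivlMr// lerBlDl.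
apply: le_trans (conv _ _) _; first by rewrite invr_gt0 ltr0n/= invf_le1 ?ler1n.
by rewrite mulrC.
Unshelve. all: by end_near. Qed.

(** Convexity of the exponential, applied to logarithms. If an endpoint value is zero, the
    right-hand side of log-convexity is minus infinity, which excludes a positive value in
    between. *)
Lemma log_convex_on_convex (S : set 'cV[R]_n) g tau u w : log_convex_on S g ->
  0 < tau < 1 -> S u -> S w ->
  g (tau *: u + (1 - tau) *: w) <= tau * g u + (1 - tau) * g w.
Proof.
move=> [g0 gc] /andP[tau0 tau1] Su Sw.
have := gc tau u w; rewrite tau0 tau1 => /(_ isT Su Sw).
set y := g (_ + _) => h.
have t1 : 0 < 1 - tau by rewrite subr_gt0.
have rhs0 : 0 <= tau * g u + (1 - tau) * g w.
  by rewrite addr_ge0// mulr_ge0 ?g0// ltW.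
have [y0|y0] := leP y 0; first exact: le_trans y0 rhs0.
move: h; rewrite (lne_EFin y0).
have [u0|u0] := leP (g u) 0.
  have -> : lne (g u)%:E = -oo%E by apply: le0_lneNy; rewrite lee_fin.
  by rewrite gt0_muleNy ?lte_fin// addNye leeNy_eq.
have [w0|w0] := leP (g w) 0.
  have -> : lne (g w)%:E = -oo%E by apply: le0_lneNy; rewrite lee_fin.
  by rewrite gt0_muleNy ?lte_fin// addeNy leeNy_eq.
rewrite !lne_EFin// -!EFinM -EFinD lee_fin => h.
apply: (@le_trans _ _ (expR (tau * ln (g u) + (1 - tau) * ln (g w)))).
  by rewrite -{1}(lnK y0) ler_expR.
have := convex_expR (Itv01 (ltW tau0) (ltW tau1)) (ln (g u)) (ln (g w)).
by rewrite !convRE /= !lnK.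
Qed.

End gradient.


Section grad_integral.
Context d (E : measurableType d) (R : realType) (P : probability E R).
Variables (n : nat) (rho : E -> R) (l : E -> 'cV[R]_n -> R) (u a : 'cV[R]_n).

Let pt tau := u + tau *: (a - u).
Let V w := \int[P]_x (rho x * l x w).

Hypothesis rho0 : forall x, 0 <= rho x.
Hypothesis dl : forall x, gdifferentiable (l x) u.
Hypothesis conv : forall x s tau, 0 < s <= 1 -> 0 < tau <= 1 ->
  l x (pt (s * tau)) <= l x u + s * (l x (pt tau) - l x u).
Hypothesis il : forall tau, 0 <= tau <= 1 ->
  P.-integrable setT (fun x => (rho x * l x (pt tau))%:E).
Hypothesis ig : forall i,
  P.-integrable setT (fun x => (rho x * grad (l x) u i 0)%:E).
Hypothesis dV : gdifferentiable V u.

Let D x := rho x * dotp (grad (l x) u) (a - u).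
Let q k x := rho x * (k.+1%:R * (l x (pt k.+1%:R^-1) - l x u)).

Let k1 k : 0 < (k.+1%:R^-1 : R) <= 1.
Proof. by rewrite invr_gt0 ltr0n/= invf_le1 ?ler1n. Qed.

Let pt0 : pt 0 = u. Proof. by rewrite /pt scale0r addr0. Qed.

Let pt1 : pt 1 = a. Proof. by rewrite /pt scale1r addrC subrK. Qed.

Let D_le_q x k : D x <= q k x.
Proof.
rewrite /D /q ler_wpM2l//.
have := @convex_segment_grad R n (l x) u (pt k.+1%:R^-1) (dl x).
have -> : pt k.+1%:R^-1 - u = k.+1%:R^-1 *: (a - u) by rewrite /pt addrAC subrr add0r.
rewrite dotpZr -ler_pdivlMl ?invr_gt0// invrK; apply => s s01.
by rewrite scalerA; apply: conv.
Qed.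

Let q_le_q0 x k : q k x <= q 0 x.
Proof.
rewrite /q ler_wpM2l// invr1 mul1r.
rewrite mulrC -ler_pdivlMr// lerBlDl mulrC.
by have := conv x (k1 k) (_ : 0 < 1 <= 1); rewrite mulr1; apply; rewrite ltr01 lexx.
Qed.

Let q_cvg x : q k x @[k --> \oo] --> D x.
Proof. by apply: cvgMr; exact: diff_quotient_cvg. Qed.

Let DE x : D x = \sum_i rho x * grad (l x) u i 0 * (a - u) i 0.
Proof. by rewrite /D /dotp mulr_sumr; apply: eq_bigr => i _; rewrite mulrA. Qed.

Let iDi i : P.-integrable setT
  (fun x => (rho x * grad (l x) u i 0 * (a - u) i 0)%:E).
Proof. by under eq_fun do rewrite EFinM; exact: integrableZr. Qed.

Let iD : P.-integrable setT (fun x => (D x)%:E).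
Proof.
under eq_fun do rewrite DE -sumEFin.
by apply: integrable_sum => // i _; exact: iDi.
Qed.

Let iu : P.-integrable setT (fun x => (rho x * l x u)%:E).
Proof. by rewrite -{1}pt0; apply: il; rewrite lexx ler01. Qed.

Let qE k : (fun x => (q k x)%:E) = (fun x => k.+1%:R%:E *
  ((rho x * l x (pt k.+1%:R^-1))%:E - (rho x * l x u)%:E))%E.
Proof. by apply/funext => x; rewrite -EFinB -EFinM /q; congr (_%:E); ring. Qed.

Let iq k : P.-integrable setT (fun x => (q k x)%:E).
Proof.
rewrite qE; apply: integrableZl => //; apply: integrableB => //.
by apply: il; have /andP[/ltW -> ->] := k1 k.
Qed.

Let int_q k : (\int[P]_x (q k x)%:E = (k.+1%:R * (V (pt k.+1%:R^-1) - V u))%:E)%E.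
Proof.
have ipt : P.-integrable setT (fun x => (rho x * l x (pt k.+1%:R^-1))%:E).
  by apply: il; have /andP[/ltW -> ->] := k1 k.
rewrite qE integralZl//; last exact: integrableB.
rewrite integralB// EFinM EFinB /V /Rintegral !fineK//; exact: integrable_fin_num.
Qed.

(** The difference quotients of a convex function decrease as the step shrinks, so
    [D <= q k <= q 0], which supplies the dominating function. They integrate to the difference
    quotients of [V], whose limit is its directional derivative. *)
Let int_D : (\int[P]_x (D x)%:E = (dotp (grad V u) (a - u))%:E)%E.
Proof.
pose gd x : \bar R := (`|D x| + `|q 0 x|)%:E.
have igd : P.-integrable setT gd.
  rewrite /gd; under eq_fun do rewrite EFinD.
  by apply: integrableD => //; apply: integrable_norm => //; exact: iq.
have [||||_ _ h1] := @dominated_convergence _ E R P setT measurableT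
  (fun k x => (q k x)%:E) (fun x => (D x)%:E) gd _ _ _ igd.
- by move=> k; exact: measurable_int (iq k).
- exact: measurable_int iD.
- apply: aeW => x _; apply: cvg_EFin; first exact: nearW.
  exact: q_cvg.
- apply: aeW => x k _; rewrite lee_fin.
  have := D_le_q x k; have := q_le_q0 x k.
  have := ler_norm (q 0 x); have := lerNnormlW (lexx `|D x|).
  have := normr_ge0 (D x); have := normr_ge0 (q 0 x).
  by move=> *; rewrite ler_norml; lra.
have h2 : (\int[P]_x (q k x)%:E)%E @[k --> \oo] --> (dotp (grad V u) (a - u))%:E.
  under eq_fun do rewrite int_q.
  by apply: cvg_EFin; [exact: nearW|exact: diff_quotient_cvg].
exact: (cvg_unique _ h1 h2).
Qed.

(** Convexity and integrability of [l] are available only on the segment from [u] to [a], hence an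
    identity in the direction [a - u] instead of one for each coordinate. *)
Lemma dotp_integral_grad :
  dotp (\col_i \int[P]_x (rho x * grad (l x) u i 0)) (a - u) =
  dotp (grad V u) (a - u).
Proof.
apply: EFin_inj; rewrite -int_D.
under [RHS]eq_integral do rewrite DE -sumEFin.
rewrite integral_sum// /dotp -sumEFin; apply: eq_bigr => i _.
rewrite mxE; under [RHS]eq_integral do rewrite EFinM.
by rewrite integralZr// EFinM /Rintegral fineK//; exact: integrable_fin_num.
Qed.

(** The integrated form of [D <= q 0]: [V] inherits from [l] the first-order inequality of convex
    functions. *)
Lemma dotp_integral_grad_le : dotp (grad V u) (a - u) <= V a - V u.
Proof.
rewrite -lee_fin -int_D.
have := int_q 0; rewrite invr1 mul1r pt1 => <-.
by apply: le_integral => // x _; rewrite lee_fin D_le_q.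
Qed.

End grad_integral.

(** * Measurability *)

Lemma integral_likelihood_ratio d (E : measurableType d) (R : realType)
    (P P' : probability E R) (l f : E -> R) :
  P `<< P' ->
  ae_eq P' setT (fun x => (l x)%:E)
    (Radon_Nikodym (charge_of_finite_measure P) P') ->
  measurable_fun setT l -> P.-integrable setT (fun x => (f x)%:E) ->
  (\int[P']_x (f x * l x)%:E = \int[P]_x (f x)%:E)%E.
Proof.
move=> PP' lE ml fi.
have mf := measurable_int _ fi.
rewrite -(Radon_Nikodym_change_of_variables PP' measurableT fi).
apply: ae_eq_integral => //.
- apply/measurable_EFinP; apply: measurable_funM => //.
  exact/measurable_EFinP.
- by apply: emeasurable_funM.
- by apply: filterS lE => x /= lx _; rewrite EFinM lx.
Qed.

Section noise_multiplier.
Context d d' (T : measurableType d) (E : measurableType d') (R : realType).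
Variables (Q : probability T R) (H : nat -> set (set T)).
Hypothesis HT : forall n, H n `<=` measurable.
Hypothesis HS : forall n, H n `<=` H n.+1.
Variables (Z : nat -> T -> E) (kappa : nat -> T -> probability E R).
Hypothesis mZ : forall k,
  measurable_fun setT (Z k : g_sigma_algebraType (H k.+1) -> E).
Hypothesis mkappa : forall k B, measurable B ->
  measurable_fun setT ((kappa k ^~ B) : g_sigma_algebraType (H k) -> \bar R).
Hypothesis kappaE : forall k A B, <<s H k>> A -> measurable B ->
  (Q (A `&` Z k @^-1` B) = \int[Q]_(w in A) kappa k w B)%E.
Variables (phi : nat -> T -> E -> R) (C : R) (a : nat -> R).
Hypothesis mphi : forall k, measurable_fun setT
  ((fun z => phi k z.1 z.2) : g_sigma_algebraType (H k) * E -> R).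
Hypothesis phi2 : forall k w, (\int[kappa k w]_y (phi k w y ^+ 2)%:E <= C%:E)%E.
Hypothesis acvg : cvgn (series (fun k => a k ^+ 2)).
Variables (c : nat -> T -> R) (M : R).
Hypothesis mc : forall k,
  measurable_fun setT (c k : g_sigma_algebraType (H k) -> R).
Hypothesis cM : forall k w, `|c k w| <= M.

(** The multiplier is known given the past, so it can be moved inside the observable: [phi'] has
    kernel mean [c] times that of [phi] and second moment at most [M ^+ 2 * C]. *)
Lemma noise_series_multiplier_cvg : {ae Q, forall w,
  cvgn (series (fun k => a k * (c k w * (phi k w (Z k w)
    - noise_mean kappa phi k w))) : nat -> R^o)}.
Proof.
have mphi1 k w : measurable_fun setT (phi k w).
  have := @measurableT_comp _ _ _ E (g_sigma_algebraType (H k) * E)%type R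
    (fun z => phi k z.1 z.2) setT (pair w) (@mphi k).
  by apply; exact: (@pair1_measurable _ _ (g_sigma_algebraType (H k))).
pose phi' k w y := c k w * phi k w y.
have mc1 k : measurable_fun setT
    ((fun z => c k z.1) : g_sigma_algebraType (H k) * E -> R).
  have := @measurableT_comp _ _ _ (g_sigma_algebraType (H k) * E)%type
    (g_sigma_algebraType (H k)) R (c k) setT fst (@mc k).
  by apply; exact: measurable_fst.
have meanE k w : noise_mean kappa phi' k w = c k w * noise_mean kappa phi k w.
  rewrite /noise_mean /phi'; under eq_integral do rewrite EFinM.
  rewrite integralZl//; last exact: (sqr_bound_integrable (@mphi1 k w) (phi2 k w)).
  rewrite fineM//; apply: integrable_fin_num => //.
  exact: (sqr_bound_integrable (@mphi1 k w) (phi2 k w)).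
have mphi' k : measurable_fun setT
    ((fun z => phi' k z.1 z.2) : g_sigma_algebraType (H k) * E -> R).
  exact: measurable_funM.
have phi'2 k w : (\int[kappa k w]_y (phi' k w y ^+ 2)%:E <= (M ^+ 2 * C)%:E)%E.
  rewrite /phi'; under eq_integral do rewrite exprMn EFinM.
  rewrite ge0_integralZl//; last 3 first.
  - by apply/measurable_EFinP; apply: measurable_funX.
  - by move=> y _; rewrite lee_fin sqr_ge0.
  - by rewrite lee_fin sqr_ge0.
  rewrite (EFinM (M ^+ 2)); apply: lee_pmul => //.
  - by rewrite lee_fin sqr_ge0.
  - by apply: integral_ge0 => y _; rewrite lee_fin sqr_ge0.
  rewrite lee_fin -(real_normK (num_real (c k w))) ler_sqr ?nnegrE//.
    exact: le_trans (normr_ge0 _) (cM k w).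
  exact: phi2.
have := noise_series_cvg HT HS mZ mkappa kappaE mphi' phi'2 acvg.
apply: filterS => w.
have -> : (fun k => a k * (phi' k w (Z k w) - noise_mean kappa phi' k w)) =
    (fun k => a k * (c k w * (phi k w (Z k w) - noise_mean kappa phi k w))).
  by apply/funext => k; rewrite meanE /phi' -mulrBr.
exact.
Qed.

End noise_multiplier.

Section borel_cV.
Context d (T : measurableType d) (R : realType).

(** The boxes with rational centre and radius [N.+1%:R^-1] are countably many, and those contained
    in an open set cover it; each of them is described by the coordinates. *)
Lemma measurable_cV (n : nat) (f : T -> 'cV[R]_n) :
  (forall i, measurable_fun setT (fun w => f w i 0)) ->
  measurable_fun setT (f : T -> borel_cV R n).
Proof.
move=> mf.
apply: (@measurability _ _ T (borel_cV R n) setT f (@open 'cV[R]_n)) => //.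
move=> _ [U oU <-].
rewrite setTI.
pose box (q : 'cV[rat]_n * nat) : set 'cV[R]_n :=
  [set v | forall i, `|v i 0 - ratr (q.1 i 0)| < q.2.+1%:R^-1].
have mbox q : measurable (f @^-1` box q).
  have -> : f @^-1` box q = ~` \bigcup_i
      [set w | q.2.+1%:R^-1 <= `|f w i 0 - ratr (q.1 i 0)|].
    apply/seteqP; split => w /=.
      by move=> h [i _ /=]; rewrite leNgt h.
    move=> h i; rewrite ltNge; apply/negP => h'; apply: h.
    by exists i.
  apply: measurableC; apply: countable_bigcupT_measurable => [|i].
    exact: countableP.
  have mi : measurable_fun setT (fun w => `|f w i 0 - ratr (q.1 i 0)|).
    apply: (measurableT_comp (@normr_measurable R setT)).
    exact: measurable_funB.
  have := measurable_fun_ler (measurable_cst (q.2.+1%:R^-1 : R)) mi.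
  by move=> /(_ measurableT [set true] I); rewrite setTI.
have -> : f @^-1` U = \bigcup_q
    (if `[< box q `<=` U >] then f @^-1` box q else set0).
  apply/seteqP; split => w; last first.
    by move=> [q _]; case: asboolP => // Iq bq; exact: Iq bq.
  move=> Ufw.
  have /nbhs_ballP[e /= e0 eU] : nbhs (f w) U by exact: open_nbhs_nbhs.
  have [N Ne] : exists N, N.+1%:R^-1 < e / 2 :> R.
    have [N _ /(_ N (leqnn _))] := near_infty_natSinv_lt (PosNum (divr_gt0 e0 (@ltr0n R 2))).
    by exists N.
  have /fin_all_exists[q qP] : forall i, exists r : rat,
      `|f w i 0 - ratr r| < N.+1%:R^-1 :> R.
    move=> i.
    have : ball (f w i 0) (N.+1%:R^-1) `&` range (ratr : rat -> R) !=set0.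
      apply: dense_rat; last exact: ball_open.
      by exists (f w i 0); apply: ballxx; rewrite invr_gt0.
    by move=> [y [/= h [r _ ry]]]; exists r; rewrite ry.
  have qP' i : `|f w i 0 - ratr ((\col_i q i) i 0)| < N.+1%:R^-1 by rewrite mxE.
  exists (\col_i q i, N) => //; case: asboolP => // nU; exfalso; apply: nU.
  move=> v bv; apply: eU; split => // i j; rewrite ord1.
  rewrite /ball /=; pose r : R := ratr ((\col_i q i) i 0).
  have h2 : `|f w i 0 - r| < N.+1%:R^-1 by exact: qP'.
  have h3 : `|v i 0 - r| < N.+1%:R^-1 by exact: bv.
  have -> : f w i 0 - v i 0 = (f w i 0 - r) - (v i 0 - r) by ring.
  apply: le_lt_trans (ler_normB _ _) _.
  by rewrite (splitr e) ltrD// (lt_trans _ Ne).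
apply: countable_bigcupT_measurable => [|q]; first exact: countableP.
by case: ifP.
Qed.

Lemma measurable_cV_continuous (n : nat) (g : 'cV[R]_n -> R) :
  continuous (g : 'cV[R]_n -> R^o) -> measurable_fun setT (g : borel_cV R n -> R).
Proof.
move=> cg; apply: (measurability _ (RGenOpens.measurableE R)).
move=> _ [_ [x [y ->]] <-].
rewrite setTI; apply: sub_sigma_algebra.
by move/continuousP : cg; apply; exact: interval_open.
Qed.

Lemma measurable_cV_coord (n : nat) (i : 'I_n) :
  measurable_fun setT (fun t : borel_cV R n => (t : 'cV[R]_n) i 0).
Proof. by apply: measurable_cV_continuous; exact: coord_continuous. Qed.

End borel_cV.

Section measurable_maps.
Context d (T : measurableType d) (R : realType).

Lemma measurable_fun_coord (n : nat) (t : T -> 'cV[R]_n) (i : 'I_n) :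
  measurable_fun setT (t : T -> borel_cV R n) ->
  measurable_fun setT (fun w => t w i 0).
Proof.
move=> mt.
exact: (@measurableT_comp _ _ _ T (borel_cV R n) R _ setT t
  (@measurable_cV_coord R n i) mt).
Qed.

Lemma measurable_forall (I : finType) (S : I -> set T) :
  (forall i, measurable (S i)) -> measurable [set w | forall i, S i w].
Proof.
move=> mS; have -> : [set w | forall i, S i w] = ~` \bigcup_i ~` S i.
  apply/seteqP; split => w /=; first by move=> h [i _]; apply; exact: h.
  by move=> h i; apply: contrapT => nS; apply: h; exists i.
apply: measurableC; apply: countable_bigcupT_measurable => [|i].
  exact: countableP.
exact/measurableC.
Qed.

Lemma measurable_grad (n : nat) (f : T -> 'cV[R]_n -> R) (t : T -> 'cV[R]_n)
    (i : 'I_n) :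
  measurable_fun setT (fun w => f w (t w)) ->
  (forall c, measurable_fun setT (fun w => f w (t w + c))) ->
  (forall w, gdifferentiable (f w) (t w)) ->
  measurable_fun setT (fun w => grad (f w) (t w) i 0).
Proof.
move=> m0 mc dt.
apply: (measurable_fun_cvg (h := fun k w => k.+1%:R *
  (f w (t w + k.+1%:R^-1 *: delta_mx i 0) - f w (t w)))) => [k|w _].
  by apply: measurable_funM => //; exact: measurable_funB.
have -> : grad (f w) (t w) i 0 = dotp (grad (f w) (t w)) (delta_mx i 0).
  rewrite /dotp (bigD1 i)//= big1 ?addr0 => [|j ji].
    by rewrite [X in _ * X]mxE !eqxx mulr1.
  by rewrite [X in _ * X]mxE (negbTE ji) mulr0.
exact: diff_quotient_cvg.
Qed.

(** The active set takes finitely many values. [kap] is real-valued because the matrix of active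
    rows changes size with the point; it will be an entry of the kernel projector. *)
Lemma measurable_active (p n : nat) (A : 'M[R]_(p, n)) (b : 'cV[R]_p)
    (t : T -> 'cV[R]_n) (kap : {set 'I_p} -> R) :
  measurable_fun setT (t : T -> borel_cV R n) ->
  measurable_fun setT (fun w => kap (active A b (t w))).
Proof.
move=> mt _ B mB; rewrite setTI.
have mA i : measurable [set w | (A *m t w) i 0 = b i 0].
  have mi : measurable_fun setT (fun w => (A *m t w) i 0).
    under eq_fun do rewrite mxE.
    apply: measurable_sum => j; apply: measurable_funM => //.
    exact: measurable_fun_coord.
  have := measurable_fun_eqr mi (measurable_cst (b i 0)).
  move=> /(_ measurableT [set true] I); rewrite setTI; congr measurable.
  by apply/seteqP; split => w /= /eqP.
have -> : (fun w => kap (active A b (t w))) @^-1` B = \bigcup_S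
    (if `[< B (kap S) >] then [set w | forall i, (i \in S) = (i \in active A b (t w))]
     else set0).
  apply/seteqP; split => w.
    by move=> Bw; exists (active A b (t w)) => //; case: asboolP.
  move=> [S _]; case: asboolP => // BS /= h.
  by rewrite /preimage /= (_ : active A b (t w) = S)//; apply/setP => i.
apply: countable_bigcupT_measurable => [|S]; first exact: countableP.
case: ifP => // _; apply: measurable_forall => i.
have [iS|iS] := boolP (i \in S).
  rewrite [X in measurable X](_ : _ = [set w | (A *m t w) i 0 = b i 0])//.
  apply/seteqP; split => w /=; rewrite inE.
    by move=> /esym/eqP.
  by move=> ->; rewrite eqxx.
rewrite [X in measurable X](_ : _ = ~` [set w | (A *m t w) i 0 = b i 0]).
  exact: measurableC.
apply/seteqP; split => w /=; rewrite inE.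
  by move=> /esym/negbT/eqP.
by move=> /eqP/negbTE ->.
Qed.

(** Projections are nonexpansive, so the preimage of an open set under [x] is the preimage under [z]
    of a union of open balls centred at the values of [z]. The union may be uncountable but it is
    open, hence Borel. *)
Lemma measurable_projects (p n : nat) (A : 'M[R]_(p, n)) (b : 'cV[R]_p)
    (z x : T -> 'cV[R]_n) :
  (forall w, projects A b (z w) (x w)) ->
  measurable_fun setT (z : T -> borel_cV R n) ->
  measurable_fun setT (x : T -> borel_cV R n).
Proof.
move=> zx mz.
have lip w w' : dotp (x w - x w') (x w - x w') <= dotp (z w - z w') (z w - z w').
  have [Kx vi] := zx w; have [Kx' vi'] := zx w'.
  have := dotp_ge0 ((z w - z w') - (x w - x w')).
  have := vi _ Kx'; have := vi' _ Kx; rewrite !dotpE.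
  have := (dotpC (z w) (z w'), dotpC (x w) (x w'), dotpC (z w) (x w),
    dotpC (z w') (x w), dotpC (z w) (x w'), dotpC (z w') (x w')).
  by move=> [[[[[e1 e2] e3] e4] e5] e6]; lra.
apply: (@measurability _ _ T (borel_cV R n) setT x (@open 'cV[R]_n)) => //.
move=> _ [U oU <-]; rewrite setTI.
pose near_ w e : set 'cV[R]_n := [set v | dotp (v - z w) (v - z w) < e ^+ 2].
have near_open w e : open (near_ w e).
  have cont : continuous (fun v : 'cV[R]_n => dotp (v - z w) (v - z w) : R^o).
    move=> v; have ci i : (u - z w) i 0 @[u --> v] --> (v - z w) i 0.
      have cc := cvgB (@coord_continuous R n 1 i 0 v) (cvg_cst (z w i 0)).
      have -> : (fun u : 'cV[R]_n => (u - z w) i 0) = (fun u => u i 0 - z w i 0).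
        by apply/funext => u; rewrite !mxE.
      have -> : (v - z w) i 0 = v i 0 - z w i 0 by rewrite !mxE.
      exact: cc.
    exact: (cvg_sumr (nbhs_filter v) (fun i => cvgM (ci i) (ci i))).
  move/continuousP : cont => /(_ [set y | y < e ^+ 2]); apply.
  exact: open_lt.
pose V := \bigcup_(we in [set we : T * R | 0 < we.2 /\ ball (x we.1) we.2 `<=` U])
  near_ we.1 we.2.
have -> : x @^-1` U = z @^-1` V.
  apply/seteqP; split => w.
    move=> Uxw; have /nbhs_ballP[e /= e0 eU] : nbhs (x w) U by exact: open_nbhs_nbhs.
    exists (w, e) => //=; rewrite /near_ /= subrr dotp0l exprn_gt0//.
  move=> [[w' e] /= [e0 eU] zw]; apply: eU; split => // i j; rewrite ord1.
  rewrite /ball /= distrC -ltr_sqr ?nnegrE ?(ltW e0)// real_normK ?num_real//.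
  apply: le_lt_trans zw; apply: le_trans (lip w w').
  by have := coord_sqr_le_dotp (x w - x w') i; rewrite !mxE.
rewrite -[X in measurable X]setTI; apply: mz => //.
by apply: sub_sigma_algebra; exact: bigcup_open.
Qed.

End measurable_maps.

(** * Step sizes and projections *)

Section step_sizes.
Variables (R : realType) (alpha gamma : R).
Hypothesis alpha0 : 0 < alpha.
Hypothesis gammaP : 2^-1 < gamma < 1.

Let a k := step alpha gamma k.+1.

Let q := 2 * gamma - 1.

Let q0 : 0 < q.
Proof. by move: gammaP => /andP[h _]; rewrite /q; lra. Qed.

Lemma step_gt0 k : 0 < a k.
Proof. by rewrite divr_gt0// powR_gt0. Qed.

Lemma step_series_infty : series a k @[k --> \oo] --> +oo.
Proof.
have nda : nondecreasing_seq (series a).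
  move=> i j ij; rewrite /series /= [leRHS](big_cat_nat _ _ (n := i))//= lerDl.
  by apply: sumr_ge0 => k _; rewrite ltW// step_gt0.
apply: nondecreasing_dvgn_lt => // ca.
have g01 : 0 <= gamma <= 1 by move: gammaP => /andP[? ?]; apply/andP; split; lra.
apply: (dvg_riemannR g01).
have -> : series (riemannR gamma) = alpha^-1 *: (series a : nat -> R^o).
  apply/funext => n; rewrite /series /= !fctE /GRing.scale /= mulr_sumr.
  by apply: eq_bigr => k _; rewrite /a /step mulKf// gt_eqF.
exact: is_cvgZr.
Qed.

(** The discrete comparison with the integral of [t^(-2 gamma)], a primitive of which is
    [- t^(-q) / q]. It follows from [ln (1 + h) <= h] and [1 + h <= expR h]. *)
Lemma powR_telescope (n : nat) :
  q * (n.+2%:R `^ (2 * gamma))^-1 <= n.+1%:R `^ (- q) - n.+2%:R `^ (- q).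
Proof.
have x0 : 0 < n.+1%:R :> R by [].
have y0 : 0 < n.+2%:R :> R by [].
rewrite -powRN /powR !gt_eqF//.
set lx := ln n.+1%:R; set ly := ln n.+2%:R.
have lxy : lx - ly <= - n.+2%:R^-1.
  rewrite /lx /ly -ln_div// (_ : _ / _ = 1 + (- n.+2%:R^-1)).
    by apply: le_ln1Dx; rewrite ltrN2 invf_lt1// ltr1n.
  have yn : n.+2%:R != 0 :> R by rewrite gt_eqF.
  by apply: (mulIf yn); rewrite divfK// mulrDl mulNr mulVf// mul1r -(natr1 n.+1) addrK.
have -> : - (2 * gamma) * ly = - q * ly - ly by rewrite /q; ring.
have -> : - q * lx = - q * ly + q * (ly - lx) by ring.
rewrite !expRD expRN lnK//.
have e1 : 1 + q * (ly - lx) <= expR (q * (ly - lx)) by exact: expR_ge1Dx.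
have e2 : q * n.+2%:R^-1 <= q * (ly - lx) by rewrite ler_pM2l// -(opprB lx ly) lerNr.
have := expR_ge0 (- q * ly).
set E := expR (- q * ly); set z := n.+2%:R^-1 in e2 *; set F := expR _ in e1 *.
move=> E0; have : E * (q * z) <= E * (F - 1) by rewrite ler_wpM2l//; lra.
by lra.
Qed.

Lemma step_sqr_cvg : cvgn (series (fun k => a k ^+ 2) : nat -> R^o).
Proof.
apply: nondecreasing_is_cvgn.
  move=> i j ij; rewrite /series /= [leRHS](big_cat_nat _ _ (n := i))//= lerDl.
  by apply: sumr_ge0 => k _; exact: sqr_ge0.
(* The 1 accounts for the first term, [q^-1] for the telescoping bound on all later ones. *)
exists (alpha ^+ 2 * (1 + q^-1)) => _ [n _ <-].
have aE k : a k ^+ 2 = alpha ^+ 2 * (k.+1%:R `^ (2 * gamma))^-1.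
  rewrite /a /step expr_div_n; congr (_ * _^-1).
  by rewrite (mulrC 2) powRrM powR_mulrn ?powR_ge0.
have bound m : series (fun k => (k.+1%:R `^ (2 * gamma))^-1) m.+1 <=
    1 + q^-1 * (1 - m.+1%:R `^ (- q)).
  elim: m => [|m IH].
    rewrite /series /= big_nat1 (_ : 1%N%:R = 1 :> R)//.
    by rewrite !powR1 invr1 subrr mulr0 addr0.
  rewrite /series /= big_nat_recr//=; apply: le_trans (lerD IH (lexx _)) _.
  rewrite -addrA lerD2l -lerBrDl -mulrBr ler_pdivlMl//.
  by apply: le_trans (powR_telescope m) _; lra.
rewrite {1}/series /=; under eq_bigr do rewrite aE.
rewrite -mulr_sumr ler_wpM2l ?sqr_ge0//.
case: n => [|n]; first by rewrite big_geq// addr_ge0// invr_ge0 ltW.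
apply: le_trans (bound n) _; rewrite lerD2l ler_piMr ?invr_ge0 ?(ltW q0)//.
Qed.

End step_sizes.

Section polyhedron_theory.
Variables (R : realType) (p n : nat) (A : 'M[R]_(p, n)) (b : 'cV[R]_p).
Let K := polyhedron A b.

Lemma polyhedron_segment x y tau : K x -> K y -> 0 <= tau <= 1 ->
  K (x + tau *: (y - x)).
Proof.
move=> Kx Ky /andP[t0 t1] i.
have -> : (A *m (x + tau *: (y - x))) i 0 =
    (1 - tau) * (A *m x) i 0 + tau * (A *m y) i 0.
  rewrite mulmxDr -scalemxAr mulmxBr mxE [X in _ + X]mxE [X in _ * X]mxE.
  by rewrite [X in _ * (_ + X)]mxE; ring.
have -> : b i 0 = (1 - tau) * b i 0 + tau * b i 0 by ring.
have := Kx i; have := Ky i => Kyi Kxi.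
by apply: lerD; rewrite ler_wpM2l ?subr_ge0.
Qed.

(* First-order optimality along the segments of [K]. *)
Lemma argmin_projects (t0 sm x : 'cV[R]_n) : K x ->
  (forall y, K y -> dotp sm x + 2^-1 * enorm (x - t0) ^+ 2 <=
                    dotp sm y + 2^-1 * enorm (y - t0) ^+ 2) ->
  projects A b (t0 - sm) x.
Proof.
move=> Kx xmin; split => // y Ky.
have [u uE] : exists u, u = y - x by exists (y - x).
rewrite -uE; have h tau : 0 < tau <= 1 ->
    dotp (t0 - sm - x) u <= tau * (2^-1 * dotp u u).
  move=> /andP[tau0 tau1].
  have := xmin _ (polyhedron_segment Kx Ky (_ : 0 <= tau <= 1)).
  rewrite (ltW tau0) tau1 => /(_ isT); rewrite -uE !enorm_sqr.
  rewrite !dotpE (dotpC u x) (dotpC u t0) => h.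
  rewrite -(ler_pM2l tau0); lra.
apply/ler_addgt0Pr => eps eps0; rewrite add0r.
have c0 := dotp_ge0 u.
pose tau := Num.min 1 (eps / (1 + dotp u u)).
have d0 : 0 < 1 + dotp u u by rewrite ltr_pwDl.
have tau0 : 0 < tau by rewrite lt_min ltr01 divr_gt0.
have tau1 : tau <= 1 by rewrite ge_min lexx.
apply: le_trans (h tau _) _; first by rewrite tau0.
have : tau <= eps / (1 + dotp u u) by rewrite ge_min lexx orbT.
rewrite ler_pdivlMr//; nra.
Qed.

End polyhedron_theory.

Lemma dotp_suml (R : realType) (n N : nat) (u : nat -> 'cV[R]_n) w :
  dotp (\sum_(0 <= k < N) u k) w = \sum_(0 <= k < N) dotp (u k) w.
Proof.
elim: N => [|N IH]; first by rewrite !big_geq// dotp0l.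
by rewrite !big_nat_recr//= dotpDl IH.
Qed.

(** The objective is a function of [z.1] plus a function of [z.2]; comparing the minimizer with
    pairs that share one coordinate decouples the two problems. *)
Lemma da_objective_projects (R : realType) (s m p q : nat)
    (A : 'M[R]_(p, s)) (b : 'cV[R]_p) (C : 'M[R]_(q, m)) (d : 'cV[R]_q)
    (a : nat -> R) t0 mu0 g h n x y :
  argmin (polyhedron A b `*` polyhedron C d) (da_objective a t0 mu0 g h n)
    = [set (x, y)] ->
  projects A b (t0 - \sum_(0 <= k < n.+1) a k.+1 *: g k) x /\
  projects C d (mu0 - \sum_(0 <= k < n.+1) a k.+1 *: h k) y.
Proof.
move=> xyE.
have [[/= Ax Cy] xymin] : argmin (polyhedron A b `*` polyhedron C d)
    (da_objective a t0 mu0 g h n) (x, y) by rewrite xyE.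
have objE z : da_objective a t0 mu0 g h n z =
    dotp (\sum_(0 <= k < n.+1) a k.+1 *: g k) z.1
    + 2^-1 * enorm (z.1 - t0) ^+ 2
    + (dotp (\sum_(0 <= k < n.+1) a k.+1 *: h k) z.2
    + 2^-1 * enorm (z.2 - mu0) ^+ 2).
  rewrite /da_objective !dotp_suml.
  under [in RHS]eq_bigr do rewrite dotpZl.
  under [X in _ = _ + (X + _)]eq_bigr do rewrite dotpZl.
  under [in LHS]eq_bigr do rewrite mulrDr.
  rewrite big_split /=; ring.
split; apply: argmin_projects => // z Kz.
  by have := xymin (z, y) (conj Kz Cy); rewrite !objE /= lerD2r.
by have := xymin (x, z) (conj Ax Kz); rewrite !objE /= lerD2l.
Qed.

Lemma penrose_trmx (R : realType) (m n : nat) (B : 'M[R]_(m, n)) X :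
  penrose B X -> penrose B^T X^T.
Proof.
move=> [X1 X2 X3 X4]; split.
- by rewrite -!trmx_mul mulmxA X1.
- by rewrite -!trmx_mul mulmxA X2.
- by rewrite -trmx_mul !X4.
- by rewrite -trmx_mul !X3.
Qed.

Section ker_proj_theory.
Variables (R : realType) (m n : nat) (B : 'M[R]_(m, n)).

(** The pseudoinverse of a symmetric matrix is symmetric: its transpose satisfies the same Penrose
    equations, which have only one solution. *)
Lemma ker_proj_sym : (ker_proj B)^T = ker_proj B.
Proof.
have [X1 X2 X3 X4] := mp_pinvP (B *m B^T).
have Xs : (mp_pinv (B *m B^T))^T = mp_pinv (B *m B^T).
  have S : (B *m B^T)^T = B *m B^T by rewrite trmx_mul trmxK.
  by apply: (penrose_uniq (B := B *m B^T)) => //; rewrite -{1}S; exact: penrose_trmx.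
by rewrite /ker_proj linearB /= trmx1 !trmx_mul trmxK Xs mulmxA.
Qed.

Lemma ker_proj_idem : ker_proj B *m ker_proj B = ker_proj B.
Proof.
have [X1 X2 X3 X4] := mp_pinvP (B *m B^T).
rewrite {2}/ker_proj mulmxBr mulmx1 {2}/ker_proj mulmxBl mul1mx.
set X := mp_pinv _ in X2 *.
have -> : B^T *m X *m B *m (B^T *m X *m B) = B^T *m (X *m (B *m B^T) *m X) *m B.
  by rewrite !mulmxA.
by rewrite X2 subrr subr0.
Qed.

(** Symmetric and idempotent means orthogonal projector. Through this bound [GM] also controls the
    integrand of [v_obj]. *)
Lemma ker_proj_contraction u :
  enorm (ker_proj B *m u) ^+ 2 <= enorm u ^+ 2.
Proof.
rewrite !enorm_sqr.
have e : dotp (ker_proj B *m u) (ker_proj B *m u) = dotp u (ker_proj B *m u).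
  by rewrite -{1}ker_proj_sym dotp_trmx_mul mulmxA ker_proj_idem.
have := dotp_ge0 (u - ker_proj B *m u).
rewrite !dotpE e (dotpC _ u); lra.
Qed.

End ker_proj_theory.

Lemma coord_le_enorm (R : realType) (n : nat) (u : 'cV[R]_n) i :
  `|u i 0| <= enorm u.
Proof.
rewrite -ler_sqr ?nnegrE ?enorm_ge0// real_normK ?num_real// enorm_sqr.
exact: coord_sqr_le_dotp.
Qed.

Lemma bounded_enorm (R : realType) (n : nat) (S : set 'cV[R]_n) (c : 'cV[R]_n) :
  bounded_set S -> exists D, forall u, S u -> enorm (u - c) <= D.
Proof.
move=> /pinfty_ex_gt0[N N0 SN].
pose K : R := \sum_i (N + `|c i 0|) ^+ 2.
exists (Num.sqrt K) => u Su; rewrite ler_sqrt; last first.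
  by apply: sumr_ge0 => i _; exact: sqr_ge0.
apply: ler_sum => i _; rewrite -expr2 -real_normK ?num_real//.
have Nc : 0 <= N + `|c i 0| by rewrite addr_ge0// ltW.
rewrite ler_sqr ?nnegrE// 2!mxE.
apply: le_trans (ler_normB _ _) _; rewrite lerD2r.
apply: le_trans (SN u Su).
have /mapP[j Hj ->] : `|u i 0| \in [seq `|u x.1 x.2| | x : 'I_n * 'I_1].
  by apply/mapP; exists (i, 0) => //=; rewrite mem_enum.
by rewrite [leRHS]/Num.norm /= mx_normrE; apply/bigmax_geP; right => /=; exists j.
Qed.

(** * Measurability and moments of the gradient estimators *)

Section gradient_measurability.
Context d (T : measurableType d) (R : realType) (s r m p : nat).
Variables (A : 'M[R]_(p, s)) (b : 'cV[R]_p).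
Variables (F : 'cV[R]_s -> 'cV[R]_r -> R) (ell : 'cV[R]_r -> 'cV[R]_m -> R).
Variables (t : T -> 'cV[R]_s) (u : T -> 'cV[R]_m) (y : T -> 'cV[R]_r).
Hypothesis mF : measurable_fun [set: borel_cV R s * borel_cV R r]
  (fun z => F z.1 z.2).
Hypothesis mell : measurable_fun [set: borel_cV R r * borel_cV R m]
  (fun z => ell z.1 z.2).
Hypothesis mt : measurable_fun setT (t : T -> borel_cV R s).
Hypothesis mu : measurable_fun setT (u : T -> borel_cV R m).
Hypothesis my : measurable_fun setT (y : T -> borel_cV R r).
Hypothesis dF : forall w, gdifferentiable (fun v => F v (y w)) (t w).
Hypothesis dell : forall w, gdifferentiable (ell (y w)) (u w).

Let mshift n (f : T -> 'cV[R]_n) c :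
  measurable_fun setT (f : T -> borel_cV R n) ->
  measurable_fun setT ((fun w => f w + c) : T -> borel_cV R n).
Proof.
move=> mf; apply: measurable_cV => i; under eq_fun do rewrite mxE.
by apply: measurable_funD => //; exact: measurable_fun_coord.
Qed.

Let mFc c : measurable_fun setT (fun w => F (t w + c) (y w)).
Proof.
apply: (@measurableT_comp _ _ _ T (borel_cV R s * borel_cV R r)%type R
  (fun z => F z.1 z.2) setT (fun w => (t w + c, y w)) mF).
by apply/measurable_fun_pairP; split => //; exact: mshift.
Qed.

Let mellc c : measurable_fun setT (fun w => ell (y w) (u w + c)).
Proof.
apply: (@measurableT_comp _ _ _ T (borel_cV R r * borel_cV R m)%type R
  (fun z => ell z.1 z.2) setT (fun w => (y w, u w + c)) mell).
by apply/measurable_fun_pairP; split => //; exact: mshift.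
Qed.

Lemma measurable_ell : measurable_fun setT (fun w => ell (y w) (u w)).
Proof. by have := mellc 0; under eq_fun do rewrite addr0. Qed.

Lemma measurable_G_fun i :
  measurable_fun setT (fun w => G_fun F (t w) (y w) i 0).
Proof.
apply: (measurable_grad (f := fun w v => F v (y w))) => //.
by have := mFc 0; under eq_fun do rewrite addr0.
Qed.

Lemma measurable_Gmu_fun i :
  measurable_fun setT (fun w => Gmu_fun F ell (u w) (t w) (y w) i 0).
Proof.
rewrite /Gmu_fun; under eq_fun do rewrite mxE.
by apply: measurable_funM; [exact: measurable_ell|exact: measurable_G_fun].
Qed.

Lemma measurable_PG_fun_sqr :
  measurable_fun setT (fun w => enorm (PG_fun A b F (t w) (y w)) ^+ 2).
Proof.
under eq_fun do rewrite enorm_sqr /dotp.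
have mi i : measurable_fun setT (fun w => PG_fun A b F (t w) (y w) i 0).
  rewrite /PG_fun; under eq_fun do rewrite mxE.
  apply: measurable_sum => j; apply: measurable_funM; last exact: measurable_G_fun.
  exact: (measurable_active A b (fun S => ker_proj (subrows S A) i j) mt).
by apply: measurable_sum => i; exact: measurable_funM.
Qed.

Lemma measurable_grad_ell i :
  measurable_fun setT (fun w => grad (ell (y w)) (u w) i 0).
Proof.
apply: (measurable_grad (f := fun w => ell (y w))) => //.
exact: measurable_ell.
Qed.

Lemma measurable_H_fun i :
  measurable_fun setT (fun w => H_fun A b F ell (t w) (u w) (y w) i 0).
Proof.
rewrite /H_fun; under eq_fun do rewrite mxE.
apply: measurable_funM; first exact: measurable_PG_fun_sqr.
exact: measurable_grad_ell.
Qed.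

End gradient_measurability.

Section gradient_moments.
Context (R : realType) (s r m p q : nat).
Variables (A : 'M[R]_(p, s)) (b : 'cV[R]_p) (C : 'M[R]_(q, m)) (d : 'cV[R]_q).
Variables (P : probability (borel_cV R r) R)
  (Pmu : 'cV[R]_m -> probability (borel_cV R r) R).
Variables (F : 'cV[R]_s -> 'cV[R]_r -> R) (ell : 'cV[R]_r -> 'cV[R]_m -> R).
Variables (GM HM : R).
Let Theta := polyhedron A b.
Let M := polyhedron C d.
Let G := G_fun F.
Hypothesis mF : measurable_fun [set: borel_cV R s * borel_cV R r]
  (fun z => F z.1 z.2).
Hypothesis mell : measurable_fun [set: borel_cV R r * borel_cV R m]
  (fun z => ell z.1 z.2).
Hypothesis dF : forall t x, Theta t -> gdifferentiable (fun u => F u x) t.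
Hypothesis dell : forall x u, M u -> gdifferentiable (ell x) u.
Hypothesis iG : forall t i, Theta t ->
  P.-integrable setT (fun x => (G t x i 0)%:E).
Hypothesis PPmu : forall u, M u -> P `<< Pmu u.
Hypothesis ellE : forall u, M u -> ae_eq (Pmu u) setT
  (fun x => (ell x u)%:E)
  (Radon_Nikodym (charge_of_finite_measure P) (Pmu u)).
Hypothesis ellc : forall x, log_convex_on M (ell x).
Hypothesis GMP : forall t u, Theta t -> M u ->
  (\int[P]_x (enorm (G t x) ^+ 2 * ell x u)%:E <= (GM ^+ 2)%:E)%E.
Hypothesis HMP : forall t u, Theta t -> M u ->
  (\int[P]_x (enorm (PG_fun A b F t x) ^+ 4
     * enorm (grad (ell x) u) ^+ 2)%:E <= (HM ^+ 2)%:E)%E.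

Variables (t : 'cV[R]_s) (u : 'cV[R]_m).
Hypothesis (Kt : Theta t) (Mu : M u).

Let mcst n (v : 'cV[R]_n) :
  measurable_fun setT ((fun=> v) : borel_cV R r -> borel_cV R n).
Proof. exact: measurable_cst. Qed.

Let mid : measurable_fun setT (id : borel_cV R r -> borel_cV R r).
Proof. exact: measurable_id. Qed.

Let mellu u' : measurable_fun setT ((fun x => ell x u') : borel_cV R r -> R).
Proof. exact: (measurable_ell mell (mcst u') mid). Qed.

Let mG i : measurable_fun setT ((fun x => G t x i 0) : borel_cV R r -> R).
Proof. exact: (measurable_G_fun mF (mcst t) mid (fun x => dF x Kt)). Qed.

Let mG2 : measurable_fun setT ((fun x => enorm (G t x) ^+ 2) : borel_cV R r -> R).
Proof.
under eq_fun do rewrite enorm_sqr /dotp.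
by apply: measurable_sum => i; exact: measurable_funM.
Qed.

Let mPG2 : measurable_fun setT
  ((fun x => enorm (PG_fun A b F t x) ^+ 2) : borel_cV R r -> R).
Proof. exact: (measurable_PG_fun_sqr A b mF (mcst t) mid (fun x => dF x Kt)). Qed.

Let mge i : measurable_fun setT ((fun x => grad (ell x) u i 0) : borel_cV R r -> R).
Proof. exact: (measurable_grad_ell mell (mcst u) mid (fun x => dell x Mu)). Qed.

Let ell0 x u' : M u' -> 0 <= ell x u'.
Proof. by move=> Mu'; have [+ _] := ellc x; apply. Qed.

Let iG2 u' : M u' -> P.-integrable setT (fun x => (enorm (G t x) ^+ 2 * ell x u')%:E).
Proof.
move=> Mu'; apply: ge0_integrable.
- exact: measurable_funM.
- by move=> x; rewrite mulr_ge0 ?sqr_ge0 ?ell0.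
- by apply: le_lt_trans (GMP Kt Mu') _; rewrite ltry.
Qed.

(** One factor [ell x u] of the square is absorbed by the change of measure from [Pmu u] to [P]; the
    other remains as the weight in the bound by [GM]. *)
Lemma Gmu_second_moment i :
  (\int[Pmu u]_x (Gmu_fun F ell u t x i 0 ^+ 2)%:E <= (GM ^+ 2)%:E)%E.
Proof.
have le2 x : ell x u * G t x i 0 ^+ 2 <= enorm (G t x) ^+ 2 * ell x u.
  by rewrite mulrC ler_wpM2r ?ell0// enorm_sqr coord_sqr_le_dotp.
have m2 : measurable_fun setT
    ((fun x => ell x u * G t x i 0 ^+ 2) : borel_cV R r -> R).
  by apply: measurable_funM => //; exact: measurable_funX.
have i2 : P.-integrable setT (fun x => (ell x u * G t x i 0 ^+ 2)%:E).
  apply: (le_integrable measurableT _ _ (iG2 Mu)); first exact/measurable_EFinP.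
  move=> x _; rewrite !abse_EFin lee_fin !ger0_norm ?le2//.
    by rewrite mulr_ge0 ?sqr_ge0 ?ell0.
  by rewrite mulr_ge0 ?sqr_ge0 ?ell0.
under eq_integral => x _.
  rewrite mxE (_ : _ ^+ 2 = ell x u * G t x i 0 ^+ 2 * ell x u); last first.
    by rewrite /G; ring.
  over.
rewrite (integral_likelihood_ratio (PPmu Mu) (ellE Mu))//.
apply: le_trans (GMP Kt Mu); apply: ge0_le_integral => //.
- by move=> x _; rewrite lee_fin mulr_ge0 ?sqr_ge0 ?ell0.
- exact/measurable_EFinP.
- by apply/measurable_EFinP; exact: measurable_funM.
- by move=> x _; rewrite lee_fin.
Qed.

Lemma Gmu_mean i :
  fine (\int[Pmu u]_x (Gmu_fun F ell u t x i 0)%:E)%E = \int[P]_x (G t x i 0).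
Proof.
have e x : Gmu_fun F ell u t x i 0 = G t x i 0 * ell x u.
  by rewrite mxE mulrC.
rewrite /Rintegral; congr fine.
transitivity (\int[Pmu u]_x (G t x i 0 * ell x u)%:E)%E.
  by apply: eq_integral => x _; rewrite e.
by rewrite (integral_likelihood_ratio (PPmu Mu) (ellE Mu))//; exact: iG.
Qed.

Let mHi i : measurable_fun setT
  ((fun x => H_fun A b F ell t u x i 0) : borel_cV R r -> R).
Proof.
exact: (measurable_H_fun A b mF mell (mcst t) (mcst u) mid (fun x => dF x Kt)
  (fun x => dell x Mu)).
Qed.

Lemma H_second_moment i :
  (\int[P]_x (H_fun A b F ell t u x i 0 ^+ 2)%:E <= (HM ^+ 2)%:E)%E.
Proof.
apply: le_trans (HMP Kt Mu); apply: ge0_le_integral => //.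
- by move=> x _; rewrite lee_fin sqr_ge0.
- by apply/measurable_EFinP; exact: measurable_funX.
- apply/measurable_EFinP; apply: measurable_funM.
    under eq_fun do rewrite (exprM _ 2 2).
    exact: measurable_funX.
  under eq_fun do rewrite enorm_sqr /dotp.
  by apply: measurable_sum => j; exact: measurable_funM.
- move=> x _; rewrite lee_fin mxE exprMn -exprM ler_wpM2l ?exprn_ge0 ?enorm_ge0//.
  by rewrite enorm_sqr coord_sqr_le_dotp.
Qed.

Let irho u' : M u' -> P.-integrable setT
  (fun x => (enorm (PG_fun A b F t x) ^+ 2 * ell x u')%:E).
Proof.
move=> Mu'; apply: (le_integrable measurableT _ _ (iG2 Mu')).
  by apply/measurable_EFinP; exact: measurable_funM.
move=> x _; have l0 := ell0 x Mu'.
rewrite !abse_EFin lee_fin !ger0_norm ?(mulr_ge0 _ l0) ?sqr_ge0//.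
by rewrite ler_wpM2r// ker_proj_contraction.
Qed.

Hypothesis dv : gdifferentiable (v_obj A b P F ell t) u.

(** Log-convexity makes [ell x] convex along feasible segments, while [GMP] and [HMP] make the
    weighted likelihood ratio and its gradient integrable, so differentiation under the integral
    applies. The first conclusion stands for unbiasedness of [H_fun], the second for convexity of
    [v_obj] in its last argument. *)
Lemma H_mean a : M a ->
  dotp (\col_i \int[P]_x (H_fun A b F ell t u x i 0)) (a - u) =
    dotp (grad (v_obj A b P F ell t) u) (a - u) /\
  dotp (grad (v_obj A b P F ell t) u) (a - u) <=
    v_obj A b P F ell t a - v_obj A b P F ell t u.
Proof.
move=> Ma.
have Mpt tau : 0 <= tau <= 1 -> M (u + tau *: (a - u)).
  exact: polyhedron_segment.
have rho0 x : 0 <= enorm (PG_fun A b F t x) ^+ 2 by exact: sqr_ge0.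
have conv x (z tau : R) : 0 < z <= 1 -> 0 < tau <= 1 ->
    ell x (u + (z * tau) *: (a - u)) <=
    ell x u + z * (ell x (u + tau *: (a - u)) - ell x u).
  move=> /andP[z0 z1] /andP[tau0 tau1].
  move: z1; rewrite le_eqVlt => /predU1P[->|z1].
    by rewrite !mul1r (addrC (ell x u)) subrK.
  have Mtau : M (u + tau *: (a - u)) by apply: Mpt; rewrite (ltW tau0).
  have := log_convex_on_convex (tau := z) (ellc x) _ Mtau Mu.
  rewrite z0 z1 => /(_ isT); set v1 := _ + (1 - z) *: u => h.
  have -> : u + (z * tau) *: (a - u) = v1.
    by apply/colP => i; rewrite /v1 !mxE; ring.
  by lra.
have iH i : P.-integrable setT
    (fun x => (enorm (PG_fun A b F t x) ^+ 2 * grad (ell x) u i 0)%:E).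
  have := sqr_bound_integrable (@mHi i) (H_second_moment i).
  by apply: eq_integrable => // x _; rewrite mxE.
have il tau : 0 <= tau <= 1 -> P.-integrable setT
    (fun x => (enorm (PG_fun A b F t x) ^+ 2 * ell x (u + tau *: (a - u)))%:E).
  by move=> /Mpt; exact: irho.
have dl x : gdifferentiable (ell x) u by exact: dell.
pose rho (x : borel_cV R r) := enorm (PG_fun A b F t x) ^+ 2.
have := @dotp_integral_grad_le _ (borel_cV R r) R P m rho ell u a
  rho0 dl conv il iH dv.
have := @dotp_integral_grad _ (borel_cV R r) R P m rho ell u a
  rho0 dl conv il iH dv.
move=> <- le; split => //.
congr dotp; apply/colP => i; rewrite !mxE; apply: eq_Rintegral => x _.
by rewrite mxE.
Qed.

End gradient_moments.

(** * The stochastic algorithm *)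

Section history_theory.
Context d (T : measurableType d) d' (E : measurableType d').
Variables Y X : nat -> T -> E.

Lemma history_sub_measurable n :
  (forall k, measurable_fun setT (Y k.+1)) ->
  (forall k, measurable_fun setT (X k.+1)) ->
  history Y X n `<=` measurable.
Proof.
move=> mY mX; apply: smallest_sub; first exact: sigma_algebra_measurable.
move=> S [k [B [/andP[k1 _] mB kB]]].
case: k k1 kB => // k _ [->|->]; rewrite -[X in measurable X]setTI.
  exact: (mY k) measurableT _ mB.
exact: (mX k) measurableT _ mB.
Qed.

Lemma history_subS n : history Y X n `<=` history Y X n.+1.
Proof.
apply: sub_sigma_algebra2 => S [k [B [/andP[k1 kn] mB kB]]].
by exists k, B; split => //; rewrite k1 leqW.
Qed.

Lemma measurable_history_fst k :
  measurable_fun setT (Y k.+1 : g_sigma_algebraType (history Y X k.+1) -> E).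
Proof.
move=> _ B mB; rewrite setTI; apply: sub_sigma_algebra.
(* The history is already a sigma-algebra and [g_sigma_algebraType] generates from it once more,
   hence two inclusions. *)
by apply: sub_sigma_algebra; exists k.+1, B; split; rewrite ?ltnS ?leqnn//; left.
Qed.

Lemma measurable_history_snd k :
  measurable_fun setT (X k.+1 : g_sigma_algebraType (history Y X k.+1) -> E).
Proof.
move=> _ B mB; rewrite setTI; apply: sub_sigma_algebra.
by apply: sub_sigma_algebra; exists k.+1, B; split; rewrite ?ltnS ?leqnn//; right.
Qed.

End history_theory.

Section joint_dual_averaging.
Context (R : realType) (s r m p q : nat).
Variables (A : 'M[R]_(p, s)) (b : 'cV[R]_p) (C : 'M[R]_(q, m)) (d : 'cV[R]_q).
Variables (P : probability (borel_cV R r) R)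
  (Pmu : 'cV[R]_m -> probability (borel_cV R r) R).
Variables (F : 'cV[R]_s -> 'cV[R]_r -> R) (ell : 'cV[R]_r -> 'cV[R]_m -> R).
Variables (alpha gamma : R).
Context disp (Omega : measurableType disp) (Q : probability Omega R).
Variables (Y X : nat -> Omega -> borel_cV R r)
  (theta : nat -> Omega -> 'cV[R]_s) (mu : nat -> Omega -> 'cV[R]_m)
  (theta0 : 'cV[R]_s) (mu0 : 'cV[R]_m).
Variables (GM HM : R).
Let Theta := polyhedron A b.
Let M := polyhedron C d.
Let G := G_fun F.
Hypothesis mF : measurable_fun [set: borel_cV R s * borel_cV R r]
  (fun z => F z.1 z.2).
Hypothesis mell : measurable_fun [set: borel_cV R r * borel_cV R m]
  (fun z => ell z.1 z.2).
Hypothesis dF : forall t x, Theta t -> gdifferentiable (fun u => F u x) t.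
Hypothesis dell : forall x u, M u -> gdifferentiable (ell x) u.
Hypothesis iG : forall t i, Theta t ->
  P.-integrable setT (fun x => (G t x i 0)%:E).
Hypothesis PPmu : forall u, M u -> P `<< Pmu u.
Hypothesis ellE : forall u, M u -> ae_eq (Pmu u) setT
  (fun x => (ell x u)%:E)
  (Radon_Nikodym (charge_of_finite_measure P) (Pmu u)).
Hypothesis ellc : forall x, log_convex_on M (ell x).
Hypothesis GMP : forall t u, Theta t -> M u ->
  (\int[P]_x (enorm (G t x) ^+ 2 * ell x u)%:E <= (GM ^+ 2)%:E)%E.
Hypothesis HMP : forall t u, Theta t -> M u ->
  (\int[P]_x (enorm (PG_fun A b F t x) ^+ 4
     * enorm (grad (ell x) u) ^+ 2)%:E <= (HM ^+ 2)%:E)%E.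
Hypothesis alpha0 : 0 < alpha.
Hypothesis gammaP : 2^-1 < gamma < 1.
Hypothesis Ktheta0 : Theta theta0.
Hypothesis Mmu0 : M mu0.
Hypothesis theta_0 : forall w, theta 0%N w = theta0.
Hypothesis mu_0 : forall w, mu 0%N w = mu0.
Hypothesis mY : forall k, measurable_fun setT (Y k.+1).
Hypothesis mX : forall k, measurable_fun setT (X k.+1).
Hypothesis thetamuE : forall n w,
  argmin (Theta `*` M)
    (da_objective (step alpha gamma) theta0 mu0
       (fun k => Gmu_fun F ell (mu k w) (theta k w) (Y k.+1 w))
       (fun k => H_fun A b F ell (theta k w) (mu k w) (X k.+1 w)) n)
  = [set (theta n.+1 w, mu n.+1 w)].
Hypothesis condE : forall n (B1 B2 : set (borel_cV R r)),
  measurable B1 -> measurable B2 ->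
  cond_prob_version Q (history Y X n)
    (Y n.+1 @^-1` B1 `&` X n.+1 @^-1` B2)
    (fun w => Pmu (mu n w) B1 * P B2)%E.
Hypothesis Theta_bounded : bounded_set Theta.
Hypothesis M_bounded : bounded_set M.

Let a k := step alpha gamma k.+1.

Definition theta_grad k w := Gmu_fun F ell (mu k w) (theta k w) (Y k.+1 w).

Definition mu_grad k w := H_fun A b F ell (theta k w) (mu k w) (X k.+1 w).

Definition theta_dual n w := theta0 - \sum_(0 <= k < n) a k *: theta_grad k w.

Definition mu_dual n w := mu0 - \sum_(0 <= k < n) a k *: mu_grad k w.

Let projects_self n' p' (A' : 'M[R]_(p', n')) b' x :
  polyhedron A' b' x -> projects A' b' x x.
Proof. by move=> Kx; split => // y _; rewrite subrr dotp0l. Qed.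

Lemma theta_mu_projects n w :
  projects A b (theta_dual n w) (theta n w) /\
  projects C d (mu_dual n w) (mu n w).
Proof.
case: n => [|n]; last exact: da_objective_projects (thetamuE n w).
rewrite /theta_dual /mu_dual !big_geq// !subr0 theta_0 mu_0.
by split; exact: projects_self.
Qed.

Lemma theta_feasible n w : Theta (theta n w).
Proof. by have [[]] := theta_mu_projects n w. Qed.

Lemma mu_feasible n w : M (mu n w).
Proof. by have [_ []] := theta_mu_projects n w. Qed.

Lemma theta_dualS n w :
  theta_dual n.+1 w = theta_dual n w - a n *: theta_grad n w.
Proof. by rewrite /theta_dual big_nat_recr//= opprD addrA. Qed.

Lemma theta_dual_coordS n w i :
  theta_dual n.+1 w i 0 = theta_dual n w i 0 - a n * theta_grad n w i 0.
Proof. by rewrite theta_dualS mxE [X in _ + X]mxE [X in - X]mxE. Qed.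

Lemma mu_dualS n w : mu_dual n.+1 w = mu_dual n w - a n *: mu_grad n w.
Proof. by rewrite /mu_dual big_nat_recr//= opprD addrA. Qed.

Lemma mu_dual_coordS n w i :
  mu_dual n.+1 w i 0 = mu_dual n w i 0 - a n * mu_grad n w i 0.
Proof. by rewrite mu_dualS mxE [X in _ + X]mxE [X in - X]mxE. Qed.

Let H n := history Y X n.
Let sigF n := g_sigma_algebraType (H n).

Let HT n : H n `<=` measurable.
Proof. exact: history_sub_measurable. Qed.

Let HS n : H n `<=` H n.+1.
Proof. exact: history_subS. Qed.

(** The induction runs through the dual iterates: gradient [n] uses the draws of index [n.+1], which
    belong to the history at [n.+1], and the primal iterates follow as projections of the duals. *)
Lemma theta_mu_adapted n :
  [/\ measurable_fun setT (theta n : sigF n -> borel_cV R s),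
      measurable_fun setT (mu n : sigF n -> borel_cV R m),
      measurable_fun setT (theta_dual n : sigF n -> borel_cV R s) &
      measurable_fun setT (mu_dual n : sigF n -> borel_cV R m)].
Proof.
elim: n => [|n [mt mm mzt mzm]].
  have -> : theta 0 = cst theta0 by apply/funext.
  have -> : mu 0 = cst mu0 by apply/funext.
  have -> : theta_dual 0 = cst theta0.
    by apply/funext => w; rewrite /theta_dual big_geq// subr0.
  have -> : mu_dual 0 = cst mu0.
    by apply/funext => w; rewrite /mu_dual big_geq// subr0.
  by split; exact: measurable_cst.
have up d' (E : measurableType d') (f : Omega -> E) :
    measurable_fun setT (f : sigF n -> E) -> measurable_fun setT (f : sigF n.+1 -> E).
  exact: (measurable_fun_history_le HS (leqnSn n)).
have mt' := up _ (borel_cV R s) _ mt.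
have mm' := up _ (borel_cV R m) _ mm.
have mzt' : measurable_fun setT (theta_dual n.+1 : sigF n.+1 -> borel_cV R s).
  apply: measurable_cV => i.
  under eq_fun do rewrite theta_dual_coordS.
  apply: measurable_funB.
    exact: (measurable_fun_coord i (up _ (borel_cV R s) _ mzt)).
  apply: measurable_funM => //.
  apply: (measurable_Gmu_fun mF mell mt' mm' (@measurable_history_fst _ _ _ _ Y X n)).
  by move=> w; apply: dF; exact: theta_feasible.
have mzm' : measurable_fun setT (mu_dual n.+1 : sigF n.+1 -> borel_cV R m).
  apply: measurable_cV => i.
  under eq_fun do rewrite mu_dual_coordS.
  apply: measurable_funB.
    exact: (measurable_fun_coord i (up _ (borel_cV R m) _ mzm)).
  apply: measurable_funM => //.
  apply: (measurable_H_fun A b mF mell mt' mm' (@measurable_history_snd _ _ _ _ Y X n)).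
  - by move=> w; apply: dF; exact: theta_feasible.
  - by move=> w; apply: dell; exact: mu_feasible.
have mt1 : measurable_fun setT (theta n.+1 : sigF n.+1 -> borel_cV R s).
  apply: (@measurable_projects _ (sigF n.+1) R _ _ A b (theta_dual n.+1)) => //.
  by move=> w; have [] := theta_mu_projects n.+1 w.
have mm1 : measurable_fun setT (mu n.+1 : sigF n.+1 -> borel_cV R m).
  apply: (@measurable_projects _ (sigF n.+1) R _ _ C d (mu_dual n.+1)) => //.
  by move=> w; have [] := theta_mu_projects n.+1 w.
exact: And4 mt1 mm1 mzt' mzm'.
Qed.

Let PmuY k w : probability (borel_cV R r) R := Pmu (mu k w).

Let PX (k : nat) (w : Omega) : probability (borel_cV R r) R := P.

Let sigH k (S : set Omega) : <<s H k >> S -> H k S.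
Proof. by rewrite sigma_algebra_id//; exact: smallest_sigma_algebra. Qed.

Let mPmuY k B : measurable B ->
  measurable_fun setT ((PmuY k ^~ B) : sigF k -> \bar R).
Proof.
move=> mB; have [+ _] := condE k mB measurableT.
by under eq_fun do rewrite probability_setT mule1.
Qed.

Let mPX k B : measurable B -> measurable_fun setT ((PX k ^~ B) : sigF k -> \bar R).
Proof. by move=> mB; exact: measurable_cst. Qed.

Let PmuYE k S B : <<s H k >> S -> measurable B ->
  (Q (S `&` Y k.+1 @^-1` B) = \int[Q]_(w in S) PmuY k w B)%E.
Proof.
move=> /sigH HS' mB; have [_ /(_ _ HS')] := condE k mB measurableT.
rewrite preimage_setT setIT => ->; apply: eq_integral => w _.
by rewrite probability_setT mule1.
Qed.

Let PXE k S B : <<s H k >> S -> measurable B ->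
  (Q (S `&` X k.+1 @^-1` B) = \int[Q]_(w in S) PX k w B)%E.
Proof.
move=> /sigH HS' mB; have [_ /(_ _ HS')] := condE k measurableT mB.
rewrite preimage_setT setTI => ->; apply: eq_integral => w _.
by rewrite probability_setT mul1e.
Qed.

Let E := borel_cV R r.

Let mfst_comp k n (f : Omega -> 'cV[R]_n) :
  measurable_fun setT (f : sigF k -> borel_cV R n) ->
  measurable_fun setT ((fun z => f z.1) : sigF k * E -> borel_cV R n).
Proof.
move=> mf; apply: (@measurableT_comp _ _ _ (sigF k * E)%type (sigF k)
  (borel_cV R n) f setT fst mf).
exact: measurable_fst.
Qed.

Let msnd k : measurable_fun setT (snd : sigF k * E -> E).
Proof. exact: measurable_snd. Qed.

Let phiY i k w y := Gmu_fun F ell (mu k w) (theta k w) y i 0.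

Let phiX i k w x := H_fun A b F ell (theta k w) (mu k w) x i 0.

Let mphiY i k :
  measurable_fun setT ((fun z => phiY i k z.1 z.2) : sigF k * E -> R).
Proof.
have [mt mm _ _] := theta_mu_adapted k.
apply: (measurable_Gmu_fun mF mell (mfst_comp mt) (mfst_comp mm) (@msnd k)).
by move=> z; apply: dF; exact: theta_feasible.
Qed.

Let mphiX i k :
  measurable_fun setT ((fun z => phiX i k z.1 z.2) : sigF k * E -> R).
Proof.
have [mt mm _ _] := theta_mu_adapted k.
apply: (measurable_H_fun A b mF mell (mfst_comp mt) (mfst_comp mm) (@msnd k)).
- by move=> z; apply: dF; exact: theta_feasible.
- by move=> z; apply: dell; exact: mu_feasible.
Qed.

Let phiY2 i k w : (\int[PmuY k w]_y (phiY i k w y ^+ 2)%:E <= (GM ^+ 2)%:E)%E.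
Proof.
exact: (Gmu_second_moment mF mell dF PPmu ellE ellc GMP
  (theta_feasible k w) (mu_feasible k w)).
Qed.

Let phiX2 i k w : (\int[PX k w]_x (phiX i k w x ^+ 2)%:E <= (HM ^+ 2)%:E)%E.
Proof.
exact: (H_second_moment mF mell dF dell HMP
  (theta_feasible k w) (mu_feasible k w)).
Qed.

Let acvg : cvgn (series (fun k => a k ^+ 2)).
Proof. exact: step_sqr_cvg. Qed.

Let mY' k : measurable_fun setT (Y k.+1 : sigF k.+1 -> E).
Proof. exact: measurable_history_fst. Qed.

Let mX' k : measurable_fun setT (X k.+1 : sigF k.+1 -> E).
Proof. exact: measurable_history_snd. Qed.

Definition theta_noise k w := theta_grad k w - \col_i \int[P]_x (G (theta k w) x i 0).

(** The noise of [mu] is centred at the mean of [H_fun] itself, since this mean is tied to the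
    gradient of [v_obj] only along differences of feasible points. *)
Definition mu_mean k w : 'cV[R]_m :=
  \col_i \int[P]_x (H_fun A b F ell (theta k w) (mu k w) x i 0).

Definition mu_noise k w := mu_grad k w - mu_mean k w.

Lemma theta_noise_cvg i (c : nat -> Omega -> R) (K : R) :
  (forall k, measurable_fun setT (c k : sigF k -> R)) ->
  (forall k w, `|c k w| <= K) ->
  {ae Q, forall w,
    cvgn (series (fun k => a k * (c k w * theta_noise k w i 0)) : nat -> R^o)}.
Proof.
move=> mc cK.
have := noise_series_multiplier_cvg HT HS mY' mPmuY PmuYE (@mphiY i) (phiY2 i)
  acvg mc cK.
apply: filterS => w.
have -> : (fun k => a k * (c k w * (phiY i k w (Y k.+1 w) -
      noise_mean PmuY (phiY i) k w))) =
    (fun k => a k * (c k w * theta_noise k w i 0)).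
  apply/funext => k; rewrite /theta_noise mxE [X in _ = _ * (_ * (_ + X))]mxE.
  rewrite [X in _ = _ * (_ * (_ - X))]mxE.
  congr (_ * (_ * (_ - _))).
  exact: (Gmu_mean mell iG PPmu ellE (theta_feasible k w) (mu_feasible k w)).
exact.
Qed.

Lemma mu_noise_cvg i (c : nat -> Omega -> R) (K : R) :
  (forall k, measurable_fun setT (c k : sigF k -> R)) ->
  (forall k w, `|c k w| <= K) ->
  {ae Q, forall w,
    cvgn (series (fun k => a k * (c k w * mu_noise k w i 0)) : nat -> R^o)}.
Proof.
move=> mc cK.
have := noise_series_multiplier_cvg HT HS mX' mPX PXE (@mphiX i) (phiX2 i)
  acvg mc cK.
apply: filterS => w.
have -> : (fun k => a k * (c k w * (phiX i k w (X k.+1 w) -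
      noise_mean PX (phiX i) k w))) =
    (fun k => a k * (c k w * mu_noise k w i 0)).
  apply/funext => k; rewrite /mu_noise mxE [X in _ = _ * (_ * (_ + X))]mxE.
  by rewrite [X in _ = _ * (_ * (_ - X))]mxE.
exact.
Qed.

Lemma theta_grad_sqr_cvg i : {ae Q, forall w,
  cvgn (series (fun k => (a k * theta_grad k w i 0) ^+ 2) : nat -> R^o)}.
Proof. exact: (noise_series_sqr_cvg HT HS mY' mPmuY PmuYE (@mphiY i) (phiY2 i) acvg). Qed.

Lemma mu_grad_sqr_cvg i : {ae Q, forall w,
  cvgn (series (fun k => (a k * mu_grad k w i 0) ^+ 2) : nat -> R^o)}.
Proof. exact: (noise_series_sqr_cvg HT HS mX' mPX PXE (@mphiX i) (phiX2 i) acvg). Qed.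

End joint_dual_averaging.

(** * The argument along a fixed path *)

Lemma cvgn_series_sum (R : realType) (I : finType) (f : I -> nat -> R) :
  (forall i, cvgn (series (f i) : nat -> R^o)) ->
  cvgn (series (fun k => \sum_i f i k) : nat -> R^o).
Proof.
move=> fc; have -> : series (fun k => \sum_i f i k) =
    (fun n => \sum_i series (f i) n).
  by apply/funext => n; rewrite /series /= exchange_big.
apply/cvg_ex; exists (\sum_i limn (series (f i) : nat -> R^o)).
exact: (cvg_sumr _ fc).
Qed.

Section noisy_dual_averaging.
Variables (R : realType) (p n : nat) (A : 'M[R]_(p, n)) (b : 'cV[R]_p).
Variables (xs : 'cV[R]_n) (x z g xi : nat -> 'cV[R]_n) (a : nat -> R).
Hypothesis Kxs : polyhedron A b xs.
Hypothesis a0 : forall k, 0 < a k.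
Hypothesis ainfty : series a k @[k --> \oo] --> +oo.
Hypothesis zS : forall k, z k.+1 = z k - a k *: g k.
Hypothesis xproj : forall k, projects A b (z k) (x k).

(** [g - xi] is the mean gradient and [eps] an allowance for its bias. Both [eps] and [n0] serve
    [mu], whose drift is controlled only once [theta] has the right active set. *)
Lemma noisy_dual_averaging_cvg (c : R) (eps : nat -> R) (n0 : nat) :
  0 < c ->
  (forall i, cvgn (series (fun k => a k * ((x k - xs) i 0 * xi k i 0)) : nat -> R^o)) ->
  (forall i, cvgn (series (fun k => (a k * g k i 0) ^+ 2) : nat -> R^o)) ->
  cvgn (series (fun k => a k * eps k) : nat -> R^o) ->
  (forall k, (n0 <= k)%N -> c * dotp (x k - xs) (x k - xs) - eps k <=
     dotp (g k - xi k) (x k - xs)) ->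
  dotp (x k - xs) (x k - xs) @[k --> \oo] --> (0 : R) /\
  cvgn (series (fun k => a k * dotp (x k - xs) (x k - xs)) : nat -> R^o).
Proof.
move=> c0 xic g2c epsc drift.
pose e k := \sum_i (a k * ((x k - xs) i 0 * xi k i 0)) - a k * eps k.
have ec : cvgn (series e : nat -> R^o).
  have -> : series e = series (fun k => \sum_i (a k * ((x k - xs) i 0 * xi k i 0)))
      - series (fun k => a k * eps k).
    by apply/funext => k; rewrite !fctE /series /= -sumrB.
  by apply: is_cvgB => //; exact: cvgn_series_sum.
have gc : cvgn (series (fun k => a k ^+ 2 * dotp (g k) (g k)) : nat -> R^o).
  have -> : (fun k => a k ^+ 2 * dotp (g k) (g k)) =
      (fun k => \sum_i (a k * g k i 0) ^+ 2).
    apply/funext => k; rewrite /dotp mulr_sumr; apply: eq_bigr => i _; ring.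
  exact: cvgn_series_sum.
have descent k : (n0 <= k)%N ->
    c * (a k * dotp (x k - xs) (x k - xs)) + e k <= a k * dotp (g k) (x k - xs).
  move=> /drift h; have eE : e k = a k * (dotp (xi k) (x k - xs) - eps k).
    rewrite /e -mulr_sumr mulrBr /dotp; congr (_ * _ - _).
    by apply: eq_bigr => i _; rewrite mulrC.
  rewrite eE mulrCA -mulrDr ler_pM2l//; move: h.
  by rewrite (dotpDl (g k)) (dotpNl (xi k)); lra.
split; first exact: (dist_cvg0 Kxs xproj zS a0 ainfty ec gc c0 descent).
exact: (dist_series_cvg Kxs xproj zS a0 ec gc c0 descent).
Qed.

Lemma noisy_dual_averaging_identification (gam : 'cV[R]_n)
    (lambda : 'cV[R]_(#|active A b xs|)) :
  dotp (x k - xs) (x k - xs) @[k --> \oo] --> (0 : R) ->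
  (forall i, cvgn (series (fun k => a k * xi k i 0) : nat -> R^o)) ->
  (forall i, (g k i 0 - xi k i 0) @[k --> \oo] --> gam i 0) ->
  vlt 0 lambda -> - gam = (act_mx A b xs)^T *m lambda ->
  \forall k \near \oo, same_active A b xs (x k).
Proof.
move=> xcvg xic gcvg lambda0 gamE.
apply: (eventually_same_active Kxs xproj xcvg (invr_series_cvg0 ainfty) lambda0).
move=> i; rewrite -gamE mxE.
apply: (dual_average_cvg a0 ainfty (g := fun k => g k i 0) (xi := fun k => xi k i 0)) => //.
by move=> k; rewrite zS mxE [X in _ + X]mxE [X in - X]mxE.
Qed.

End noisy_dual_averaging.

Lemma enorm_cvg_coord (R : realType) (n : nat) (u : nat -> 'cV[R]_n) l
    (e : nat -> R) i :
  (\forall k \near \oo, enorm (u k - l) <= e k) -> e k @[k --> \oo] --> (0 : R) ->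
  u k i 0 @[k --> \oo] --> l i 0.
Proof.
move=> ue e0; apply/subr_cvg0/norm_cvg0P.
apply: (squeeze_cvgr (f := fun=> 0) (h := e)) => //; last exact: cvg_cst.
apply: filterS ue => k; rewrite normr_ge0/=; apply: le_trans.
by have := coord_le_enorm (u k - l) i; rewrite !mxE.
Qed.

Lemma enorm_cvg0 (R : realType) (n : nat) (u : nat -> 'cV[R]_n) :
  dotp (u k) (u k) @[k --> \oo] --> (0 : R) -> enorm (u k) @[k --> \oo] --> (0 : R).
Proof.
move=> u0; have -> : (0 : R) = Num.sqrt 0 by rewrite sqrtr0.
rewrite /enorm; apply: continuous_cvg => //; exact: sqrt_continuous.
Qed.

Section pathwise.
Variables (R : realType) (p q s m : nat).
Variables (A : 'M[R]_(p, s)) (b : 'cV[R]_p) (C : 'M[R]_(q, m)) (d : 'cV[R]_q).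
Variables (f : 'cV[R]_s -> R) (v : 'cV[R]_s -> 'cV[R]_m -> R).
Variables (tstar : 'cV[R]_s) (mstar : 'cV[R]_m) (c1 c2 c3 D : R).
Variables (a : nat -> R) (th zt gt : nat -> 'cV[R]_s) (u zm gm hm : nat -> 'cV[R]_m).
Let Theta := polyhedron A b.
Let M := polyhedron C d.
Hypothesis Kt : Theta tstar.
Hypothesis Km : M mstar.
Hypothesis a0 : forall k, 0 < a k.
Hypothesis ainfty : series a k @[k --> \oo] --> +oo.
Hypothesis ztS : forall k, zt k.+1 = zt k - a k *: gt k.
Hypothesis zmS : forall k, zm k.+1 = zm k - a k *: gm k.
Hypothesis tproj : forall k, projects A b (zt k) (th k).
Hypothesis mproj : forall k, projects C d (zm k) (u k).
Hypothesis f_first_order : forall t, Theta t ->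
  dotp (grad f t) (tstar - t) <= f tstar - f t.
Hypothesis v_first_order : forall w, M w ->
  dotp (grad (v tstar) w) (mstar - w) <= v tstar mstar - v tstar w.
Hypothesis hmE : forall k w, same_active A b tstar (th k) -> M w ->
  dotp (hm k) (w - u k) = dotp (grad (v (th k)) (u k)) (w - u k).
Hypothesis c1_gt0 : 0 < c1.
Hypothesis f_growth : forall t, Theta t ->
  c1 * enorm (t - tstar) ^+ 2 <= f t - f tstar.
Hypothesis v_growth : forall w, M w ->
  c1 * enorm (w - mstar) ^+ 2 <= v tstar w - v tstar mstar.
Hypothesis f_lip : forall t, Theta t ->
  enorm (grad f t - grad f tstar) <= c2 * enorm (t - tstar).
Hypothesis v_lip : forall w, M w ->
  enorm (grad (v tstar) w - grad (v tstar) mstar) <= c2 * enorm (w - mstar).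
Hypothesis v_lip3 : forall t w, Theta t -> same_active A b tstar t -> M w ->
  enorm (grad (v t) w - grad (v tstar) w) <= c3 * enorm (t - tstar) ^+ 2.
Hypothesis MD : forall w, M w -> enorm (w - mstar) <= D.
Variables (lambda1 : 'cV[R]_(#|active A b tstar|)).
Variables (lambda2 : 'cV[R]_(#|active C d mstar|)).
Hypothesis lambda1_gt0 : vlt 0 lambda1.
Hypothesis lambda2_gt0 : vlt 0 lambda2.
Hypothesis f_opt : - grad f tstar = (act_mx A b tstar)^T *m lambda1.
Hypothesis v_opt : - grad (v tstar) mstar = (act_mx C d mstar)^T *m lambda2.

Let xit k := gt k - grad f (th k).
Let xim k := gm k - hm k.

Hypothesis xit_cvg : forall i,
  cvgn (series (fun k => a k * xit k i 0) : nat -> R^o).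
Hypothesis xit_mul_cvg : forall i,
  cvgn (series (fun k => a k * ((th k - tstar) i 0 * xit k i 0)) : nat -> R^o).
Hypothesis gt_sqr_cvg : forall i,
  cvgn (series (fun k => (a k * gt k i 0) ^+ 2) : nat -> R^o).
Hypothesis xim_cvg : forall i,
  cvgn (series (fun k => a k * xim k i 0) : nat -> R^o).
Hypothesis xim_mul_cvg : forall i,
  cvgn (series (fun k => a k * ((u k - mstar) i 0 * xim k i 0)) : nat -> R^o).
Hypothesis gm_sqr_cvg : forall i,
  cvgn (series (fun k => (a k * gm k i 0) ^+ 2) : nat -> R^o).

Let Tth k : Theta (th k). Proof. by have [] := tproj k. Qed.
Let Mu k : M (u k). Proof. by have [] := mproj k. Qed.

Let th_cvg : dotp (th k - tstar) (th k - tstar) @[k --> \oo] --> (0 : R) /\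
  cvgn (series (fun k => a k * dotp (th k - tstar) (th k - tstar)) : nat -> R^o).
Proof.
apply: (noisy_dual_averaging_cvg Kt a0 ainfty ztS tproj (xi := xit) (c := c1)
  (eps := fun=> 0) (n0 := 0)) => //.
  under [X in series X]eq_fun do rewrite mulr0.
  apply/cvg_ex; exists 0; apply: cvg_near_cst; apply: nearW => k.
  by rewrite /series /= big1.
move=> k _; have -> : gt k - xit k = grad f (th k).
  by rewrite /xit opprB addrC subrK.
rewrite subr0 -enorm_sqr.
have := f_first_order (Tth k); have := f_growth (Tth k).
by rewrite -(opprB (th k) tstar) dotpNr; lra.
Qed.

Let th_enorm_cvg0 : enorm (th k - tstar) @[k --> \oo] --> (0 : R).
Proof. by apply: enorm_cvg0; have [] := th_cvg. Qed.

Let th_same_active : \forall k \near \oo, same_active A b tstar (th k).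
Proof.
apply: (noisy_dual_averaging_identification Kt a0 ainfty ztS tproj (xi := xit)
  (gam := grad f tstar) (lambda := lambda1)) => //; first by have [] := th_cvg.
move=> i; have -> : (fun k => gt k i 0 - xit k i 0) = (fun k => grad f (th k) i 0).
  by apply/funext => k; rewrite /xit mxE [X in - (_ + X)]mxE opprD opprK addNKr.
apply: (enorm_cvg_coord (e := fun k => c2 * enorm (th k - tstar))).
  by apply: nearW => k; exact: f_lip.
by rewrite -(mulr0 c2); apply: cvgMr.
Qed.

Let u_cvg (N : nat) : (forall k, (N <= k)%N -> same_active A b tstar (th k)) ->
  dotp (u k - mstar) (u k - mstar) @[k --> \oo] --> (0 : R).
Proof.
move=> actN.
suff [] : dotp (u k - mstar) (u k - mstar) @[k --> \oo] --> (0 : R) /\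
  cvgn (series (fun k => a k * dotp (u k - mstar) (u k - mstar)) : nat -> R^o) by [].
(* In [eps], [c3] comes from the bias of the gradient and [D] from the distance of [u k] to [mstar];
   the second half of [th_cvg] makes it summable against the steps. *)
apply: (noisy_dual_averaging_cvg Km a0 ainfty zmS mproj (xi := xim) (c := c1)
  (eps := fun k => c3 * D * dotp (th k - tstar) (th k - tstar)) (n0 := N)) => //.
  have [_ h] := th_cvg.
  have -> : series (fun k => a k * (c3 * D * dotp (th k - tstar) (th k - tstar))) =
      (c3 * D) *: (series (fun k => a k * dotp (th k - tstar) (th k - tstar)) : nat -> R^o).
    apply/funext => k; rewrite /series /= !fctE /GRing.scale /= mulr_sumr.
    by apply: eq_bigr => j _; ring.
  exact: is_cvgZr.
move=> k Nk; have act := actN k Nk.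
have -> : gm k - xim k = hm k by rewrite /xim opprB addrC subrK.
have := hmE act Km; rewrite -(opprB (u k) mstar) !dotpNr => /oppr_inj ->.
have := v_first_order (Mu k); have := v_growth (Mu k).
rewrite -(opprB (u k) mstar) dotpNr -!enorm_sqr => h1 h2.
have h3 : `|dotp (grad (v (th k)) (u k) - grad (v tstar) (u k)) (u k - mstar)|
    <= c3 * enorm (th k - tstar) ^+ 2 * D.
  apply: le_trans (dotp_le_enorm _ _) _.
  by apply: ler_pM; rewrite ?enorm_ge0 ?v_lip3 ?MD.
have := lerNnormlW h3.
by rewrite (dotpDl (grad (v (th k)) (u k))) dotpNl; lra.
Qed.

Lemma eventually_same_active_pair : \forall k \near \oo,
  same_active A b tstar (th k) /\ same_active C d mstar (u k).
Proof.
have [N _ actN] := th_same_active.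
have ucvg := u_cvg actN.
(* Identification averages the gradients coordinate by coordinate, but [hm] is known only along
   differences of points of [M]. From [N] on, [gm'] has the true gradient in its place, with the
   same noise. The resulting dual sequence differs from [zm] by vectors orthogonal to these
   differences, so [u k] is still its projection. *)
pose gm' k := if (k < N)%N then gm k else grad (v (th k)) (u k) + xim k.
pose zm' k := zm 0 - \sum_(0 <= j < k) a j *: gm' j.
have zm'S k : zm' k.+1 = zm' k - a k *: gm' k.
  by rewrite /zm' big_nat_recr//= opprD addrA.
(* [M] only sees the gradients along [M - M], where [gm'] and [gm] agree. *)
have orth k w : M w -> dotp (gm' k - gm k) (w - u k) = 0.
  move=> Mw; rewrite /gm'; case: ltnP => [_|/actN act]; first by rewrite subrr dotp0l.
  rewrite -addrA dotpDl /xim addrAC subrr add0r dotpNl hmE// subrr//.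
have zorth k w w' : M w -> M w' -> dotp (zm' k - zm k) (w - w') = 0.
  move=> Mw Mw'; elim: k => [|k IH].
    by rewrite /zm' big_geq// subr0 subrr dotp0l.
  have -> : zm' k.+1 - zm k.+1 = (zm' k - zm k) - a k *: (gm' k - gm k).
    by apply/colP => i; rewrite zm'S zmS !mxE; ring.
  rewrite dotpDl IH dotpNl dotpZl add0r.
  have -> : w - w' = (w - u k) - (w' - u k) by rewrite opprB addrA subrK.
  by rewrite dotpDr dotpNr !orth// subrr mulr0 oppr0.
have mproj' k : projects C d (zm' k) (u k).
  have [Mk vi] := mproj k; split => // w Mw.
  have := zorth k w (u k) Mw Mk; have := vi w Mw.
  rewrite !dotpE; lra.
have h : \forall k \near \oo, same_active C d mstar (u k).
  apply: (noisy_dual_averaging_identification Km a0 ainfty zm'S mproj' (xi := xim)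
    (gam := grad (v tstar) mstar) (lambda := lambda2)) => //.
  move=> i; have vdiff : (grad (v (th k)) (u k) - grad (v tstar) (u k)) i 0
      @[k --> \oo] --> (0 : 'cV[R]_m) i 0.
    apply: (enorm_cvg_coord (e := fun k => c3 * enorm (th k - tstar) ^+ 2)).
      by exists N => // k /= Nk; rewrite subr0; apply: v_lip3 => //; exact: actN.
    rewrite -(mulr0 c3); apply: cvgMr; under eq_fun do rewrite enorm_sqr.
    by have [] := th_cvg.
  have vstar : grad (v tstar) (u k) i 0 @[k --> \oo] --> grad (v tstar) mstar i 0.
    apply: (enorm_cvg_coord (e := fun k => c2 * enorm (u k - mstar))).
      by apply: nearW => k; exact: v_lip.
    by rewrite -(mulr0 c2); apply: cvgMr; exact: enorm_cvg0.
  have e0 : (0 : 'cV[R]_m) i 0 = 0 :> R by rewrite mxE.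
  have hs : ((grad (v (th k)) (u k) - grad (v tstar) (u k)) i 0 +
      grad (v tstar) (u k) i 0) @[k --> \oo] --> grad (v tstar) mstar i 0.
    by rewrite -[X in _ --> X]add0r -e0; exact: cvgD.
  apply: cvg_trans hs; apply: near_eq_cvg; exists N => // k /= Nk.
  rewrite /gm' ltnNge Nk /= [X in _ = X - _]mxE addrK.
  by rewrite [X in X + _]mxE [X in _ + X + _]mxE subrK.
near=> k; split; near: k; [exists N|]; exact.
Unshelve. all: by end_near. Qed.

End pathwise.

(** * The random index and the almost sure conclusion *)

(** [N w] is the least [k] with [w] in [good k], and 0 on the null set [bad]. The unions of [good k]
    with [bad] increase with [k] and are exactly the events [N w <= k], which makes [N]
    measurable. *)
Lemma measurable_eventual_index d (T : measurableType d) (R : realType)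
    (Q : probability T R) (S : nat -> set T) :
  (forall n, measurable (S n)) ->
  {ae Q, forall w, \forall n \near \oo, S n w} ->
  exists N : T -> nat, measurable_fun setT N /\
    {ae Q, forall w n, (N w <= n)%N -> S n w}.
Proof.
move=> mS aeS.
pose good k : set T := \bigcap_(n in [set n | (k <= n)%N]) S n.
have mgood k : measurable (good k).
  by apply: bigcap_measurable => [|n _]; [exists k => /=|exact: mS].
have good_le k l : (k <= l)%N -> good k `<=` good l.
  by move=> kl w h n /= ln; apply: h; exact: leq_trans ln.
pose bad : set T := ~` \bigcup_k good k.
have mbad : measurable bad by apply/measurableC/bigcupT_measurable.
have Nex w : exists n, forall k, (n <= k)%N <-> (good k `|` bad) w.
  have [[k gk]|nb] := pselect (exists k, good k w).
    have exk : exists k, `[< good k w >] by exists k; apply/asboolP.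
    exists (ex_minn exk); case: ex_minnP => n /asboolP gn nmin l; split.
      by move=> nl; left; exact: good_le nl _ gn.
    by move=> [/asboolP/nmin//|]; case; exists k.
  exists 0%N => k; split => // _; right => -[l _ gl].
  by apply: nb; exists l.
have [N NP] := choice Nex.
exists N; split.
  move=> _ B _; rewrite setTI.
  have mle k : measurable [set w | (N w <= k)%N].
    have -> : [set w | (N w <= k)%N] = good k `|` bad.
      by apply/seteqP; split => w /NP.
    exact: measurableU.
  have meq k : measurable [set w | N w = k].
    case: k => [|k].
      have -> : [set w | N w = 0%N] = [set w | (N w <= 0)%N].
        by apply/seteqP; split => w /=; rewrite leqn0 => /eqP.
      exact: mle.
    have -> : [set w | N w = k.+1] =
        [set w | (N w <= k.+1)%N] `\` [set w | (N w <= k)%N].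
      apply/seteqP; split => w /=; first by move=> ->; rewrite ltnn.
      move=> [le1 /negP]; rewrite -ltnNge => le2.
      by apply/eqP; rewrite eqn_leq le1.
    exact: measurableD.
  have -> : N @^-1` B = \bigcup_(k in B) [set w | N w = k].
    by apply/seteqP; split => w /=; [move=> Bw; exists (N w)|move=> [k Bk /= ->]].
  exact: bigcup_measurable.
apply: filterS aeS => w [k _ kS] n Nn.
have [gn|] := (NP w n).1 Nn; first exact: gn _ (leqnn n).
by case; exists k.
Qed.

Lemma cvgn_series_eq (R : realType) (e1 e2 : nat -> R) : (forall k, e1 k = e2 k) ->
  cvgn (series e1 : nat -> R^o) -> cvgn (series e2 : nat -> R^o).
Proof. by move=> e12; have -> : e1 = e2 by exact/funext. Qed.

Lemma ae_forall d (T : measurableType d) (R : realType)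
    (Q : {measure set T -> \bar R}) (I : finType) (S : I -> T -> Prop) :
  (forall i, {ae Q, forall w, S i w}) -> {ae Q, forall w i, S i w}.
Proof. exact: filter_forall. Qed.

Lemma ae_and d (T : measurableType d) (R : realType)
    (Q : {measure set T -> \bar R}) (S1 S2 : T -> Prop) :
  {ae Q, forall w, S1 w} -> {ae Q, forall w, S2 w} ->
  {ae Q, forall w, S1 w /\ S2 w}.
Proof. exact: filterI. Qed.

Lemma same_active_refl (R : realType) (p n : nat) (A : 'M[R]_(p, n)) b t :
  polyhedron A b t -> same_active A b t t.
Proof.
move=> Kt; split.
  apply/colP => i; rewrite [LHS]subrows_mul [RHS]mxE.
  by have := enum_valP i; rewrite inE => /eqP.
move=> i; rewrite [ltLHS]subrows_mul [ltRHS]mxE.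
have := enum_valP i; rewrite inE lt_neqAle (Kt _) andbT.
by rewrite inE.
Qed.

Lemma measurable_same_active d (T : measurableType d) (R : realType) (p n : nat)
    (A : 'M[R]_(p, n)) (b : 'cV[R]_p) t0 (t : T -> 'cV[R]_n) :
  measurable_fun setT (t : T -> borel_cV R n) ->
  measurable [set w | same_active A b t0 (t w)].
Proof.
move=> mt.
have mB k (B : 'M[R]_(k, n)) i : measurable_fun setT (fun w => (B *m t w) i 0).
  under eq_fun do rewrite mxE.
  apply: measurable_sum => j; apply: measurable_funM => //.
  exact: measurable_fun_coord.
have -> : [set w | same_active A b t0 (t w)] =
    [set w | forall i, (act_mx A b t0 *m t w) i 0 == act_rhs A b t0 i 0] `&`
    [set w | forall i, (inact_mx A b t0 *m t w) i 0 < inact_rhs A b t0 i 0].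
  apply/seteqP; split => w /= [h1 h2]; split => //.
    by move=> i; rewrite h1.
  by apply/colP => i; apply/eqP.
apply: measurableI; apply: measurable_forall => i.
  have := measurable_fun_eqr (mB _ (act_mx A b t0) i)
    (measurable_cst (act_rhs A b t0 i 0)).
  by move=> /(_ measurableT [set true] I); rewrite setTI.
have := measurable_fun_ltr (mB _ (inact_mx A b t0) i)
  (measurable_cst (inact_rhs A b t0 i 0)).
by move=> /(_ measurableT [set true] I); rewrite setTI.
Qed.

Lemma convex_function_segment (R : realType) (n : nat) (S : set 'cV[R]_n)
    (f : 'cV[R]_n -> R) t u tau :
  convex_function (S : set (convex_lmodType 'cV[R]_n)) f ->
  S t -> S u -> 0 < tau <= 1 ->
  f (t + tau *: (u - t)) <= f t + tau * (f u - f t).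
Proof.
move=> fc St Su /andP[tau0 tau1].
have := fc (Itv01 (ltW tau0) tau1) u t (mem_set Su) (mem_set St).
rewrite convRE /= => h.
have -> : t + tau *: (u - t) = tau *: u + (1 - tau) *: t.
  by apply/colP => i; rewrite !mxE; ring.
by apply: le_trans h _; rewrite /unstable.onem; lra.
Qed.

Theorem proposition5p5 (R : realType) (s r m p q : nat)
  (* feasible sets *)
  (A : 'M[R]_(p, s)) (b : 'cV[R]_p) (C : 'M[R]_(q, m)) (d : 'cV[R]_q)
  (* distributions, integrand and likelihood ratio *)
  (P : probability (borel_cV R r) R)
  (Pmu : 'cV[R]_m -> probability (borel_cV R r) R)
  (F : 'cV[R]_s -> 'cV[R]_r -> R) (ell : 'cV[R]_r -> 'cV[R]_m -> R)
  (* the algorithm: Y k is the draw from P_{mu_{k-1}}, X k the draw from P *)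
  (alpha gamma : R)
  (disp : measure_display) (Omega : measurableType disp)
  (Q : probability Omega R)
  (Y X : nat -> Omega -> borel_cV R r)
  (theta : nat -> Omega -> 'cV[R]_s) (mu : nat -> Omega -> 'cV[R]_m)
  (theta0 : 'cV[R]_s) (mu0 : 'cV[R]_m)
  (* solutions and constants *)
  (tstar : 'cV[R]_s) (mstar : 'cV[R]_m) (GM HM c1 c2 c3 : R) :
  let Theta := polyhedron A b in
  let M := polyhedron C d in
  let f := f_obj P F in
  let G := G_fun F in
  let v := v_obj A b P F ell in
  (* setup: F and its gradient *)
  measurable_fun [set: borel_cV R s * borel_cV R r] (fun z => F z.1 z.2) ->
  (forall t, Theta t -> P.-integrable setT (fun x => (F t x)%:E)) ->
  (forall t x, Theta t -> gdifferentiable (fun u => F u x) t) ->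
  (forall t i, Theta t -> P.-integrable setT (fun x => (G t x i 0)%:E)) ->
  (forall t, Theta t -> grad f t = \col_i \int[P]_x (G t x i 0)) ->
  (* setup: importance sampling family *)
  measurable_fun [set: borel_cV R r * borel_cV R m] (fun z => ell z.1 z.2) ->
  (forall u, M u -> P `<< Pmu u) ->
  (forall u, M u -> ae_eq (Pmu u) setT
     (fun x => (ell x u)%:E)
     (Radon_Nikodym (charge_of_finite_measure P) (Pmu u))) ->
  (* algorithm *)
  0 < alpha -> 2^-1 < gamma < 1 ->
  Theta theta0 -> M mu0 ->
  (forall w, theta 0%N w = theta0) -> (forall w, mu 0%N w = mu0) ->
  (forall k, measurable_fun setT (Y k.+1)) ->
  (forall k, measurable_fun setT (X k.+1)) ->
  (forall n w,
     argmin (Theta `*` M)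
       (da_objective (step alpha gamma) theta0 mu0
          (fun k => Gmu_fun F ell (mu k w) (theta k w) (Y k.+1 w))
          (fun k => H_fun A b F ell (theta k w) (mu k w) (X k.+1 w)) n)
     = [set (theta n.+1 w, mu n.+1 w)]) ->
  (forall n (B1 B2 : set (borel_cV R r)), measurable B1 -> measurable B2 ->
     cond_prob_version Q (history Y X n)
       (Y n.+1 @^-1` B1 `&` X n.+1 @^-1` B2)
       (fun w => Pmu (mu n w) B1 * P B2)%E) ->
  (* (a) *)
  convex_function (Theta : set (convex_lmodType 'cV[R]_s)) f ->
  C1_on Theta f -> C2_near f tstar ->
  argmin Theta f = [set tstar] -> sym_posdef (hess f tstar) ->
  bounded_set Theta ->
  (* (b) *)
  (forall x, log_convex_on M (ell x)) ->
  (forall x u, M u -> gdifferentiable (ell x) u) ->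
  (* (c) *)
  argmin M (v tstar) = [set mstar] ->
  twice_differentiable (v tstar) mstar -> sym_posdef (hess (v tstar) mstar) ->
  bounded_set M ->
  (forall t u, Theta t -> M u ->
     (\int[P]_x (enorm (G t x) ^+ 2 * ell x u)%:E <= (GM ^+ 2)%:E)%E) ->
  (forall t u, Theta t -> M u ->
     (\int[P]_x (enorm (PG_fun A b F t x) ^+ 4
                 * enorm (grad (ell x) u) ^+ 2)%:E <= (HM ^+ 2)%:E)%E) ->
  (* (d) *)
  0 < c1 ->
  (forall t, Theta t -> c1 * enorm (t - tstar) ^+ 2 <= f t - f tstar) ->
  (forall u, M u ->
     c1 * enorm (u - mstar) ^+ 2 <= v tstar u - v tstar mstar) ->
  (forall t, Theta t ->
     enorm (grad f t - grad f tstar) <= c2 * enorm (t - tstar)) ->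
  (forall u, M u ->
     enorm (grad (v tstar) u - grad (v tstar) mstar) <= c2 * enorm (u - mstar)) ->
  (forall t u, Theta t -> same_active A b tstar t -> M u ->
     gdifferentiable (v t) u) ->
  (forall t u, Theta t -> same_active A b tstar t -> M u ->
     enorm (grad (v t) u - grad (v tstar) u) <= c3 * enorm (t - tstar) ^+ 2) ->
  (* (e) *)
  (exists lambda1, vlt 0 lambda1 /\
     - grad f tstar = (act_mx A b tstar)^T *m lambda1) ->
  (exists lambda2, vlt 0 lambda2 /\
     - grad (v tstar) mstar = (act_mx C d mstar)^T *m lambda2) ->
  exists N : Omega -> nat, measurable_fun setT N /\
    {ae Q, forall w, forall n, (N w <= n)%N ->
       same_active A b tstar (theta n w) /\ same_active C d mstar (mu n w)}.
Proof.
move=> Theta M f G v mF iF dF iG gradfE mell PPmu ellE alpha0 gammaP Ktheta0 Mmu0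
  theta_0 mu_0 mY mX argE condE fconv fC1 _ fmin _ Tbd ellc dell vmin _ _ Mbd
  GMP HMP c1_gt0 fgrow vgrow flip vlip dv vlip3 [lambda1 [l1 fopt]]
  [lambda2 [l2 vopt]].
have Kt : Theta tstar.
  by have [] : argmin Theta f tstar by rewrite fmin.
have Km : M mstar.
  by have [] : argmin M (v tstar) mstar by rewrite vmin.
have [DT DTP] := bounded_enorm tstar Tbd.
have [DM DMP] := bounded_enorm mstar Mbd.
have adapted := theta_mu_adapted mF mell dF dell Ktheta0 Mmu0 theta_0 mu_0 argE.
have projs := theta_mu_projects Ktheta0 Mmu0 theta_0 mu_0 argE.
have Kth n w : Theta (theta n w) by have [[]] := projs n w.
have Mmu n w : M (mu n w) by have [_ []] := projs n w.
apply: (measurable_eventual_index (S := fun n => [set w |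
  same_active A b tstar (theta n w) /\ same_active C d mstar (mu n w)])).
  move=> n; have [mt mm _ _] := adapted n.
  have HT k := @history_sub_measurable _ Omega _ (borel_cV R r) Y X k mY mX.
  apply: measurableI; apply: measurable_same_active.
    exact: (measurable_fun_history HT mt).
  exact: (measurable_fun_history HT mm).
have mcoord k n0 (x : 'cV[R]_n0) (t : nat -> Omega -> 'cV[R]_n0) i :
  measurable_fun setT
    (t k : g_sigma_algebraType (history Y X k) -> borel_cV R n0) ->
  measurable_fun setT
    ((fun w => (t k w - x) i 0) : g_sigma_algebraType (history Y X k) -> R).
  move=> mt; under eq_fun do rewrite !mxE.
  by apply: measurable_funB => //; exact: (measurable_fun_coord i mt).
have noise_t := theta_noise_cvg mF mell dF dell iG PPmu ellE ellc GMP gammaP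
  Ktheta0 Mmu0 theta_0 mu_0 mY mX argE condE.
have noise_m := mu_noise_cvg mF mell dF dell HMP gammaP
  Ktheta0 Mmu0 theta_0 mu_0 mY mX argE condE.
have one_le (k : nat) (w : Omega) : `|1 : R| <= 1 by rewrite normr1.
have mone k : measurable_fun setT
  ((fun=> 1) : g_sigma_algebraType (history Y X k) -> R).
  exact: measurable_cst.
have mct i k : measurable_fun setT
    ((fun w => (theta k w - tstar) i 0) : g_sigma_algebraType (history Y X k) -> R).
  by apply: mcoord; have [] := adapted k.
have mcm i k : measurable_fun setT
    ((fun w => (mu k w - mstar) i 0) : g_sigma_algebraType (history Y X k) -> R).
  by apply: mcoord; have [] := adapted k.
have ct_le i k w : `|(theta k w - tstar) i 0| <= DT.
  by apply: le_trans (coord_le_enorm _ _) (DTP _ (Kth k w)).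
have cm_le i k w : `|(mu k w - mstar) i 0| <= DM.
  by apply: le_trans (coord_le_enorm _ _) (DMP _ (Mmu k w)).
(* The multiplier 1 gives the plain noise series, needed to average the gradients; the coordinates
   of [theta k w - tstar] give the series that enters the energy. *)
have t1 := ae_forall (fun i => noise_t i (fun _ _ => 1) 1 mone one_le).
have t2 := ae_forall (fun i => noise_t i _ DT (mct i) (ct_le i)).
have t3 := ae_forall (theta_grad_sqr_cvg mF mell dF dell PPmu ellE ellc GMP
  gammaP Ktheta0 Mmu0 theta_0 mu_0 mY mX argE condE).
have m1 := ae_forall (fun i => noise_m i (fun _ _ => 1) 1 mone one_le).
have m2 := ae_forall (fun i => noise_m i _ DM (mcm i) (cm_le i)).
have m3 := ae_forall (mu_grad_sqr_cvg mF mell dF dell HMP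
  gammaP Ktheta0 Mmu0 theta_0 mu_0 mY mX argE condE).
(* The point [tstar] has its own active set, so [v tstar] is differentiable on [M] and [H_mean]
   applies at [tstar]. *)
have v_first_order u : M u ->
    dotp (grad (v tstar) u) (mstar - u) <= v tstar mstar - v tstar u.
  move=> Mu; have dvu := dv _ _ Kt (same_active_refl Kt) Mu.
  by have [] := H_mean mF mell dF dell ellc GMP HMP Kt Mu dvu Km.
have f_first_order t : Theta t -> dotp (grad f t) (tstar - t) <= f tstar - f t.
  move=> Tt; apply: convex_segment_grad; first by have [+ _] := fC1; apply.
  by move=> tau tau01; exact: (convex_function_segment fconv).
have := ae_and (ae_and t1 (ae_and t2 t3)) (ae_and m1 (ae_and m2 m3)).
apply: filterS => w [[t1w [t2w t3w]] [m1w [m2w m3w]]].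
have gradfE' k : \col_i \int[P]_x (G_fun F (theta k w) x i 0) = grad f (theta k w).
  by rewrite gradfE.
apply: (@eventually_same_active_pair R p q s m A b C d f v tstar mstar c1 c2 c3 DM
  (fun k => step alpha gamma k.+1) (theta ^~ w) _ (fun k => theta_grad F ell Y theta mu k w)
  (mu ^~ w) _ (fun k => mu_grad A b F ell X theta mu k w)
  (fun k => mu_mean A b P F ell theta mu k w)
  Kt Km (step_gt0 gamma alpha0) (step_series_infty alpha0 gammaP)
  (fun k => theta_dualS _ _ _ _ _ _ _ _ k w) (fun k => mu_dualS _ _ _ _ _ _ _ _ _ _ k w)
  (fun k => (projs k w).1) (fun k => (projs k w).2) f_first_order v_first_order _
  c1_gt0 fgrow vgrow flip vlip vlip3 DMP lambda1 lambda2 l1 l2 fopt vopt).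
- move=> k u act Mu.
  have dvk := dv _ _ (Kth k w) act (Mmu k w).
  by have [] := H_mean mF mell dF dell ellc GMP HMP (Kth k w) (Mmu k w) dvk Mu.
- move=> i; apply: cvgn_series_eq (t1w i) => k.
  by rewrite mul1r /theta_noise gradfE'.
- move=> i; apply: cvgn_series_eq (t2w i) => k.
  by rewrite /theta_noise gradfE'.
- exact: t3w.
- by move=> i; apply: cvgn_series_eq (m1w i) => k; rewrite mul1r.
- exact: m2w.
- exact: m3w.
Qed.
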